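(* Let $k>0$, $c\in\mathbb{R}$, $x>0$, and let $\alpha,\beta,\eta,\lambda,v\in\mathbb{C}$ be such that $\Re(v)>-1$, $\Re(\alpha)>0$ and $\Re(\lambda+v)>\max[0,\Re(\beta-\eta)]$. Suppose that $\frac{\lambda}{k}+\frac{v}{k}$ and $\frac{\lambda}{k}+\frac{v}{k}+\eta-\beta$ are not in $\{0,-1,-2,\dots\}$, and that none of the five lower parameters of the ${}_4F_5$ below is in $\{0,-1,-2,\dots\}$. Then $$\left(I_{0+}^{\alpha,\beta,\eta}\,t^{\frac{\lambda}{k}-1}W_{v,c}^{k}(t)\right)(x)=\frac{x^{\frac{\lambda}{k}+\frac{v}{k}-\beta-1}}{(2k)^{\frac{v}{k}}}\,\frac{\Gamma\left(\frac{\lambda}{k}+\frac{v}{k}\right)\Gamma\left(\frac{\lambda}{k}+\frac{v}{k}+\eta-\beta\right)}{\Gamma\left(\frac{\lambda}{k}+\frac{v}{k}-\beta\right)\Gamma\left(\frac{\lambda}{k}+\frac{v}{k}+\alpha+\eta\right)\Gamma\left(\frac{v}{k}+1\right)}$$ $$\times\;{}_4F_5\left[\begin{array}{c}\frac{\lambda}{2k}+\frac{v}{2k},\ \frac{\lambda}{2k}+\frac{v}{2k}+\frac12,\ \frac{\lambda}{2k}+\frac{v}{2k}+\frac{\eta-\beta}{2},\ \frac{\lambda}{2k}+\frac{v}{2k}+\frac{\eta-\beta+1}{2}\\ \frac{v}{k}+1,\ \frac{\lambda}{2k}+\frac{v}{2k}-\frac{\beta}{2},\ \frac{\lambda}{2k}+\frac{v}{2k}-\frac{\beta-1}{2},\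 \frac{\lambda}{2k}+\frac{v}{2k}+\frac{\alpha+\eta}{2},\ \frac{\lambda}{2k}+\frac{v}{2k}+\frac{\alpha+\eta+1}{2}\end{array};-\frac{cx^2}{4k}\right].$$
   Context: Saigo's left-sided generalized fractional integral is defined for $x>0$, $\alpha,\beta,\eta\in\mathbb{C}$, $\Re(\alpha)>0$ by $$\left(I_{0+}^{\alpha,\beta,\eta}f\right)(x)=\frac{x^{-\alpha-\beta}}{\Gamma(\alpha)}\int_0^x (x-t)^{\alpha-1}\,{}_2F_1\left(\alpha+\beta,-\eta;\alpha;1-\tfrac{t}{x}\right)f(t)\,dt,$$ where ${}_2F_1$ is the Gauss hypergeometric function. The notation $\left(I_{0+}^{\alpha,\beta,\eta}g(t)\right)(x)$ means the operator applied to $t\mapsto g(t)$ on $(0,\infty)$ and evaluated at $x$. The $k$-Bessel function is $$W_{v,c}^{k}(z)=\sum_{n=0}^{\infty}\frac{(-c)^n}{\Gamma_k(nk+v+k)\,n!}\left(\frac{z}{2}\right)^{2n+\frac{v}{k}},$$ where $\Gamma_k(z)=\int_0^\infty t^{z-1}e^{-t^k/k}\,dt$ for $\Re(z)>0$, extended by $\Gamma_k(z)=k^{\frac{z}{k}-1}\Gamma\left(\frac{z}{k}\right)$. The generalized hypergeometric function is $${}_pF_q\left[\begin{array}{c}a_1,\dots,a_p\\ b_1,\dots,b_q\end{array};z\right]=\sum_{n=0}^\infty\frac{(a_1)_n\cdots(a_p)_n}{(b_1)_n\cdots(b_q)_n}\frac{z^n}{n!},\qquad b_j\ne0,-1,-2,\dots,$$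 where $(a)_n$ is the Pochhammer symbol. Complex powers of positive reals are $y^s=e^{s\log y}$.
   Formalization: The integral can diverge when k>1 (e.g. k=4, c=v=0, λ=α=1, β=1/8, η=−3/8), so the formula is stated whenever the integral converges absolutely; convergence is proved if Re(λ/k+v/k)>max[0,Re(β−η)], which holds automatically for k≤1. *)

(* Defs.v *)
From mathcomp Require Import all_boot all_order all_algebra.
From mathcomp Require Import all_classical all_reals all_analysis.
From mathcomp Require Import complex.

Set Implicit Arguments.
Unset Strict Implicit.
Unset Printing Implicit Defensive.

Import Order.TTheory GRing.Theory Num.Theory.
Import numFieldNormedType.Exports.

Local Open Scope classical_set_scope.
Local Open Scope complex_scope.
Local Open Scope ring_scope.

(* Projections of the pair type R[i], with values in R. *)
Local Notation Re := complex.Re.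
Local Notation Im := complex.Im.

Definition cexp {R : realType} (z : R[i]) : R[i] :=
  (expR (Re z))%:C * (cos (Im z) +i* sin (Im z)).

(* y ^ s = exp (s log y); only meaningful for y > 0. *)
Definition cpow {R : realType} (y : R) (s : R[i]) : R[i] :=
  cexp (s * (ln y)%:C).

Definition csum {R : realType} (u : nat -> R[i]) : R[i] :=
  limn (series (fun n => Re (u n))) +i* limn (series (fun n => Im (u n))).

Definition cintegrable {R : realType} (D : set R) (f : R -> R[i]) : Prop :=
  (@lebesgue_measure R).-integrable D (fun t => (Re (f t))%:E) /\
  (@lebesgue_measure R).-integrable D (fun t => (Im (f t))%:E).

Definition cint {R : realType} (D : set R) (f : R -> R[i]) : R[i] :=
  (\int[@lebesgue_measure R]_(t in D) Re (f t)) +i*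
  (\int[@lebesgue_measure R]_(t in D) Im (f t)).

Definition pochhammer {R : realType} (a : R[i]) (n : nat) : R[i] :=
  \prod_(i < n) (a + i%:R).

Definition nonpos_integer {R : realType} (z : R[i]) : Prop :=
  exists m : nat, z = - m%:R.

Definition Gamma_integral {R : realType} (z : R[i]) : R[i] :=
  cint `]0, +oo[ (fun t => cpow t (z - 1) * (expR (- t))%:C).

(* For Re z <= 0, Gamma (z) = Gamma (z + N) / (z (z + 1) ... (z + N - 1)), where
   N > |Re z|, so that Re (z + N) > 0. At the poles this evaluates to 0. *)
Definition Gamma {R : realType} (z : R[i]) : R[i] :=
  if 0 < Re z then Gamma_integral z
  else let N := Num.bound (Re z) in
       Gamma_integral (z + N%:R) / pochhammer z N.

Definition Gammak {R : realType} (k : R) (z : R[i]) : R[i] :=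
  if 0 < Re z then
    cint `]0, +oo[ (fun t => cpow t (z - 1) * (expR (- (t `^ k / k)))%:C)
  else cpow k (z / k%:C - 1) * Gamma (z / k%:C).

(* W_{v,c}^k (z) at a positive real z. *)
Definition besselk {R : realType} (k c : R) (v : R[i]) (z : R) : R[i] :=
  csum (fun n => ((- c) ^+ n)%:C / (Gammak k ((n%:R * k)%:C + v + k%:C) * n`!%:R)
                 * cpow (z / 2) (n.*2%:R + v / k%:C)).

(* pFq [a; b; z], where p and q are the lengths of a and b. *)
Definition hypergeometric {R : realType} (a b : seq R[i]) (z : R[i]) : R[i] :=
  csum (fun n => (\prod_(s <- a) pochhammer s n) / (\prod_(s <- b) pochhammer s n)
                 * (z ^+ n / n`!%:R)).

Definition saigo_integrand {R : realType} (alpha beta eta : R[i])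
    (f : R -> R[i]) (x t : R) : R[i] :=
  cpow (x - t) (alpha - 1)
  * hypergeometric [:: alpha + beta; - eta] [:: alpha] (1 - t / x)%:C
  * f t.

(* saigo below is total: its value is meaningful when the integral over (0, x)
   converges absolutely. *)
Definition saigo_defined {R : realType} (alpha beta eta : R[i])
    (f : R -> R[i]) (x : R) : Prop :=
  cintegrable `]0, x[ (saigo_integrand alpha beta eta f x).

Definition saigo {R : realType} (alpha beta eta : R[i])
    (f : R -> R[i]) (x : R) : R[i] :=
  cpow x (- alpha - beta) / Gamma alpha
  * cint `]0, x[ (saigo_integrand alpha beta eta f x).

(* Main.v *)
From HB Require Import structures.
Require Import Defs.
From mathcomp Require Import all_boot all_order all_algebra.
From mathcomp Require Import all_classical all_reals all_analysis.
From mathcomp Require Import measurable_realfun.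
From mathcomp Require Import complex.
From mathcomp Require Import ring lra.
Set Implicit Arguments.
Unset Strict Implicit.
Unset Printing Implicit Defensive.
Import Order.TTheory GRing.Theory Num.Theory.
Import numFieldNormedType.Exports.
Local Open Scope classical_set_scope.
Local Open Scope complex_scope.
Local Open Scope ring_scope.
Local Notation Re := complex.Re.
Local Notation Im := complex.Im.
Local Notation cabs := Normc.normc.

(** Write s = lambda / k + v / k, a = alpha + beta, b = - eta. Up to the power
    t ^ (v / k) and a constant, the k-Bessel function is an entire series
    H (t) = sum_n w_n t ^ (2 n) with w_0 = 1 (besselkE), so the integrand of the
    operator is H (t) times the kernel
    K_s (t) = t ^ (s - 1) (x - t) ^ (alpha - 1) 2F1 (a, b; alpha; 1 - t / x).
    As t ^ (2 n) K_s = K_(s + 2 n) is dominated by x ^ (2 n) |K_s|, the integral is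
    sum_n w_n M (s + 2 n), where M (s) is the integral of K_s
    (kernel_bessel_integral). Everything then rests on the value of M.

    Expanding 2F1 and integrating term by term gives beta integrals, whose sum is
    M (s) = x ^ (s + alpha - 1) B (s, alpha) 2F1 (a, b; s + alpha; 1)
    (kernel_integral), and Gauss's theorem (hyp1E) evaluates the last factor as a
    quotient of Gamma functions. Since Gamma (z + 2 n) = (z)_(2 n) Gamma (z) and
    (z)_(2 n) = 4 ^ n (z / 2)_n (z / 2 + 1 / 2)_n, the terms w_n M (s + 2 n) are
    those of the 4F5.

    This computation needs the series at s + alpha to converge: either
    Re (s + eta - beta) > 0, or 2F1 is a polynomial (gauss_cond). It must be
    deduced from the convergence of the integral alone. Since H (0) <> 0,
    integrability of H K_s gives that of K_s (kernel_integrable_of_bessel). If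
    the condition failed, then M would stay bounded near the point
    theta = beta - eta, on the right of which M is known; but there M has a pole,
    because Gauss's series satisfies a contiguity relation whose residue does not
    vanish (kernel_integrable_cond).

    The theory of Gamma used above is obtained from a single limit:
    n ^ s B (s, a + n) tends to Gamma (s) by dominated convergence
    (cvg_beta_Gamma). With the recurrence of the beta integral it yields Gauss's
    product for Gamma (cvg_gprod), then B (s, a) = Gamma (s) Gamma (a) / Gamma (s + a)
    (betaE). Comparing Gauss's product at z and at Re z shows that Gamma has no
    zeros (Gamma_neq0), and the same product evaluates the limit to which the
    contiguity relation reduces Gauss's theorem. *)


(** * Complex numbers: modulus, limits and series *)

(** With the topology of its norm, [R[i]] gets the limit calculus of normed
    fields. *)
HB.instance Definition _ (R : realType) := NormedModule.copy R[i] (R[i])^o.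

Section complex_numbers.
Variable R : realType.
Implicit Types (z w : R[i]) (u v : nat -> R[i]).

Lemma Re_add z w : Re (z + w) = Re z + Re w. Proof. by case: z; case: w. Qed.
Lemma Im_add z w : Im (z + w) = Im z + Im w. Proof. by case: z; case: w. Qed.
Lemma Re_opp z : Re (- z) = - Re z. Proof. by case: z. Qed.
Lemma Im_opp z : Im (- z) = - Im z. Proof. by case: z. Qed.
Lemma Re_mul z w : Re (z * w) = Re z * Re w - Im z * Im w.
Proof. by case: z; case: w. Qed.
Lemma Im_mul z w : Im (z * w) = Re z * Im w + Im z * Re w.
Proof. by case: z; case: w. Qed.
Lemma Re_nat n : Re (n%:R : R[i]) = n%:R.
Proof. by elim: n => // n ih; rewrite -!natr1 Re_add ih. Qed.
Lemma Im_nat n : Im (n%:R : R[i]) = 0.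
Proof. by elim: n => // n ih; rewrite -!natr1 Im_add ih addr0. Qed.
Lemma natC n : (n%:R : R)%:C = n%:R :> R[i].
Proof. by rewrite rmorph_nat. Qed.

Lemma realCM (x y : R) : (x * y)%:C = x%:C * y%:C :> R[i].
Proof. exact: rmorphM. Qed.
Lemma realCV (x : R) : (x^-1)%:C = (x%:C)^-1 :> R[i].
Proof. exact: fmorphV. Qed.

Lemma complex_eq z w : Re z = Re w -> Im z = Im w -> z = w.
Proof. by case: z => a b; case: w => c d /= -> ->. Qed.

Lemma cabsE z : `|z| = (cabs z)%:C. Proof. by case: z. Qed.
Lemma cabs_ge0 z : 0 <= cabs z. Proof. by case: z => a b; exact: sqrtr_ge0. Qed.
Lemma cabsM z w : cabs (z * w) = cabs z * cabs w. Proof. exact: Normc.normcM. Qed.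
Lemma cabsV z : cabs z^-1 = (cabs z)^-1. Proof. exact: Normc.normcV. Qed.
Lemma cabs0 : cabs (0 : R[i]) = 0. Proof. exact: Normc.normc0. Qed.
Lemma cabs1 : cabs (1 : R[i]) = 1. Proof. exact: Normc.normc1. Qed.
Lemma cabsN z : cabs (- z) = cabs z.
Proof. by case: z => a b /=; rewrite !sqrrN. Qed.
Lemma cabs_eq0 z : (cabs z == 0) = (z == 0).
Proof.
apply/eqP/eqP => [|->]; [exact: Normc.eq0_normc|exact: cabs0].
Qed.
Lemma cabs_gt0 z : (0 < cabs z) = (z != 0).
Proof. by rewrite lt_def cabs_ge0 andbT cabs_eq0. Qed.
Lemma cabs_real (r : R) : cabs (r%:C) = `|r|.
Proof. by rewrite /= expr0n /= addr0 sqrtr_sqr. Qed.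
Lemma cabs_nat n : cabs (n%:R : R[i]) = n%:R.
Proof. by rewrite -natC cabs_real normr_nat. Qed.
Lemma cabsD z w : cabs (z + w) <= cabs z + cabs w.
Proof. exact: (@le_normcD R). Qed.
Lemma cabsB z w : cabs z - cabs w <= cabs (z - w).
Proof. by rewrite lerBlDr (le_trans _ (cabsD _ _))// subrK. Qed.
Lemma sqr_cabs z : cabs z ^+ 2 = Re z ^+ 2 + Im z ^+ 2.
Proof. by case: z => a b /=; rewrite sqr_sqrtr// addr_ge0 ?sqr_ge0. Qed.
Lemma Re_cabs z : `|Re z| <= cabs z.
Proof.
case: z => a b /=; rewrite -sqrtr_sqr ler_wsqrtr// lerDl sqr_ge0//.
Qed.
Lemma Im_cabs z : `|Im z| <= cabs z.
Proof.
case: z => a b /=; rewrite -sqrtr_sqr ler_wsqrtr// lerDr sqr_ge0//.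
Qed.
Lemma Re_le_cabs z : Re z <= cabs z.
Proof. exact: le_trans (ler_norm _) (Re_cabs z). Qed.
Lemma cabs_le z : cabs z <= `|Re z| + `|Im z|.
Proof.
have -> : z = (Re z)%:C + (0 +i* Im z) by case: z => a b /=; simpc.
apply: le_trans (cabsD _ _) _; rewrite cabs_real /= expr0n/= add0r sqrtr_sqr.
by rewrite addr0 add0r.
Qed.
Lemma cabs_sum (I : Type) (s : seq I) (F : I -> R[i]) :
  cabs (\sum_(i <- s) F i) <= \sum_(i <- s) cabs (F i).
Proof.
elim/big_rec2: _ => [|i y1 y2 _ h]; first by rewrite cabs0.
by apply: le_trans (cabsD _ _) _; rewrite lerD2l.
Qed.
Lemma pos_complex z : 0 < z -> exists2 r : R, 0 < r & z = r%:C.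
Proof.
case: z => a b; rewrite ltcE /= => /andP[/eqP -> a0]; by exists a.
Qed.

(** Limits are coordinatewise, which is how the definitions of sums and
    integrals, made of real and imaginary parts, are reached. *)
Lemma ccvgP (T : Type) (F : set_system T) {FF : Filter F} (f : T -> R[i]) l :
  f x @[x --> F] --> l <->
  (Re (f x) @[x --> F] --> Re l) /\ (Im (f x) @[x --> F] --> Im l).
Proof.
split.
- move=> /cvgrPdist_lt h; split; apply/cvgrPdist_lt => e e0;
    (have := h e%:C; rewrite ltcR => /(_ e0); apply: filterS => x;
     rewrite cabsE ltcR; apply: le_lt_trans; rewrite distrC -opprB normrN).
  + by rewrite -Re_opp -Re_add; exact: Re_cabs.
  + by rewrite -Im_opp -Im_add; exact: Im_cabs.
- case=> /cvgrPdist_lt hr /cvgrPdist_lt hi; apply/cvgrPdist_lt => e e0.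
  have [e' e'0 ->] := pos_complex e0.
  have e2 : 0 < e' / 2 by rewrite divr_gt0.
  have := hr _ e2; have := hi _ e2; apply: filterS2 => x xi xr.
  rewrite cabsE ltcR (le_lt_trans (cabs_le _))// Re_add Im_add Re_opp Im_opp.
  by rewrite (splitr e') ltrD.
Qed.

Lemma ccvg_cabsP (T : Type) (F : set_system T) {FF : Filter F} (f : T -> R[i]) l :
  f x @[x --> F] --> l <-> cabs (f x - l) @[x --> F] --> 0.
Proof.
split => [/cvgrPdist_lt h|/cvgrPdist_lt h]; apply/cvgrPdist_lt => e e0.
- have := h e%:C; rewrite ltcR => /(_ e0); apply: filterS => x.
  by rewrite cabsE ltcR sub0r normrN ger0_norm ?cabs_ge0// -cabsN opprB.
- have [e' e'0 ->] := pos_complex e0.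
  apply: filterS (h _ e'0) => x.
  by rewrite cabsE ltcR sub0r normrN ger0_norm ?cabs_ge0// -cabsN opprB.
Qed.

Lemma cvg_cabs (T : Type) (F : set_system T) {FF : Filter F} (f : T -> R[i]) l :
  f x @[x --> F] --> l -> cabs (f x) @[x --> F] --> cabs l.
Proof.
move=> /cvgrPdist_lt h; apply/cvgrPdist_lt => e e0.
have := h e%:C; rewrite ltcR => /(_ e0); apply: filterS => x.
rewrite cabsE ltcR; apply: le_lt_trans; rewrite ler_norml cabsB andbT.
by rewrite lerNl opprB (le_trans (cabsB _ _))// -cabsN opprB.
Qed.

Lemma ccvg_unique (T : Type) (F : set_system T) {FF : ProperFilter F}
    (f : T -> R[i]) (l m : R[i]) :
  f x @[x --> F] --> l -> f x @[x --> F] --> m -> l = m.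
Proof.
move=> /ccvgP[a1 b1] /ccvgP[a2 b2]; apply: complex_eq.
- exact: cvg_unique a1 a2.
- exact: cvg_unique b1 b2.
Qed.

Lemma Re_series u n : Re (series u n) = series (fun n => Re (u n)) n.
Proof. by rewrite /series /= (big_morph (@complex.Re R) Re_add (erefl _)). Qed.
Lemma Im_series u n : Im (series u n) = series (fun n => Im (u n)) n.
Proof. by rewrite /series /= (big_morph (@complex.Im R) Im_add (erefl _)). Qed.

Lemma csum_cvg u l : series u @ \oo --> l -> csum u = l.
Proof.
move=> /ccvgP[hr hi]; rewrite /csum.
have -> : series (fun n => Re (u n)) = (fun n => Re (series u n)).
  by apply/funext => n; rewrite Re_series.
rewrite (cvg_lim _ hr)//.
have -> : series (fun n => Im (u n)) = (fun n => Im (series u n)).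
  by apply/funext => n; rewrite Im_series.
by rewrite (cvg_lim _ hi)//; case: l {hr hi}.
Qed.

Definition asummable u := cvgn (series (fun n => cabs (u n))).

Lemma asummable_le u (w : nat -> R) : (forall n, cabs (u n) <= w n) ->
  cvgn (series w) -> asummable u.
Proof.
move=> h; apply: series_le_cvg => // n; first exact: cabs_ge0.
by apply: le_trans (h n); exact: cabs_ge0.
Qed.

Lemma asummable_cvg u : asummable u -> series u @ \oo --> csum u.
Proof.
move=> h.
have cr : cvgn (series (fun n => Re (u n))).
  apply: normed_cvg; apply: series_le_cvg h => n //=; first exact: cabs_ge0.
  exact: Re_cabs.
have ci : cvgn (series (fun n => Im (u n))).
  apply: normed_cvg; apply: series_le_cvg h => n //=; first exact: cabs_ge0.
  exact: Im_cabs.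
apply/ccvgP; split => /=.
- by under eq_fun do rewrite Re_series.
- by under eq_fun do rewrite Im_series.
Qed.

Lemma series_le_lim (w : nat -> R) n : (forall n, 0 <= w n) -> cvgn (series w) ->
  series w n <= limn (series w).
Proof.
move=> h c; apply: nondecreasing_cvgn_le => //.
by apply: nondecreasing_series => k _ _; exact: h.
Qed.

Lemma cabs_csum u : asummable u ->
  cabs (csum u) <= limn (series (fun n => cabs (u n))).
Proof.
move=> h; have /cvg_cabs := asummable_cvg h.
move=> c; apply: (ler_cvg_to c h); apply: nearW => n /=.
exact: cabs_sum.
Qed.

Lemma csumZ c u : asummable u -> csum (fun n => c * u n) = c * csum u.
Proof.
move=> h; apply: csum_cvg.
have -> : series (fun n => c * u n) = (fun n => c * series u n).
  by apply/funext => n; rewrite /series /= mulr_sumr.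
by apply: cvgM; [exact: cvg_cst|exact: asummable_cvg].
Qed.

End complex_numbers.

(** * Integrals of complex-valued functions *)

Section complex_integrals.
Variable R : realType.
Local Notation mu := (@lebesgue_measure R).
Implicit Types (D : set R) (f g : R -> R[i]).

Definition cmeas D f :=
  measurable_fun D (fun t => Re (f t)) /\ measurable_fun D (fun t => Im (f t)).

Lemma cmeas_cabs D f : measurable D -> cmeas D f ->
  measurable_fun D (fun t => cabs (f t)).
Proof.
move=> mD [mr mi].
have -> : (fun t => cabs (f t)) =
    (fun t => Num.sqrt (Re (f t) ^+ 2 + Im (f t) ^+ 2)).
  by apply/funext => t; case: (f t).
apply: (@measurableT_comp _ _ _ _ _ _ (@Num.sqrt R)).
  by apply: continuous_measurable_fun; exact: sqrt_continuous.
by apply: measurable_funD; apply: measurable_funX.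
Qed.

Lemma cmeasM D f g : cmeas D f -> cmeas D g -> cmeas D (fun t => f t * g t).
Proof.
move=> [fr fi] [gr gi]; split.
- under eq_fun do rewrite Re_mul.
  by apply: measurable_funB; apply: measurable_funM.
- under eq_fun do rewrite Im_mul.
  by apply: measurable_funD; apply: measurable_funM.
Qed.

Lemma cmeas_cst D (c : R[i]) : cmeas D (fun=> c).
Proof. by split; exact: measurable_cst. Qed.

Lemma cmeasD D f g : cmeas D f -> cmeas D g -> cmeas D (fun t => f t + g t).
Proof.
move=> [fr fi] [gr gi]; split.
- by under eq_fun do rewrite Re_add; apply: measurable_funD.
- by under eq_fun do rewrite Im_add; apply: measurable_funD.
Qed.

Lemma cmeas_sum D (f_ : nat -> R -> R[i]) n : (forall k, cmeas D (f_ k)) ->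
  cmeas D (fun t => series (fun k => f_ k t) n).
Proof.
move=> h; elim: n => [|n ih].
  under eq_fun do rewrite /series /= big_geq//.
  exact: cmeas_cst.
under eq_fun do rewrite seriesSr.
exact: cmeasD.
Qed.

Lemma eq_cmeas D f g : (forall t, D t -> f t = g t) -> cmeas D f -> cmeas D g.
Proof.
move=> h [a b]; split.
- by apply: eq_measurable_fun a => t /[!inE] /h ->.
- by apply: eq_measurable_fun b => t /[!inE] /h ->.
Qed.

Lemma open_continuous_cmeas D f : open D -> (forall t, D t -> {for t, continuous f}) ->
  cmeas D f.
Proof.
move=> oD c; split; apply: open_continuous_measurable_fun => // t /[!inE] /c.
- by move=> /ccvgP[].
- by move=> /ccvgP[].
Qed.

Lemma cintegrable_cmeas D f : cintegrable D f -> cmeas D f.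
Proof.
by move=> [a b]; split; apply/measurable_EFinP; [case/integrableP: a|case/integrableP: b].
Qed.

Lemma cintegrable_le D f (g : R -> R) : measurable D -> cmeas D f ->
  (forall t, D t -> cabs (f t) <= g t) -> mu.-integrable D (EFin \o g) ->
  cintegrable D f.
Proof.
move=> mD [mr mi] h ig; split.
- apply: le_integrable ig => //; first exact/measurable_EFinP.
  move=> t Dt /=; rewrite lee_fin (le_trans (Re_cabs _))//.
  by rewrite (le_trans (h _ Dt))// ler_norm.
- apply: le_integrable ig => //; first exact/measurable_EFinP.
  move=> t Dt /=; rewrite lee_fin (le_trans (Im_cabs _))//.
  by rewrite (le_trans (h _ Dt))// ler_norm.
Qed.

Lemma integrable_cabs D f : measurable D -> cintegrable D f ->
  mu.-integrable D (EFin \o (fun t => cabs (f t))).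
Proof.
move=> mD [ir ii].
have := @integrableD _ _ _ mu D mD _ _ (integrable_norm ir) (integrable_norm ii).
apply: le_integrable => //.
  by apply/measurable_EFinP; apply: cmeas_cabs => //; exact: cintegrable_cmeas.
move=> t Dt /=; rewrite lee_fin ger0_norm ?cabs_ge0//.
by rewrite ger0_norm ?addr_ge0// cabs_le.
Qed.

Lemma cintegrableM D (h f : R -> R[i]) (M : R) : measurable D -> cmeas D h ->
  (forall t, D t -> cabs (h t) <= M) -> cintegrable D f ->
  cintegrable D (fun t => h t * f t).
Proof.
move=> mD mh hM fi.
apply: (@cintegrable_le _ _ (fun t => M * cabs (f t))) => //.
- by apply: cmeasM => //; exact: cintegrable_cmeas.
- by move=> t Dt; rewrite cabsM ler_wpM2r ?cabs_ge0// hM.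
- have := @integrableZl _ _ _ mu D mD M _ (integrable_cabs mD fi).
  exact: eq_integrable.
Qed.

Lemma cintegrableZ D (c : R[i]) f : measurable D -> cintegrable D f ->
  cintegrable D (fun t => c * f t).
Proof.
by move=> mD; apply: (@cintegrableM _ _ _ (cabs c)) => //; exact: cmeas_cst.
Qed.

Lemma cintegrableD D f g : measurable D -> cintegrable D f -> cintegrable D g ->
  cintegrable D (fun t => f t + g t).
Proof.
move=> mD [fr fi] [gr gi]; split.
- under eq_fun do rewrite Re_add EFinD; exact: integrableD.
- under eq_fun do rewrite Im_add EFinD; exact: integrableD.
Qed.

Lemma eq_cintegrable D f g : measurable D -> (forall t, D t -> f t = g t) ->
  cintegrable D f -> cintegrable D g.
Proof.
move=> mD h [a b]; split.
- by apply: eq_integrable a => // t /[!inE] /h ->.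
- by apply: eq_integrable b => // t /[!inE] /h ->.
Qed.

Lemma eq_cint D f g : (forall t, D t -> f t = g t) -> cint D f = cint D g.
Proof.
move=> h; rewrite /cint; congr Complex; apply: eq_Rintegral => t /[!inE] /h -> //.
Qed.

Lemma cintD D f g : measurable D -> cintegrable D f -> cintegrable D g ->
  cint D (fun t => f t + g t) = cint D f + cint D g.
Proof.
move=> mD [fr fi] [gr gi]; rewrite /cint; apply: complex_eq => /=.
- by under eq_Rintegral do rewrite Re_add; exact: RintegralD.
- by under eq_Rintegral do rewrite Im_add; exact: RintegralD.
Qed.

Lemma cintZ D c f : measurable D -> cintegrable D f ->
  cint D (fun t => c * f t) = c * cint D f.
Proof.
move=> mD [fr fi]; rewrite /cint; apply: complex_eq; rewrite ?Re_mul ?Im_mul /=.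
- under eq_Rintegral do rewrite Re_mul.
  rewrite -!RintegralZl// -RintegralB//.
  + by have := @integrableZl _ _ _ mu D mD (Re c) _ fr.
  + by have := @integrableZl _ _ _ mu D mD (Im c) _ fi.
- under eq_Rintegral do rewrite Im_mul.
  rewrite -!RintegralZl// -RintegralD//.
  + by have := @integrableZl _ _ _ mu D mD (Re c) _ fi.
  + by have := @integrableZl _ _ _ mu D mD (Im c) _ fr.
Qed.

(** The factor 2 comes from bounding the two coordinates separately; only the
    order of magnitude is ever used. *)
Lemma cabs_cint D f : measurable D -> cintegrable D f ->
  cabs (cint D f) <= 2 * \int[mu]_(t in D) cabs (f t).
Proof.
move=> mD fi; have ia := integrable_cabs mD fi; case: fi => fr fi.
apply: le_trans (cabs_le _) _; rewrite /= mulr2n mulrDl mul1r lerD//.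
- apply: le_trans (le_normr_Rintegral _ _) _ => //.
  apply: le_Rintegral => //; first exact: integrable_norm.
  by move=> t _ /=; exact: Re_cabs.
- apply: le_trans (le_normr_Rintegral _ _) _ => //.
  apply: le_Rintegral => //; first exact: integrable_norm.
  by move=> t _ /=; exact: Im_cabs.
Qed.

Lemma dominated_Rintegral D (f_ : nat -> R -> R) (f g : R -> R) : measurable D ->
  (forall n, measurable_fun D (f_ n)) ->
  (forall t, D t -> f_ n t @[n --> \oo] --> f t) ->
  mu.-integrable D (EFin \o g) ->
  (forall n t, D t -> `|f_ n t| <= g t) ->
  mu.-integrable D (EFin \o f) /\
  \int[mu]_(t in D) f_ n t @[n --> \oo] --> \int[mu]_(t in D) f t.
Proof.
move=> mD mf c ig h.
have mf0 : measurable_fun D f by exact: measurable_fun_cvg mf c.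
have [] := @dominated_convergence _ _ R mu D mD (fun n t => (f_ n t)%:E)
  (EFin \o f) (EFin \o g).
- by move=> n; apply/measurable_EFinP; exact: mf.
- exact/measurable_EFinP.
- by apply: aeW => t Dt; apply: cvg_EFin; [exact: nearW|exact: c].
- by [].
- by apply: aeW => t n Dt /=; rewrite lee_fin h.
- move=> fint _ l; split => //; apply: fine_cvg.
  by rewrite fineK// integrable_fin_num.
Qed.

Lemma dominated_cint D (f_ : nat -> R -> R[i]) f (g : R -> R) : measurable D ->
  (forall n, cmeas D (f_ n)) ->
  (forall t, D t -> f_ n t @[n --> \oo] --> f t) ->
  mu.-integrable D (EFin \o g) ->
  (forall n t, D t -> cabs (f_ n t) <= g t) ->
  cintegrable D f /\ cint D (f_ n) @[n --> \oo] --> cint D f.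
Proof.
move=> mD mf c ig h.
have [] := @dominated_Rintegral D (fun n t => Re (f_ n t)) (fun t => Re (f t)) g mD.
- by move=> n; case: (mf n).
- by move=> t /c /ccvgP[].
- by [].
- by move=> n t Dt; apply: le_trans (Re_cabs _) (h _ _ Dt).
move=> ir cr.
have [] := @dominated_Rintegral D (fun n t => Im (f_ n t)) (fun t => Im (f t)) g mD.
- by move=> n; case: (mf n).
- by move=> t /c /ccvgP[].
- by [].
- by move=> n t Dt; apply: le_trans (Im_cabs _) (h _ _ Dt).
move=> ii ci.
by split => //; apply/ccvgP.
Qed.

Lemma integrable_series D (g_ : nat -> R -> R) : measurable D ->
  (forall n t, D t -> 0 <= g_ n t) ->
  (forall n, mu.-integrable D (EFin \o g_ n)) ->
  (forall t, D t -> cvgn (series (g_ ^~ t))) ->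
  cvgn (series (fun n => \int[mu]_(t in D) g_ n t)) ->
  mu.-integrable D (EFin \o (fun t => limn (series (g_ ^~ t)))).
Proof.
move=> mD g0 gi cg cI.
have mg n : measurable_fun D (g_ n) by apply/measurable_EFinP; case/integrableP: (gi n).
have mG : measurable_fun D (fun t => limn (series (g_ ^~ t))).
  apply: (@measurable_fun_cvg _ _ _ D (fun n t => series (g_ ^~ t) n)) => //.
  move=> n; apply: measurable_sum => i; exact: mg.
have G0 t : D t -> 0 <= limn (series (g_ ^~ t)).
  move=> Dt; apply: limr_ge; first exact: cg.
  by apply: nearW => n; apply: sumr_ge0 => k _; exact: g0.
apply/integrableP; split; first exact/measurable_EFinP.
rewrite (@eq_integral _ _ _ mu D (fun t => \sum_(0 <= n <oo) (g_ n t)%:E)%E); last first.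
  move=> t /[!inE] Dt /=.
  rewrite ger0_norm ?G0// -EFin_lim; last exact: cg.
  congr (limn _); by apply/funext => n /=; rewrite sumEFin.
rewrite integral_nneseries//.
- rewrite (_ : (fun n => _) = (fun n => (\sum_(0 <= k < n) \int[mu]_(t in D) g_ k t)%:E)).
    by rewrite (EFin_lim cI) ltry.
  apply/funext => n; rewrite -sumEFin; apply: eq_bigr => i _.
  rewrite /Rintegral fineK//; apply: integrable_fin_num => //; exact: gi.
- by move=> n; have /measurable_EFinP := mg n.
Qed.

(** Termwise integration: dominated convergence applied to the partial sums,
    with the sum of the norms as dominating function. *)
Lemma cint_series D (f_ : nat -> R -> R[i]) : measurable D ->
  (forall n, cintegrable D (f_ n)) ->
  (forall t, D t -> asummable (f_ ^~ t)) ->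
  cvgn (series (fun n => \int[mu]_(t in D) cabs (f_ n t))) ->
  cintegrable D (fun t => csum (f_ ^~ t)) /\
  series (fun n => cint D (f_ n)) @ \oo --> cint D (fun t => csum (f_ ^~ t)).
Proof.
move=> mD fi fs cI.
have iG : mu.-integrable D (EFin \o (fun t => limn (series (fun n => cabs (f_ n t))))).
  apply: (@integrable_series D (fun n t => cabs (f_ n t))) => //.
  - by move=> n t _; exact: cabs_ge0.
  - by move=> n; exact: integrable_cabs.
have si n : cintegrable D (fun t => series (f_ ^~ t) n) /\
    cint D (fun t => series (f_ ^~ t) n) = series (fun n => cint D (f_ n)) n.
  elim: n => [|n [ih1 ih2]].
    split.
      apply: (@eq_cintegrable _ (fun t => 0 * f_ 0%N t)) => //.
        by move=> t _; rewrite mul0r /series /= big_geq.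
      exact: cintegrableZ.
    rewrite (@eq_cint _ _ (fun t => 0 * f_ 0%N t)).
      by rewrite cintZ// mul0r /series /= big_geq.
    by move=> t _; rewrite mul0r /series /= big_geq.
  split.
    apply: (@eq_cintegrable _ (fun t => series (f_ ^~ t) n + f_ n t)) => //.
      by move=> t _; rewrite seriesSr.
    exact: cintegrableD.
  rewrite seriesSr -ih2 -cintD//; apply: eq_cint => t _.
  by rewrite seriesSr.
have [] := @dominated_cint D (fun n t => series (f_ ^~ t) n)
  (fun t => csum (f_ ^~ t)) _ mD _ _ iG.
- by move=> n; apply: cmeas_sum => k; exact: cintegrable_cmeas.
- by move=> t Dt; apply: asummable_cvg; exact: fs.
- move=> n t Dt; apply: le_trans (cabs_sum _ _) _.
  apply: (@series_le_lim _ (fun k => cabs (f_ k t))); last exact: fs.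
  by move=> k; exact: cabs_ge0.
move=> i c; split => //.
by have <- : (fun n => cint D (fun t => series (f_ ^~ t) n)) =
  series (fun n => cint D (f_ n)) by apply/funext => n; rewrite (si n).2.
Qed.

End complex_integrals.

(** * Complex powers of positive reals and their derivatives *)

Section complex_powers.
Variable R : realType.
Implicit Types (z w s : R[i]) (x y t : R) (F G : R -> R[i]).

Lemma cexpD z w : cexp (z + w) = cexp z * cexp w.
Proof.
rewrite /cexp Re_add Im_add expRD cosD sinD; apply: complex_eq;
  rewrite ?(Re_mul, Im_mul) /=; ring.
Qed.

Lemma cexp0 : cexp (0 : R[i]) = 1.
Proof. by rewrite /cexp /= expR0 cos0 sin0; apply: complex_eq => /=; ring. Qed.

Lemma cabs_cexp z : cabs (cexp z) = expR (Re z).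
Proof.
rewrite /cexp cabsM cabs_real ger0_norm ?expR_ge0//=.
by rewrite cos2Dsin2 sqrtr1 mulr1.
Qed.

Lemma cpowE y s : cpow y s =
  (expR (Re s * ln y) * cos (Im s * ln y)) +i* (expR (Re s * ln y) * sin (Im s * ln y)).
Proof.
rewrite /cpow /cexp Re_mul Im_mul /= !mulr0 subr0 add0r.
by apply: complex_eq => /=; ring.
Qed.

Lemma cpowD y s z : cpow y (s + z) = cpow y s * cpow y z.
Proof. by rewrite /cpow mulrDl cexpD. Qed.

Lemma cpow0 y : cpow y 0 = 1.
Proof. by rewrite /cpow mul0r cexp0. Qed.

Lemma cpow1l s : cpow 1 s = 1 :> R[i].
Proof. by rewrite /cpow ln1 mulr0 cexp0. Qed.

Lemma cpow_neq0 y s : cpow y s != 0.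
Proof. by rewrite -cabs_eq0 /cpow cabs_cexp expR_eq0. Qed.

Lemma cpowN y s : cpow y (- s) = (cpow y s)^-1.
Proof.
apply: (mulfI (cpow_neq0 y s)).
by rewrite -cpowD subrr cpow0 divff ?cpow_neq0.
Qed.

Lemma cpowB y s z : cpow y (s - z) = cpow y s / cpow y z.
Proof. by rewrite cpowD cpowN. Qed.

Lemma cpow1 y : 0 < y -> cpow y 1 = y%:C.
Proof.
move=> y0; rewrite cpowE /= !mul1r lnK// mul0r cos0 sin0 mulr1 mulr0 //.
Qed.

Lemma cpowS y s : 0 < y -> cpow y (s + 1) = y%:C * cpow y s.
Proof. by move=> y0; rewrite cpowD cpow1// mulrC. Qed.

Lemma cpow_nat y n : 0 < y -> cpow y n%:R = (y ^+ n)%:C.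
Proof.
move=> y0; elim: n => [|n ih]; first by rewrite cpow0 expr0.
by rewrite -natr1 cpowS// ih exprS rmorphM.
Qed.

Lemma cpowMl x y s : 0 < x -> 0 < y -> cpow (x * y) s = cpow x s * cpow y s.
Proof.
by move=> x0 y0; rewrite /cpow lnM ?posrE// rmorphD mulrDr cexpD.
Qed.

Lemma cpowVl x s : 0 < x -> cpow x^-1 s = (cpow x s)^-1.
Proof. by move=> x0; rewrite /cpow lnV ?posrE// rmorphN mulrN -cpowN /cpow mulNr. Qed.

Lemma cabs_cpow y s : cabs (cpow y s) = expR (Re s * ln y).
Proof. by rewrite /cpow cabs_cexp Re_mul /= mulr0 subr0. Qed.

(** [R[i]] is normed over itself and not over [R], so derivatives along the real
    line are taken coordinatewise. *)
Definition cderiv F t (d : R[i]) :=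
  is_derive t 1 (fun u => Re (F u)) (Re d) /\
  is_derive t 1 (fun u => Im (F u)) (Im d).

Lemma is_derive_continuous (g : R -> R) t d : is_derive t 1 g d ->
  {for t, continuous g}.
Proof. by case=> [h _]; have /derivable1_diffP/differentiable_continuous := h. Qed.

Lemma cderiv_continuous F t d : cderiv F t d -> {for t, continuous F}.
Proof.
move=> [[dr _] [di _]]; apply/ccvgP; split.
- by have /derivable1_diffP/differentiable_continuous := dr.
- by have /derivable1_diffP/differentiable_continuous := di.
Qed.

Lemma cderivM F G t d e : cderiv F t d -> cderiv G t e ->
  cderiv (fun u => F u * G u) t (d * G t + F t * e).
Proof.
move=> [Fr Fi] [Gr Gi]; split.
- under eq_fun do rewrite Re_mul.
  have := is_deriveB (is_deriveM Fr Gr) (is_deriveM Fi Gi).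
  move=> /is_derive_eq; apply; rewrite /GRing.scale /= Re_add !Re_mul; ring.
- under eq_fun do rewrite Im_mul.
  have := is_deriveD (is_deriveM Fr Gi) (is_deriveM Fi Gr).
  move=> /is_derive_eq; apply; rewrite /GRing.scale /= Im_add !Im_mul; ring.
Qed.

Lemma cderiv_cpow s t : 0 < t -> cderiv (fun u => cpow u s) t (s * cpow t (s - 1)).
Proof.
move=> t0.
have -> : s * cpow t (s - 1) = s * (t^-1)%:C * cpow t s.
  by rewrite cpowB cpow1// fmorphV; ring.
have dl (a : R) : is_derive t 1 (fun u => a * ln u) (a / t).
  have := is_deriveZ a (is_derive1_ln t0).
  by move=> /is_derive_eq; apply.
have de (a : R) : is_derive t 1 (fun u => expR (a * ln u)) (a / t * expR (a * ln t)).
  have := @is_derive1_comp _ (@expR R) _ t _ _ (is_derive_expR _) (dl a).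
  by move=> /is_derive_eq; apply; rewrite mulrC.
have dc (a : R) : is_derive t 1 (fun u => cos (a * ln u)) (- (a / t) * sin (a * ln t)).
  have := @is_derive1_comp _ (@cos R) _ t _ _ (is_derive_cos _) (dl a).
  by move=> /is_derive_eq; apply; ring.
have ds (a : R) : is_derive t 1 (fun u => sin (a * ln u)) (a / t * cos (a * ln t)).
  have := @is_derive1_comp _ (@sin R) _ t _ _ (is_derive_sin _) (dl a).
  by move=> /is_derive_eq; apply; ring.
split.
- under eq_fun do rewrite cpowE /=.
  have := is_deriveM (de (Re s)) (dc (Im s)).
  move=> /is_derive_eq; apply; rewrite cpowE !Re_mul !Im_mul /GRing.scale /=; ring.
- under eq_fun do rewrite cpowE /=.
  have := is_deriveM (de (Re s)) (ds (Im s)).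
  move=> /is_derive_eq; apply; rewrite cpowE !Im_mul !Re_mul /GRing.scale /=; ring.
Qed.

Lemma cderiv_cpow_sub x s t : t < x ->
  cderiv (fun u => cpow (x - u) s) t (- (s * cpow (x - t) (s - 1))).
Proof.
move=> tx; have xt : 0 < x - t by rewrite subr_gt0.
have [dr di] := cderiv_cpow s xt.
have ds : is_derive t 1 (fun u => x - u) (-1 : R).
  have := is_deriveB (is_derive_cst x t 1) (is_derive_id t (1 : R)).
  by move=> /is_derive_eq; apply; rewrite sub0r.
split.
- have := @is_derive1_comp _ _ _ t _ _ dr ds.
  by move=> /is_derive_eq; apply; rewrite Re_opp mulrN1.
- have := @is_derive1_comp _ _ _ t _ _ di ds.
  by move=> /is_derive_eq; apply; rewrite Im_opp mulrN1.
Qed.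

Lemma cderiv_real (g : R -> R) t d : is_derive t 1 g d ->
  cderiv (fun u => (g u)%:C) t d%:C.
Proof.
by move=> h; split => //; exact: is_derive_cst.
Qed.

Lemma continuous_cpow s t : 0 < t -> {for t, continuous (fun u => cpow u s)}.
Proof. by move=> t0; exact: cderiv_continuous (cderiv_cpow s t0). Qed.

Lemma continuous_cpow_sub x s t : t < x ->
  {for t, continuous (fun u => cpow (x - u) s)}.
Proof. by move=> t0; exact: cderiv_continuous (cderiv_cpow_sub s t0). Qed.

Lemma continuous_real_complex (g : R -> R) t : {for t, continuous g} ->
  {for t, continuous (fun u => (g u)%:C)}.
Proof. by move=> h; apply/ccvgP; split => //; exact: cvg_cst. Qed.

Lemma ccontinuousM F G t : {for t, continuous F} -> {for t, continuous G} ->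
  {for t, continuous (fun u => F u * G u)}.
Proof. by move=> a b; exact: (cvgM a b). Qed.

End complex_powers.

(** * Improper integrals: derivatives and substitution *)

Section improper_integrals.
Variable R : realType.
Local Notation mu := (@lebesgue_measure R).
Implicit Types (D : set R) (a b : nat -> R).

(** The compact intervals [[a n, b n]] lie in the open set [D] and every point
    of [D] is eventually in them. *)
Definition exhausts D a b :=
  [/\ open D, forall n, a n < b n, forall n t, a n <= t <= b n -> D t &
      forall t, D t -> \forall n \near \oo, a n <= t <= b n].

Lemma integral_FTC2 D (F f : R -> R) (a b : R) : a < b ->
  (forall t, a <= t <= b -> D t) ->
  (forall t, D t -> is_derive t 1 F (f t)) ->
  (forall t, D t -> {for t, continuous f}) ->
  \int[mu]_(t in `[a, b]) f t = F b - F a.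
Proof.
move=> ab abD dF cf.
have cF t : D t -> {for t, continuous F}.
  by move=> /dF; exact: is_derive_continuous.
have Da : D a by apply: abD; rewrite lexx ltW.
have Db : D b by apply: abD; rewrite lexx ltW.
rewrite /Rintegral (@continuous_FTC2 R f F a b ab)//.
- apply: continuous_in_subspaceT => t; rewrite inE /= in_itv /= => tab.
  by apply: cf; exact: abD.
- split.
  + move=> t; rewrite in_itv /= => /andP[at_ tb].
    have [] // := dF t; by apply: abD; rewrite !ltW.
  + by apply: cvg_at_right_filter; exact: cF.
  + by apply: cvg_at_left_filter; exact: cF.
- move=> t; rewrite in_itv /= => /andP[at_ tb]; rewrite derive1E.
  have [] // := dF t; by apply: abD; rewrite !ltW.
Qed.

Lemma patch_exhaust D a b (f : R -> R) t : exhausts D a b -> D t ->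
  (f \_ `[a n, b n]) t @[n --> \oo] --> f t.
Proof.
case=> _ _ _ h Dt; apply: cvg_near_cst.
apply: filterS (h _ Dt) => n tn.
by rewrite patchE mem_set//= in_itv.
Qed.

Lemma setI_exhaust D a b n : exhausts D a b -> D `&` `[a n, b n] = `[a n, b n]%classic.
Proof.
case=> _ _ h _; apply/setIidPr => t /=; rewrite in_itv /=; exact: h.
Qed.

Lemma Rintegral_exhaust D a b (f : R -> R) : exhausts D a b ->
  mu.-integrable D (EFin \o f) ->
  \int[mu]_(t in `[a n, b n]) f t @[n --> \oo] --> \int[mu]_(t in D) f t.
Proof.
move=> ex fi; have mD : measurable D by case: ex => /open_measurable.
have mf : measurable_fun D f by apply/measurable_EFinP; case/integrableP: fi.
have [] := @dominated_Rintegral R D (fun n => f \_ `[a n, b n]) f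
  (fun t => `|f t|) mD.
- move=> n; apply/(measurable_restrict _ _ mD) => //.
  by apply: measurable_funS mf => // t [].
- by move=> t Dt; exact: patch_exhaust ex Dt.
- exact: integrable_norm.
- by move=> n t Dt; rewrite patchE; case: ifP => //; rewrite normr0.
move=> _; under eq_fun do rewrite -Rintegral_mkcondr (setI_exhaust _ ex).
by [].
Qed.

(** Fatou's lemma for the truncations of [f] to the exhausting intervals. *)
Lemma ge0_integrable_exhaust D a b (f : R -> R) (K : R) : exhausts D a b ->
  measurable_fun D f -> (forall t, D t -> 0 <= f t) ->
  (forall n, mu.-integrable `[a n, b n] (EFin \o f)) ->
  (forall n, \int[mu]_(t in `[a n, b n]) f t <= K) ->
  mu.-integrable D (EFin \o f).
Proof.
move=> ex mf f0 fi fK; have mD : measurable D by case: ex => /open_measurable.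
apply/integrableP; split; first exact/measurable_EFinP.
have mp n : measurable_fun D (f \_ `[a n, b n]).
  apply/(measurable_restrict _ _ mD) => //.
  by apply: measurable_funS mf => // t [].
have := @fatou _ _ R mu D mD (fun n t => ((f \_ `[a n, b n]) t)%:E).
move=> /(_ _ _)/le_lt_trans; rewrite (@eq_integral _ _ _ mu D (abse \o (EFin \o f))).
  apply.
  - by move=> n; apply/measurable_EFinP; exact: mp.
  - by move=> n t Dt; rewrite lee_fin patchE; case: ifP => // _; exact: f0.
  - apply: (@le_lt_trans _ _ K%:E); last exact: ltry.
    rewrite limn_einf_lim; apply: lime_le; first exact: is_cvg_einfs.
    apply: nearW => n; apply: (le_trans (ereal_inf_lbound _)).
      by exists n => /=.
    have := fK n; rewrite -lee_fin; apply: le_trans.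
    rewrite /Rintegral fineK; last by apply: integrable_fin_num => //; exact: fi.
    rewrite -[leRHS](congr1 (fun A => \int[mu]_(t in A) (f t)%:E)%E (setI_exhaust n ex)).
    by rewrite integral_mkcondr restrict_EFin.
move=> t /[!inE] Dt; have c : ((f \_ `[a n, b n]) t)%:E @[n --> \oo] --> (f t)%:E.
  by apply: cvg_EFin; [exact: nearW|exact: patch_exhaust ex Dt].
by rewrite (cvg_limn_einf_sup c).1 /= ger0_norm// f0.
Qed.

(** The source of all dominating functions below: each of them is, up to a
    constant, a nonnegative derivative of a bounded function. *)
Lemma ge0_derive_integrable D a b (F f : R -> R) (K : R) : exhausts D a b ->
  (forall t, D t -> is_derive t 1 F (f t)) ->
  (forall t, D t -> {for t, continuous f}) ->
  (forall t, D t -> 0 <= f t) ->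
  (forall t, D t -> 0 <= F t <= K) ->
  mu.-integrable D (EFin \o f).
Proof.
move=> ex dF cf f0 FK; have [oD ab sub h] := ex.
apply: (@ge0_integrable_exhaust _ a b _ K) => //.
- by apply: open_continuous_measurable_fun => // t /[!inE]; exact: cf.
- move=> n; apply: continuous_compact_integrable; first exact: segment_compact.
  apply: continuous_in_subspaceT => t; rewrite inE /= in_itv /= => tab.
  by apply: cf; exact: sub tab.
- move=> n; rewrite (@integral_FTC2 D F f _ _ (ab n) (sub n))//.
  have Da : D (a n) by apply: (sub n); rewrite lexx ltW.
  have Db : D (b n) by apply: (sub n); rewrite lexx ltW.
  have /andP[_ h1] := FK _ Db; have /andP[h2 _] := FK _ Da.
  by rewrite lerBlDr (le_trans h1)// lerDl.
Qed.

(** Only the limit [l] of the boundary terms matters, so [F] need not extend to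
    the boundary of [D]. *)
Lemma cint_derive D a b (F f : R -> R[i]) l : exhausts D a b ->
  (forall t, D t -> cderiv F t (f t)) ->
  (forall t, D t -> {for t, continuous f}) ->
  cintegrable D f ->
  F (b n) - F (a n) @[n --> \oo] --> l ->
  cint D f = l.
Proof.
move=> ex dF cf [ir ii] /ccvgP[lr li]; have [oD ab sub h] := ex.
apply: complex_eq; rewrite /cint /=.
- apply: (cvg_unique _ (Rintegral_exhaust ex ir)) => //.
  have e n : \int[mu]_(t in `[a n, b n]) Re (f t) = Re (F (b n) - F (a n)).
    rewrite (@integral_FTC2 D (fun u => Re (F u)) (fun u => Re (f u)) _ _ (ab n) (sub n)
      (fun t Dt => (dF t Dt).1)); first by rewrite Re_add Re_opp.
    by move=> t /cf/ccvgP[].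
  by rewrite /=; under eq_fun do rewrite e.
- apply: (cvg_unique _ (Rintegral_exhaust ex ii)) => //.
  have e n : \int[mu]_(t in `[a n, b n]) Im (f t) = Im (F (b n) - F (a n)).
    rewrite (@integral_FTC2 D (fun u => Im (F u)) (fun u => Im (f u)) _ _ (ab n) (sub n)
      (fun t Dt => (dF t Dt).2)); first by rewrite Im_add Im_opp.
    by move=> t /cf/ccvgP[].
  by rewrite /=; under eq_fun do rewrite e.
Qed.

(** The compact case on each [[a n, b n]], passed to the limit on both sides. *)
Lemma Rintegral_substitution D D' a b (phi phi' g : R -> R) :
  exhausts D a b -> exhausts D' (phi \o a) (phi \o b) ->
  (forall t, D t -> D' (phi t)) ->
  (forall u t, D u -> D t -> u < t -> phi u < phi t) ->
  (forall t, D t -> is_derive t 1 phi (phi' t)) ->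
  (forall t, D t -> {for t, continuous phi'}) ->
  (forall t, D' t -> {for t, continuous g}) ->
  mu.-integrable D' (EFin \o g) ->
  mu.-integrable D (EFin \o (fun t => phi' t * g (phi t))) ->
  \int[mu]_(t in D') g t = \int[mu]_(t in D) (phi' t * g (phi t)).
Proof.
move=> ex ex' im inc dp cp' cg ig igp.
have [oD ab sub _] := ex; have [oD' ab' sub' _] := ex'.
have cp t : D t -> {for t, continuous phi}.
  by move=> /dp; exact: is_derive_continuous.
have dp1 t : D t -> derive1 phi t = phi' t by move=> /dp [_ <-]; rewrite derive1E.
apply: (cvg_unique _ (Rintegral_exhaust ex' ig)) => //.
suff e n : \int[mu]_(t in `[(phi \o a) n, (phi \o b) n]) g t =
    \int[mu]_(t in `[a n, b n]) (phi' t * g (phi t)).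
  rewrite /=; under eq_fun do rewrite e.
  exact: Rintegral_exhaust ex igp.
have Da : D (a n) by apply: (sub n); rewrite lexx ltW.
have Db : D (b n) by apply: (sub n); rewrite lexx ltW.
have cphi' t : D t -> derive1 phi x @[x --> t] --> phi' t.
  move=> Dt; have := cp' _ Dt; apply: cvg_trans; apply: near_eq_cvg.
  have := open_nbhs_nbhs (conj oD Dt); apply: filterS => x Dx.
  by rewrite dp1.
rewrite /Rintegral /= (@integration_by_substitution_increasing R phi g (a n) (b n)).
- congr fine; apply: eq_integral => t; rewrite inE /= in_itv /= => tab.
  by congr EFin; rewrite mulrC -(dp1 _ (sub _ _ tab)).
- exact: ltW.
- move=> u t; rewrite !in_itv /= => /sub Du /sub Dt; exact: inc.
- move=> t; rewrite in_itv /= => /andP[at_ tb].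
  have Dt : D t by apply: (sub n); rewrite !ltW.
  by rewrite /prop_for /continuous_at dp1//; exact: cphi'.
- by apply/cvg_ex; exists (phi' (a n)); apply: cvg_at_right_filter; exact: cphi'.
- by apply/cvg_ex; exists (phi' (b n)); apply: cvg_at_left_filter; exact: cphi'.
- split.
  + move=> t; rewrite in_itv /= => /andP[at_ tb].
    have [] // := dp t; by apply: (sub n); rewrite !ltW.
  + by apply: cvg_at_right_filter; exact: cp.
  + by apply: cvg_at_left_filter; exact: cp.
- apply: continuous_in_subspaceT => t; rewrite inE /= in_itv /= => tab.
  by apply: cg; exact: (sub' n).
Qed.

Lemma cint_substitution D D' a b (phi phi' : R -> R) (g : R -> R[i]) :
  exhausts D a b -> exhausts D' (phi \o a) (phi \o b) ->
  (forall t, D t -> D' (phi t)) ->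
  (forall u t, D u -> D t -> u < t -> phi u < phi t) ->
  (forall t, D t -> is_derive t 1 phi (phi' t)) ->
  (forall t, D t -> {for t, continuous phi'}) ->
  (forall t, D' t -> {for t, continuous g}) ->
  cintegrable D' g ->
  cintegrable D (fun t => (phi' t)%:C * g (phi t)) ->
  cint D' g = cint D (fun t => (phi' t)%:C * g (phi t)).
Proof.
move=> ex ex' im inc dp cp' cg [ir ii] [jr ji].
have rE t : Re ((phi' t)%:C * g (phi t)) = phi' t * Re (g (phi t)).
  by rewrite Re_mul /= mul0r subr0.
have iE t : Im ((phi' t)%:C * g (phi t)) = phi' t * Im (g (phi t)).
  by rewrite Im_mul /= mul0r addr0.
rewrite /cint; congr Complex.
- rewrite (Rintegral_substitution ex ex' im inc dp cp')//.
  + by under [RHS]eq_Rintegral do rewrite rE.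
  + by move=> t /cg/ccvgP[].
  + by under eq_fun do rewrite -rE.
- rewrite (Rintegral_substitution ex ex' im inc dp cp')//.
  + by under [RHS]eq_Rintegral do rewrite iE.
  + by move=> t /cg/ccvgP[].
  + by under eq_fun do rewrite -iE.
Qed.

Lemma exhausts_pos : exhausts `]0, +oo[ (fun n => n.+2%:R^-1) (fun n => n.+2%:R).
Proof.
split.
- exact: interval_open.
- move=> n; apply: (@le_lt_trans _ _ 1); last by rewrite ltr1n.
  by rewrite invf_le1 ?ltr0n// ler1n.
- move=> n t /andP[h _]; rewrite /= in_itv /= andbT (lt_le_trans _ h)//.
- move=> t; rewrite /= in_itv /= andbT => t0.
  have [N hN] : exists N : nat, t <= N%:R /\ t^-1 <= N%:R.
    exists (maxn (Num.bound t) (Num.bound t^-1)); split.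
    + apply: le_trans (ltW (archi_boundP (ltW t0))) _.
      by rewrite ler_nat leq_maxl.
    + have ti : 0 <= t^-1 by rewrite invr_ge0 ltW.
      apply: le_trans (ltW (archi_boundP ti)) _.
      by rewrite ler_nat leq_maxr.
  near=> n; have nN : (N <= n)%N by near: n; exact: nbhs_infty_ge.
  have NN : (N%:R : R) <= n.+2%:R by rewrite ler_nat (leq_trans nN)// !leqW.
  case: hN => h1 h2; apply/andP; split; last exact: le_trans h1 NN.
  by rewrite -[leRHS]invrK lef_pV2 ?posrE ?invr_gt0// (le_trans h2).
Unshelve. all: by end_near. Qed.

Lemma exhausts_oo (x : R) : 0 < x ->
  exhausts `]0, x[ (fun n => x / n.+3%:R) (fun n => x - x / n.+3%:R).
Proof.
move=> x0.
have x3 n : 0 < x / n.+3%:R by rewrite divr_gt0.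
split.
- exact: interval_open.
- move=> n; have -> : x - x / n.+3%:R = x / n.+3%:R * n.+2%:R.
    rewrite -[n.+3%:R]natr1; field.
    by rewrite -(natrD _ 2 n) natr1 pnatr_eq0.
  by rewrite ltr_pMr// ltr1n.
- move=> n t /andP[h1 h2]; rewrite /= in_itv /= (lt_le_trans _ h1)//=.
  by rewrite (le_lt_trans h2)// ltrBlDr ltrDl.
- move=> t; rewrite /= in_itv /= => /andP[t0 tx].
  have y0 : 0 < x - t by rewrite subr_gt0.
  have [N [h1 h2]] : exists N : nat, x / t <= N%:R /\ x / (x - t) <= N%:R.
    exists (maxn (Num.bound (x / t)) (Num.bound (x / (x - t)))); split.
    + have ti : 0 <= x / t by rewrite divr_ge0 ?ltW.
      apply: le_trans (ltW (archi_boundP ti)) _.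
      by rewrite ler_nat leq_maxl.
    + have ti : 0 <= x / (x - t) by rewrite divr_ge0 ?ltW.
      apply: le_trans (ltW (archi_boundP ti)) _.
      by rewrite ler_nat leq_maxr.
  near=> n; have nN : (N <= n)%N by near: n; exact: nbhs_infty_ge.
  have NN : (N%:R : R) <= n.+3%:R by rewrite ler_nat (leq_trans nN)// !leqW.
  apply/andP; split.
  + by rewrite ler_pdivrMr// mulrC -ler_pdivrMr// (le_trans h1).
  + by rewrite lerBrDl -lerBrDr ler_pdivrMr// mulrC -ler_pdivrMr// (le_trans h2).
Unshelve. all: by end_near. Qed.

End improper_integrals.

(** * Euler's integrals *)

Section gamma_beta_integrands.
Variable R : realType.
Local Notation mu := (@lebesgue_measure R).
Implicit Types (z s : R[i]) (x t p q k : R).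

Lemma pow_le_fact_expR (y : R) n : 0 <= y -> y ^+ n <= n`!%:R * expR y.
Proof.
case: n => [|n] y0; first by rewrite expr0 fact0 mul1r (le_trans _ (expR_ge1Dx y))// lerDl.
have := expR_ge1Dxn n y0.
have f0 : (0 : R) < n.+1`!%:R by rewrite ltr0n fact_gt0.
move=> h; rewrite -ler_pdivrMl// mulrC (le_trans _ h)// lerDr//.
Qed.

Lemma expR_ln_le (a y : R) n : 1 <= y -> a <= n%:R ->
  expR (a * ln y) <= n`!%:R * expR y.
Proof.
move=> y1 an; have y0 : 0 < y by exact: lt_le_trans y1.
apply: le_trans (pow_le_fact_expR n (ltW y0)).
have -> : y ^+ n = expR (n%:R * ln y).
  by rewrite expRM_natl lnK ?posrE.
by rewrite ler_expR ler_wpM2r// ln_ge0.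
Qed.

Lemma is_derive_ln_scale (a : R) t : 0 < t ->
  is_derive t 1 (fun u => a * ln u) (a / t).
Proof.
by move=> t0; have := is_deriveZ a (is_derive1_ln t0); move=> /is_derive_eq; apply.
Qed.

Lemma is_derive_expR_ln (a : R) t : 0 < t ->
  is_derive t 1 (fun u => expR (a * ln u)) (a / t * expR (a * ln t)).
Proof.
move=> t0.
have := @is_derive1_comp _ (@expR R) _ t _ _ (is_derive_expR _) (is_derive_ln_scale a t0).
by move=> /is_derive_eq; apply; rewrite mulrC.
Qed.

(** With [phi t = t ^ k / k], the function [(phi / (1 + phi)) ^ (p / k)] is
    bounded, and its derivative dominates the integrand. *)
Lemma integrable_gammak k p : 0 < k -> 0 < p ->
  mu.-integrable `]0, +oo[
    (EFin \o (fun t => expR ((p - 1) * ln t) * expR (- (expR (k * ln t) / k)))).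
Proof.
move=> k0 p0.
pose r := p / k; have r0 : 0 < r by rewrite divr_gt0.
pose phi t := expR (k * ln t) / k.
have phi0 t : 0 < phi t by rewrite divr_gt0// expR_gt0.
have phi1 t : 0 < 1 + phi t by rewrite addr_gt0.
have dphi t : 0 < t -> is_derive t 1 phi (k * phi t / t).
  move=> t0; rewrite /phi.
  have := is_deriveM (is_derive_expR_ln k t0) (is_derive_cst k^-1 t 1).
  by move=> /is_derive_eq; apply; rewrite /GRing.scale /=; field; rewrite !gt_eqF.
pose F t := expR (r * (k * ln t - ln k - ln (1 + phi t))).
pose f t := p / t / (1 + phi t) * F t.
have dF t : 0 < t -> is_derive t 1 F (f t).
  move=> t0.
  have d1 : is_derive t 1 (fun u => 1 + phi u) (k * phi t / t).
    have := is_deriveD (is_derive_cst (1 : R) t 1) (dphi t t0).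
    by move=> /is_derive_eq; apply; rewrite add0r.
  have d2 := @is_derive1_comp _ (@ln R) _ t _ _ (is_derive1_ln (phi1 t)) d1.
  have d3 := is_deriveB (is_deriveB (is_derive_ln_scale k t0)
    (is_derive_cst (ln k) t 1)) d2.
  have := @is_derive1_comp _ (@expR R) _ t _ _ (is_derive_expR _) (is_deriveZ r d3).
  move=> /is_derive_eq; apply; rewrite /f /F /r /GRing.scale /=; field.
  by rewrite !gt_eqF.
have cF t : 0 < t -> {for t, continuous F}.
  by move=> /dF; exact: is_derive_continuous.
have cphi t : 0 < t -> {for t, continuous phi}.
  by move=> /dphi; exact: is_derive_continuous.
have cf t : 0 < t -> {for t, continuous f}.
  move=> t0; apply: cvgM; last exact: cF.
  apply: cvgM.
    by apply: cvgM; [exact: cvg_cst|apply: cvgV => //; rewrite gt_eqF].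
  apply: cvgV; first by rewrite gt_eqF.
  by apply: cvgD; [exact: cvg_cst|exact: cphi].
have f0 t : 0 < t -> 0 <= f t.
  by move=> t0; rewrite /f mulr_ge0 ?expR_ge0// divr_ge0 ?ltW// divr_gt0.
have F01 t : 0 < t -> 0 <= F t <= 1.
  move=> t0; rewrite expR_ge0 /= -expR0 ler_expR mulr_ge0_le0 ?ltW//.
  have -> : k * ln t - ln k = ln (phi t).
    by rewrite /phi ln_div ?posrE ?expR_gt0// expRK.
  by rewrite subr_lt0 ltr_ln ?posrE// ltrDr.
have fi : mu.-integrable `]0, +oo[ (EFin \o f).
  apply: (@ge0_derive_integrable _ _ _ _ F f 1 (exhausts_pos R));
    move=> t; rewrite /= in_itv /= andbT => t0.
  - exact: dF.
  - exact: cf.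
  - exact: f0.
  - exact: F01.
have [N hN] : exists N : nat, r + 1 <= N%:R.
  by exists (Num.bound (r + 1)); apply/ltW/archi_boundP; rewrite addr_ge0// ltW.
pose C := expR (r * ln k) / p * (N`!%:R * expR 1).
have C0 : 0 <= C.
  by apply: mulr_ge0; [apply: divr_ge0; [exact: expR_ge0|exact: ltW]|apply: mulr_ge0; [exact: ler0n|exact: expR_ge0]].
have := @integrableZl _ _ _ mu _ (measurable_itv _) C _ fi.
apply: le_integrable => //.
- apply/measurable_EFinP; apply: open_continuous_measurable_fun => // t.
  rewrite inE /= in_itv /= andbT => t0.
  apply: cvgM.
    exact: is_derive_continuous (is_derive_expR_ln (p - 1) t0).
  apply: (@continuous_comp _ _ _ (fun t => - phi t) (@expR R)).
    by apply: cvgN; exact: cphi.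
  exact: continuous_expR.
- move=> t; rewrite /= in_itv /= andbT => t0.
  rewrite lee_fin ger0_norm ?mulr_ge0 ?expR_ge0// ger0_norm; last first.
    by rewrite mulr_ge0// f0.
  have -> : expR ((p - 1) * ln t) * expR (- (expR (k * ln t) / k)) =
     expR (r * ln k) / p * (expR ((r + 1) * ln (1 + phi t)) * expR (- phi t)) * f t.
    rewrite -/(phi t) /f /F.
    have -> : expR ((r + 1) * ln (1 + phi t)) = expR (r * ln (1 + phi t)) * (1 + phi t).
      by rewrite mulrDl mul1r expRD lnK ?posrE.
    have -> : r * (k * ln t - ln k - ln (1 + phi t)) =
      p * ln t - r * ln k - r * ln (1 + phi t).
      by rewrite /r; field; rewrite gt_eqF.
    have -> : (p - 1) * ln t = p * ln t - ln t by ring.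
    rewrite !expRD !expRN lnK ?posrE//; field.
    by rewrite !gt_eqF ?expR_gt0.
  rewrite ler_wpM2r ?f0// /C ler_wpM2l//.
    by apply: divr_ge0; [exact: expR_ge0|exact: ltW].
  have : expR ((r + 1) * ln (1 + phi t)) <= N`!%:R * expR (1 + phi t).
    by apply: expR_ln_le => //; rewrite lerDl ltW.
  rewrite expRD expRN mulrA -ler_pdivrMr ?expR_gt0//.
Qed.

Lemma powR_expR t k : 0 < t -> t `^ k = expR (k * ln t).
Proof. by move=> t0; rewrite /powR gt_eqF. Qed.

Lemma open_pos : open (`]0, +oo[%classic : set R). Proof. exact: interval_open. Qed.

Lemma cintegrable_gammak k z : 0 < k -> 0 < Re z ->
  cintegrable `]0, +oo[ (fun t => cpow t (z - 1) * (expR (- (t `^ k / k)))%:C).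
Proof.
move=> k0 z0.
have e (t : R) : `]0, +oo[%classic t -> (expR (- (expR (k * ln t) / k)) : R) = expR (- (t `^ k / k)).
  by rewrite /= in_itv /= andbT => /powR_expR ->.
apply: (@cintegrable_le _ _ _ _ _ _ _ (integrable_gammak k0 z0)) => //.
- apply: (@eq_cmeas _ _ (fun t => cpow t (z - 1) * (expR (- (expR (k * ln t) / k)))%:C)).
    by move=> t /e ->.
  apply: open_continuous_cmeas; first exact: open_pos.
  move=> t; rewrite /= in_itv /= andbT => t0.
  apply: ccontinuousM; first exact: continuous_cpow.
  apply: continuous_real_complex.
  apply: (@continuous_comp _ _ _ (fun t => - (expR (k * ln t) / k)) (@expR R)).
    apply: cvgN; apply: cvgM; last exact: cvg_cst.
    exact: is_derive_continuous (is_derive_expR_ln k t0).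
  exact: continuous_expR.
- move=> t Dt; rewrite cabsM cabs_cpow cabs_real ger0_norm ?expR_ge0// e//.
  by rewrite Re_add Re_opp.
Qed.

Lemma cintegrable_gamma z : 0 < Re z ->
  cintegrable `]0, +oo[ (fun t => cpow t (z - 1) * (expR (- t))%:C).
Proof.
move=> z0; have := cintegrable_gammak ltr01 z0.
apply: eq_cintegrable => // t; rewrite /= in_itv /= andbT => t0.
by rewrite powRr1 ?ltW// divr1.
Qed.

Lemma expR_ln_cvg0 (a : R) (y : nat -> R) : 0 < a -> (forall n, 0 < y n) ->
  y n @[n --> \oo] --> 0 -> expR (a * ln (y n)) @[n --> \oo] --> 0.
Proof.
move=> a0 y0 /cvgrPdist_lt h; apply/cvgrPdist_lt => e e0.
apply: filterS (h _ (expR_gt0 (ln e / a))) => n.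
rewrite !sub0r !normrN !gtr0_norm ?expR_gt0// => ye.
rewrite -[ltRHS](lnK e0) ltr_expR mulrC -ltr_pdivlMr//.
by rewrite -[ltRHS]expRK ltr_ln ?posrE ?expR_gt0.
Qed.

Lemma cvg_invS2 : (n.+2%:R^-1 : R) @[n --> \oo] --> 0.
Proof.
have := @cvg_harmonic R; rewrite -(cvg_shiftS (@harmonic R)) /=.
exact.
Qed.

Lemma cvg_invS3 : (n.+3%:R^-1 : R) @[n --> \oo] --> 0.
Proof. by have := cvg_invS2; rewrite -(cvg_shiftS (fun n => n.+2%:R^-1 : R)). Qed.

Lemma ccvg_norm0 (u : nat -> R[i]) : cabs (u n) @[n --> \oo] --> 0 ->
  u n @[n --> \oo] --> 0.
Proof. by move=> h; apply/ccvg_cabsP; under eq_fun do rewrite subr0. Qed.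

(** Integration of the derivative of [t ^ z exp (- t)], whose boundary terms
    vanish. *)
Lemma Gamma_integralS z : 0 < Re z ->
  Gamma_integral (z + 1) = z * Gamma_integral z.
Proof.
move=> z0; have z10 : 0 < Re (z + 1) by rewrite Re_add addr_gt0.
have mD : measurable (`]0, +oo[%classic : set R) by exact: measurable_itv.
pose f1 t := cpow t (z - 1) * (expR (- t))%:C.
pose f2 t := cpow t (z + 1 - 1) * (expR (- t))%:C.
have i1 : cintegrable `]0, +oo[ f1 := cintegrable_gamma z0.
have i2 : cintegrable `]0, +oo[ f2 := cintegrable_gamma z10.
have i : cintegrable `]0, +oo[ (fun t => z * f1 t + (-1) * f2 t).
  by apply: cintegrableD => //; exact: cintegrableZ.
have de (t : R) : is_derive t 1 (fun u => expR (- u)) (- expR (- t)).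
  have := @is_derive1_comp _ (@expR R) _ t _ _ (is_derive_expR _)
    (is_deriveN (is_derive_id t (1 : R))).
  by move=> /is_derive_eq; apply; rewrite mulrN1.
have ce (t : R) : {for t, continuous (fun u => expR (- u))}.
  exact: is_derive_continuous (de t).
suff : cint `]0, +oo[ (fun t => z * f1 t + (-1) * f2 t) = 0.
  rewrite cintD//; [|exact: cintegrableZ..].
  by rewrite !cintZ// mulN1r => /eqP; rewrite subr_eq0 => /eqP e; exact: (esym e).
apply: (@cint_derive _ _ _ _ (fun t => cpow t z * (expR (- t))%:C) _ _ (exhausts_pos R)).
- move=> t; rewrite /= in_itv /= andbT => t0.
  have := cderivM (cderiv_cpow z t0) (cderiv_real (de t)).
  congr cderiv; rewrite /f1 /f2 rmorphN addrK; ring.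
- move=> t; rewrite /= in_itv /= andbT => t0.
  have cg s : {for t, continuous (fun u => cpow u s * (expR (- u))%:C)}.
    apply: ccontinuousM; first exact: continuous_cpow.
    by apply: continuous_real_complex; exact: ce.
  by apply: cvgD; apply: cvgM; [exact: cvg_cst|exact: cg|exact: cvg_cst|exact: cg].
- by [].
- have h1 : cpow n.+2%:R z * (expR (- n.+2%:R))%:C @[n --> \oo] --> (0 : R[i]).
    apply: ccvg_norm0.
    have [N hN] : exists N : nat, Re z + 1 <= N%:R.
      by exists (Num.bound (Re z + 1)); apply/ltW/archi_boundP; rewrite addr_ge0// ltW.
    apply: (@squeeze_cvgr _ _ _ _ (fun=> 0) (fun n => N`!%:R * n.+2%:R^-1)).
    * apply: nearW => n; rewrite cabs_ge0 andTb cabsM cabs_cpow cabs_real.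
      rewrite ger0_norm ?expR_ge0// expRN ler_pdivrMr ?expR_gt0//.
      rewrite mulrAC ler_pdivlMr//.
      have -> : expR (Re z * ln n.+2%:R) * n.+2%:R = expR ((Re z + 1) * ln n.+2%:R) :> R.
        by rewrite mulrDl mul1r expRD lnK// posrE.
      by apply: expR_ln_le => //; rewrite ler1n.
    * exact: cvg_cst.
    * by rewrite -(mulr0 (N`!%:R : R)); apply: cvgM; [exact: cvg_cst|exact: cvg_invS2].
  have h2 : cpow n.+2%:R^-1 z * (expR (- n.+2%:R^-1))%:C @[n --> \oo] --> (0 : R[i]).
    apply: ccvg_norm0.
    apply: (@squeeze_cvgr _ _ _ _ (fun=> 0) (fun n => expR (Re z * ln (n.+2%:R^-1)))).
    * apply: nearW => n; rewrite cabs_ge0 andTb cabsM cabs_cpow cabs_real.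
      rewrite ger0_norm ?expR_ge0// ler_piMr ?expR_ge0//.
    * exact: cvg_cst.
    * by apply: expR_ln_cvg0 => //; exact: cvg_invS2.
  have := cvgB h1 h2; rewrite subr0; exact.
Qed.

End gamma_beta_integrands.

Section beta_integral.
Variable R : realType.
Local Notation mu := (@lebesgue_measure R).
Implicit Types (z s a : R[i]) (x t p q : R).

Definition beta x s a : R[i] :=
  cint `]0, x[ (fun t => cpow t (s - 1) * cpow (x - t) (a - 1)).

Lemma expR_ln_between (e u y w : R) : 0 < u -> u <= y <= w ->
  expR (e * ln y) <= expR (e * ln u) + expR (e * ln w).
Proof.
move=> u0 /andP[uy yw]; have y0 := lt_le_trans u0 uy; have w0 := lt_le_trans y0 yw.
have [e0|e0] := leP 0 e.
- rewrite (@le_trans _ _ (expR (e * ln w)))// ?lerDr ?expR_ge0//.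
  by rewrite ler_expR ler_wpM2l// ler_ln.
- rewrite (@le_trans _ _ (expR (e * ln u)))// ?lerDl ?expR_ge0//.
  by rewrite ler_expR ler_wnM2l ?(ltW e0)// ler_ln.
Qed.

Lemma expR_ln_subr1 (p t : R) : 0 < t -> expR ((p - 1) * ln t) = expR (p * ln t) / t.
Proof. by move=> t0; rewrite mulrBl mul1r expRD expRN lnK ?posrE. Qed.

(** The derivative of [t ^ p - (x - t) ^ q] dominates the integrand up to a
    constant, since one of [t] and [x - t] is at least [x / 2]. *)
Lemma integrable_beta x p q : 0 < x -> 0 < p -> 0 < q ->
  mu.-integrable `]0, x[
    (EFin \o (fun t => expR ((p - 1) * ln t) * expR ((q - 1) * ln (x - t)))).
Proof.
move=> x0 p0 q0.
pose F t := expR (p * ln t) + (expR (q * ln x) - expR (q * ln (x - t))).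
pose f t := p / t * expR (p * ln t) + q / (x - t) * expR (q * ln (x - t)).
have dsub t : is_derive t 1 (fun u => x - u) (-1 : R).
  have := is_deriveB (is_derive_cst x t 1) (is_derive_id t (1 : R)).
  by move=> /is_derive_eq; apply; rewrite sub0r.
have dE t : t < x -> is_derive t 1 (fun u => expR (q * ln (x - u)))
    (- (q / (x - t) * expR (q * ln (x - t)))).
  rewrite -subr_gt0 => tx.
  have := @is_derive1_comp _ _ _ t _ _ (is_derive_expR_ln q tx) (dsub t).
  by move=> /is_derive_eq; apply; rewrite mulrN1.
have dF t : `]0, x[%classic t -> is_derive t 1 F (f t).
  rewrite /= in_itv /= => /andP[t0 tx].
  have := is_deriveD (is_derive_expR_ln p t0)
    (is_deriveB (is_derive_cst (expR (q * ln x)) t 1) (dE t tx)).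
  by move=> /is_derive_eq; apply; rewrite sub0r opprK.
have csub t : {for t, continuous (fun u => x - u)}.
  exact: is_derive_continuous (dsub t).
have cf t : `]0, x[%classic t -> {for t, continuous f}.
  rewrite /= in_itv /= => /andP[t0 tx].
  apply: cvgD; apply: cvgM.
  - by apply: cvgM; [exact: cvg_cst|apply: cvgV => //; rewrite gt_eqF].
  - exact: is_derive_continuous (is_derive_expR_ln p t0).
  - apply: cvgM; first exact: cvg_cst.
    by apply: cvgV; [rewrite gt_eqF// subr_gt0|exact: csub].
  - exact: is_derive_continuous (dE t tx).
have fi : mu.-integrable `]0, x[ (EFin \o f).
  apply: (@ge0_derive_integrable _ _ _ _ F f (expR (p * ln x) + expR (q * ln x))
    (exhausts_oo x0)) => //.
  - move=> t; rewrite /= in_itv /= => /andP[t0 tx].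
    have xt : 0 < x - t by rewrite subr_gt0.
    by rewrite addr_ge0// mulr_ge0 ?expR_ge0// divr_ge0 ?ltW.
  - move=> t; rewrite /= in_itv /= => /andP[t0 tx].
    have xt : 0 < x - t by rewrite subr_gt0.
    have h1 : expR (q * ln (x - t)) <= expR (q * ln x).
      by rewrite ler_expR ler_wpM2l ?(ltW q0)// ler_ln ?posrE// gerDl oppr_le0 ltW.
    have h2 : expR (p * ln t) <= expR (p * ln x).
      by rewrite ler_expR ler_wpM2l ?(ltW p0)// ler_ln ?posrE// ltW.
    have h3 := expR_gt0 (p * ln t).
    have h4 := expR_gt0 (q * ln (x - t)).
    by rewrite /F; apply/andP; split; lra.
pose M e := expR ((e - 1) * ln (x / 2)) + expR ((e - 1) * ln x).
have M0 e : 0 <= M e by rewrite addr_ge0 ?expR_ge0.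
pose C := M q / p + M p / q.
have := @integrableZl _ _ _ mu _ (measurable_itv _) C _ fi.
apply: le_integrable => //.
- apply/measurable_EFinP; apply: open_continuous_measurable_fun.
    exact: interval_open.
  move=> t; rewrite inE /= in_itv /= => /andP[t0 tx].
  have xt : 0 < x - t by rewrite subr_gt0.
  apply: cvgM; first exact: is_derive_continuous (is_derive_expR_ln _ t0).
  have := @is_derive1_comp _ _ _ t _ _ (is_derive_expR_ln (q - 1) xt) (dsub t).
  exact: is_derive_continuous.
- move=> t; rewrite /= in_itv /= => /andP[t0 tx].
  have xt : 0 < x - t by rewrite subr_gt0.
  have [p1 q1] : p != 0 /\ q != 0 by rewrite !gt_eqF.
  have ft : f t = p * expR ((p - 1) * ln t) + q * expR ((q - 1) * ln (x - t)).
    by rewrite /f !expR_ln_subr1//; ring.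
  rewrite lee_fin ger0_norm ?mulr_ge0 ?expR_ge0//.
  apply: le_trans (ler_norm _); rewrite ft.
  set A := expR _; set B := expR _.
  have A0 : 0 <= A by exact: expR_ge0.
  have B0 : 0 <= B by exact: expR_ge0.
  have -> : C * (p * A + q * B) =
      M q * A + M p * B + (M q / p * (q * B) + M p / q * (p * A)).
    by rewrite /C; field; rewrite p1 q1.
  have r0 : 0 <= M q / p * (q * B) + M p / q * (p * A).
    by rewrite addr_ge0// !mulr_ge0// ?invr_ge0 ltW.
  apply: le_trans (_ : M q * A + M p * B <= _); last by rewrite lerDl.
  have [tx2|tx2] := leP t (x / 2).
  + apply: le_trans (_ : M q * A <= _); last by rewrite lerDl mulr_ge0.
    rewrite mulrC ler_wpM2r//; apply: expR_ln_between; first by rewrite divr_gt0.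
    by apply/andP; split; lra.
  + apply: le_trans (_ : M p * B <= _); last by rewrite lerDr mulr_ge0.
    rewrite ler_wpM2r//; apply: expR_ln_between; first by rewrite divr_gt0.
    by apply/andP; split; lra.
Qed.

Lemma continuous_beta x s a t : 0 < t < x ->
  {for t, continuous (fun t => cpow t s * cpow (x - t) a)}.
Proof.
move=> /andP[t0 tx]; apply: ccontinuousM; first exact: continuous_cpow.
exact: continuous_cpow_sub.
Qed.

Lemma cintegrable_beta x s a : 0 < x -> 0 < Re s -> 0 < Re a ->
  cintegrable `]0, x[ (fun t => cpow t (s - 1) * cpow (x - t) (a - 1)).
Proof.
move=> x0 s0 a0.
apply: (@cintegrable_le _ _ _ _ _ _ _ (integrable_beta x0 s0 a0)) => //.
- apply: open_continuous_cmeas; first exact: interval_open.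
  by move=> t; rewrite /= in_itv /=; exact: continuous_beta.
- by move=> t Dt; rewrite cabsM !cabs_cpow !Re_add !Re_opp.
Qed.

Lemma cpow_mul_self t s : 0 < t -> cpow t s = t%:C * cpow t (s - 1).
Proof. by move=> t0; rewrite -cpowS// subrK. Qed.

Lemma cvg_cpow_invS3 x s : 0 < x -> 0 < Re s ->
  cpow (x / n.+3%:R) s @[n --> \oo] --> (0 : R[i]).
Proof.
move=> x0 s0; apply: ccvg_norm0; under eq_fun do rewrite cabs_cpow.
apply: expR_ln_cvg0 => //; first by move=> n; rewrite divr_gt0.
by rewrite -(mulr0 x); apply: cvgM; [exact: cvg_cst|exact: cvg_invS3].
Qed.

Lemma is_cvg_cpow (y : nat -> R) x s : 0 < x -> y n @[n --> \oo] --> x ->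
  cpow (y n) s @[n --> \oo] --> cpow x s.
Proof.
move=> x0 yx.
apply: (@cvg_comp _ _ _ y (fun t => cpow t s) _ _ _ yx).
exact: continuous_cpow.
Qed.

Lemma cvg_sub_invS3 x : x - x / n.+3%:R @[n --> \oo] --> x.
Proof.
rewrite -[X in _ --> X]subr0 -[X in _ --> _ - X](mulr0 x).
by apply: cvgB; [exact: cvg_cst|apply: cvgM; [exact: cvg_cst|exact: cvg_invS3]].
Qed.

(** Integration of the derivative of [t ^ s (x - t) ^ a], whose boundary terms
    vanish. *)
Lemma betaS x s a : 0 < x -> 0 < Re s -> 0 < Re a ->
  (s + a) * beta x s (a + 1) = x%:C * a * beta x s a.
Proof.
move=> x0 s0 a0; have a10 : 0 < Re (a + 1) by rewrite Re_add addr_gt0.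
pose f1 t := cpow t (s - 1) * cpow (x - t) (a + 1 - 1).
pose f2 t := cpow t (s - 1) * cpow (x - t) (a - 1).
have i1 : cintegrable `]0, x[ f1 := cintegrable_beta x0 s0 a10.
have i2 : cintegrable `]0, x[ f2 := cintegrable_beta x0 s0 a0.
have i : cintegrable `]0, x[ (fun t => (s + a) * f1 t + (- (x%:C * a)) * f2 t).
  by apply: cintegrableD => //; exact: cintegrableZ.
suff : cint `]0, x[ (fun t => (s + a) * f1 t + (- (x%:C * a)) * f2 t) = 0.
  rewrite cintD//; [|exact: cintegrableZ..].
  by rewrite !cintZ// mulNr => /eqP; rewrite subr_eq0 => /eqP.
apply: (@cint_derive _ _ _ _ (fun t => cpow t s * cpow (x - t) a) _ _ (exhausts_oo x0)).
- move=> t; rewrite /= in_itv /= => /andP[t0 tx].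
  have := cderivM (cderiv_cpow s t0) (cderiv_cpow_sub a tx).
  have xt : 0 < x - t by rewrite subr_gt0.
  congr cderiv; rewrite /f1 /f2 addrK (cpow_mul_self s t0) (cpow_mul_self a xt).
  rewrite rmorphB; ring.
- move=> t; rewrite /= in_itv /= => tx.
  by apply: cvgD; apply: cvgM; [exact: cvg_cst|exact: continuous_beta|
    exact: cvg_cst|exact: continuous_beta].
- by [].
- have h1 : cpow (x - x / n.+3%:R) s * cpow (x - (x - x / n.+3%:R)) a @[n --> \oo]
      --> (0 : R[i]).
    under eq_fun do rewrite subKr.
    rewrite -(mulr0 (cpow x s)); apply: cvgM.
      by apply: is_cvg_cpow => //; exact: cvg_sub_invS3.
    exact: cvg_cpow_invS3.
  have h2 : cpow (x / n.+3%:R) s * cpow (x - x / n.+3%:R) a @[n --> \oo] --> (0 : R[i]).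
    rewrite -(mul0r (cpow x a)); apply: cvgM; first exact: cvg_cpow_invS3.
    by apply: is_cvg_cpow => //; exact: cvg_sub_invS3.
  have := cvgB h1 h2; rewrite subr0; exact.
Qed.

Lemma beta1 s : 0 < Re s -> beta 1 s 1 = s^-1.
Proof.
move=> s0; have sn : s != 0 by apply: contraTneq s0 => ->; rewrite ltxx.
have i : cintegrable `]0, 1[ (fun t => cpow t (s - 1) * cpow (1 - t) (1 - 1)).
  by apply: cintegrable_beta.
apply: (mulfI sn); rewrite divff// /beta -cintZ//.
apply: (@cint_derive _ _ _ _ (fun t => cpow t s) _ _ (exhausts_oo ltr01)).
- move=> t; rewrite /= in_itv /= => /andP[t0 _].
  by rewrite subrr cpow0 mulr1; exact: cderiv_cpow.
- move=> t; rewrite /= in_itv /= => tx.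
  by apply: cvgM; [exact: cvg_cst|exact: continuous_beta].
- exact: cintegrableZ.
- have := cvgB (@is_cvg_cpow _ 1 s ltr01 (@cvg_sub_invS3 1)) (cvg_cpow_invS3 ltr01 s0).
  rewrite cpow1l subr0; exact.
Qed.

(** Substitution of [x t] for the variable. *)
Lemma beta_scale x s a : 0 < x -> 0 < Re s -> 0 < Re a ->
  beta x s a = cpow x (s + a - 1) * beta 1 s a.
Proof.
move=> x0 s0 a0.
have e t : `]0, 1[%classic t -> cpow x (s + a - 1) * (cpow t (s - 1) * cpow (1 - t) (a - 1))
    = x%:C * (cpow (x * t) (s - 1) * cpow (x - x * t) (a - 1)).
  rewrite /= in_itv /= => /andP[t0 t1].
  have t10 : 0 < 1 - t by rewrite subr_gt0.
  have -> : x - x * t = x * (1 - t) by ring.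
  rewrite !cpowMl//.
  have -> : s + a - 1 = (s - 1) + (a - 1) + 1 by ring.
  by rewrite cpowS// cpowD; ring.
have i1 := cintegrable_beta ltr01 s0 a0.
rewrite /beta -cintZ// (eq_cint e).
apply: (@cint_substitution _ `]0, 1[ `]0, x[ _ _ (fun t => x * t) (fun=> x)
  (fun t => cpow t (s - 1) * cpow (x - t) (a - 1)) (exhausts_oo ltr01)).
- have := exhausts_oo x0; congr exhausts; apply/funext => n /=; ring.
- by move=> t; rewrite /= !in_itv /= => /andP[t0 t1]; rewrite mulr_gt0//= gtr_pMr.
- by move=> u t _ _ ut; rewrite ltr_pM2l.
- move=> t _; have := is_deriveZ x (is_derive_id t (1 : R)).
  by move=> /is_derive_eq; apply; rewrite /GRing.scale /= mulr1.
- by move=> t _; exact: cvg_cst.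
- by move=> t; rewrite /= in_itv /=; exact: continuous_beta.
- exact: cintegrable_beta.
- by apply: (eq_cintegrable _ e) => //; exact: cintegrableZ.
Qed.

End beta_integral.

(** * The Gamma function: Gauss's product, zeros, beta function *)

Section gamma_function.
Variable R : realType.
Local Notation mu := (@lebesgue_measure R).
Implicit Types (z s a : R[i]) (t : R).

Lemma cint_patch (D D' : set R) (f : R -> R[i]) : measurable D' -> D' `<=` D ->
  cint D' f = cint D (fun t => if t \in D' then f t else 0).
Proof.
move=> mD' sub; rewrite -[X in cint X f = _](setIidr sub).
rewrite /cint !Rintegral_mkcondr; congr Complex; apply: eq_Rintegral => t _;
  by rewrite patchE; case: ifP.
Qed.

Lemma cvg_cexp (T : Type) (F : set_system T) {FF : Filter F} (f : T -> R[i]) (l : R[i]) :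
  f x @[x --> F] --> l -> cexp (f x) @[x --> F] --> cexp l.
Proof.
move=> /ccvgP[hr hi]; apply: cvgM.
- apply/ccvgP; split; last exact: cvg_cst.
  exact: (continuous_cvg _ (@continuous_expR R _) hr).
- apply/ccvgP; split => /=.
  + exact: (continuous_cvg _ (@continuous_cos R _) hi).
  + exact: (continuous_cvg _ (@continuous_sin R _) hi).
Qed.

(** The upper bound provides the domination and, with the lower one, the limit
    of [(1 - t / m) ^ m]. *)
Lemma ln_subr_bounds (y : R) : 0 < y < 1 -> - (y / (1 - y)) <= ln (1 - y) <= - y.
Proof.
move=> /andP[y0 y1]; have y10 : 0 < 1 - y by rewrite subr_gt0.
apply/andP; split; last first.
  by rewrite -[1 - y]/(1 + - y) le_ln1Dx// ltrN2.
rewrite -[X in ln X]invrK lnV ?posrE ?invr_gt0// lerN2.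
have e : (1 - y)^-1 = 1 + y / (1 - y) by field; rewrite gt_eqF.
by rewrite [X in ln X]e le_ln1Dx// (@lt_trans _ _ 0) ?ltrN10// divr_gt0.
Qed.

Lemma cvg_invS : (n.+1%:R^-1 : R) @[n --> \oo] --> 0.
Proof. exact: cvg_harmonic. Qed.

Lemma near_lt_nat t : \forall n \near \oo, t < n.+1%:R.
Proof.
exists (Num.bound `|t|) => // n /= h.
apply: le_lt_trans (ler_norm t) _; apply: lt_le_trans (archi_boundP (normr_ge0 t)) _.
by rewrite ler_nat leqW.
Qed.

Lemma cvg_ln_subr t : 0 < t -> n.+1%:R * ln (1 - t / n.+1%:R) @[n --> \oo] --> - t.
Proof.
move=> t0.
apply: (@squeeze_cvgr _ _ _ _ (fun n => - t * (1 - t / n.+1%:R)^-1) (fun=> - t)).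
- apply: filterS (near_lt_nat t) => n tn.
  have n0 : (0 : R) < n.+1%:R by rewrite ltr0n.
  have y01 : 0 < t / n.+1%:R < 1 by rewrite divr_gt0//= ltr_pdivrMr// mul1r.
  have /andP[h1 h2] := ln_subr_bounds y01.
  move: tn n0 h1 h2; move: (n.+1%:R : R) => m tn n0 h1 h2.
  have mt : m - t != 0 by rewrite gt_eqF// subr_gt0.
  have mn0 : m != 0 by rewrite gt_eqF.
  apply/andP; split.
  + rewrite -ler_pdivrMl//; apply: le_trans h1.
    by rewrite le_eqVlt; apply/orP; left; apply/eqP; field; rewrite ?mt ?mn0.
  + rewrite -ler_pdivlMl//; apply: le_trans h2 _.
    by rewrite le_eqVlt; apply/orP; left; apply/eqP; field.
- have h : 1 - t / n.+1%:R @[n --> \oo] --> (1 - t * 0 : R).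
    by apply: cvgB; [exact: cvg_cst|apply: cvgM; [exact: cvg_cst|exact: cvg_invS]].
  rewrite mulr0 subr0 in h.
  have := cvgM (cvg_cst (- t)) (cvgV (oner_neq0 R) h).
  rewrite invr1 mulr1; exact.
- exact: cvg_cst.
Qed.

Lemma cvg_cpow_exp a t : 0 < t ->
  cpow (1 - t / n.+1%:R) (a + n.+1%:R) @[n --> \oo] --> (expR (- t))%:C.
Proof.
move=> t0.
have -> : (expR (- t))%:C = cexp ((- t)%:C).
  by rewrite /cexp /= cos0 sin0 mulr1.
rewrite /cpow; apply: cvg_cexp.
have h1 : 1 + a * (n.+1%:R^-1)%:C @[n --> \oo] --> (1 + a * 0 : R[i]).
  apply: cvgD; first exact: cvg_cst.
  apply: cvgM; first exact: cvg_cst.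
  by apply/ccvgP; split; [exact: cvg_invS|exact: cvg_cst].
have h2 : (n.+1%:R * ln (1 - t / n.+1%:R))%:C @[n --> \oo] --> (- t)%:C.
  by apply/ccvgP; split; [exact: cvg_ln_subr|exact: cvg_cst].
rewrite mulr0 addr0 in h1.
pose g (n : nat) : R[i] := (1 + a * (n.+1%:R^-1)%:C) * (n.+1%:R * ln (1 - t / n.+1%:R))%:C.
have h : g n @[n --> \oo] --> 1 * (- t)%:C by exact: (cvgM h1 h2).
rewrite (mul1r (- t)%:C) in h.
rewrite (_ : (fun n => _) = g)//; apply/funext => n; rewrite /g.
rewrite realCM realCV !natC mulrA; congr (_ * _).
by rewrite mulrDl mul1r mulfVK 1?addrC// pnatr_eq0.
Qed.

Lemma beta_rescale s a (y : R) : 0 < y -> 0 < Re s -> 0 < Re (a + y%:C) ->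
  cintegrable `]0, y[ (fun t => cpow t (s - 1) * cpow (1 - t / y) (a - 1 + y%:C)) /\
  cpow y s * beta 1 s (a + y%:C) =
  cint `]0, y[ (fun t => cpow t (s - 1) * cpow (1 - t / y) (a - 1 + y%:C)).
Proof.
move=> y0 s0 a0; set b := a - 1 + y%:C.
have mI : measurable (`]0, y[%classic : set R) by exact: measurable_itv.
have eb : a + y%:C = b + 1 by rewrite /b; ring.
rewrite eb in a0 *; have ib := cintegrable_beta y0 s0 a0.
rewrite addrK in ib.
have e t : `]0, y[%classic t ->
    cpow y (- b) * (cpow t (s - 1) * cpow (y - t) b) =
    cpow t (s - 1) * cpow (1 - t / y) b.
  rewrite /= in_itv /= => /andP[t0 ty].
  have w0 : 0 < 1 - t / y by rewrite subr_gt0 ltr_pdivrMr// mul1r.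
  have -> : y - t = y * (1 - t / y) by field; rewrite gt_eqF.
  rewrite cpowMl// cpowN; field; exact: cpow_neq0.
split; first by apply: (eq_cintegrable mI e); exact: cintegrableZ.
rewrite -(eq_cint e) cintZ//.
have -> : cint `]0, y[ (fun t => cpow t (s - 1) * cpow (y - t) b) = beta y s (b + 1).
  by rewrite /beta addrK.
rewrite (beta_scale y0 s0 a0) mulrA -cpowD.
by congr (cpow _ _ * _); ring.
Qed.

(** After rescaling to [(0, m)] the integrand is
    [t ^ (s - 1) (1 - t / m) ^ (a + m - 1)], which tends to [t ^ (s - 1) exp (- t)]
    and, as [1 - y <= exp (- y)], is bounded by it. *)
Lemma cvg_beta_Gamma s a : 0 < Re s -> 1 <= Re a ->
  cpow n.+1%:R s * beta 1 s (a + n.+1%:R) @[n --> \oo] --> Gamma_integral s.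
Proof.
move=> s0 a1.
have [m mE] : exists m : nat -> R, m = (fun n => n.+1%:R) by eexists.
have m0 n : 0 < m n by rewrite mE ltr0n.
have lt_m t : \forall n \near \oo, t < m n by rewrite mE; exact: near_lt_nat.
pose h n t := cpow t (s - 1) * cpow (1 - t / m n) (a - 1 + (m n)%:C).
pose f n t := if t \in `]0, m n[%classic then h n t else 0.
have cm t : 0 < t -> h n t @[n --> \oo] --> cpow t (s - 1) * (expR (- t))%:C.
  move=> t0; apply: cvgM; first exact: cvg_cst.
  by rewrite mE; have := cvg_cpow_exp (a - 1) t0; under eq_fun do rewrite -natC.
have a0 n : 0 < Re (a + (m n)%:C).
  by rewrite Re_add; apply: addr_gt0; [exact: lt_le_trans ltr01 a1|exact: m0].
have mD : measurable (`]0, +oo[%classic : set R) by exact: measurable_itv.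
have sub n : `]0, m n[%classic `<=` `]0, +oo[%classic.
  by move=> t; rewrite /= !in_itv /= andbT => /andP[].
have eB n : cpow n.+1%:R s * beta 1 s (a + n.+1%:R) = cint `]0, +oo[ (f n).
  have mI : measurable (`]0, m n[%classic : set R) by exact: measurable_itv.
  rewrite /f -(cint_patch (h n) mI (sub n)) /h.
  by have [_ <-] := beta_rescale (m0 n) s0 (a0 n); rewrite mE natC.
suff c : cint `]0, +oo[ (f n) @[n --> \oo] --> Gamma_integral s.
  by under eq_fun do rewrite eB.
have [] // := @dominated_cint R `]0, +oo[ f (fun t => cpow t (s - 1) * (expR (- t))%:C)
  (fun t => cabs (cpow t (s - 1) * (expR (- t))%:C)) mD.
- move=> n; have mI : measurable (`]0, m n[%classic : set R) by exact: measurable_itv.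
  have [/cintegrable_cmeas [hr hi] _] := beta_rescale (m0 n) s0 (a0 n); split.
  + apply: (@eq_measurable_fun _ _ _ _ _ ((fun t => Re (h n t)) \_ `]0, m n[)).
      by move=> t _; rewrite patchE /f; case: ifP.
    by apply/(measurable_restrict _ mI mD) => //; rewrite setIidr.
  + apply: (@eq_measurable_fun _ _ _ _ _ ((fun t => Im (h n t)) \_ `]0, m n[)).
      by move=> t _; rewrite patchE /f; case: ifP.
    by apply/(measurable_restrict _ mI mD) => //; rewrite setIidr.
- move=> t; rewrite /= in_itv /= andbT => t0.
  apply: cvg_trans (cm _ t0); apply: near_eq_cvg.
  apply: filterS (lt_m t) => n tn.
  by rewrite /f mem_set//= in_itv /= t0.
- by apply: integrable_cabs => //; exact: cintegrable_gamma.
- move=> n t Dt; rewrite /f; cbv beta.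
  have t0 : 0 < t by move: Dt; rewrite /= in_itv /= andbT.
  case: ifP => [|_]; last by rewrite cabs0; exact: cabs_ge0.
  move=> tI; have tm : t < m n by move: tI; rewrite inE /= in_itv /= => /andP[].
  rewrite /h cabsM [leRHS]cabsM ler_wpM2l ?cabs_ge0// cabs_cpow cabs_real ger0_norm ?expR_ge0//.
  rewrite ler_expR !Re_add Re_opp /=.
  have y01 : 0 < t / m n < 1 by rewrite divr_gt0//= ltr_pdivrMr// mul1r.
  have /andP[_ h2] := ln_subr_bounds y01.
  apply: (@le_trans _ _ (m n * - (t / m n))); last first.
    by rewrite mulrN lerN2 mulrCA divff ?mulr1// gt_eqF.
  apply: (@le_trans _ _ (m n * ln (1 - t / m n))); last by rewrite ler_wpM2l// ltW.
  rewrite ler_wnM2r//; last by rewrite lerDr subr_ge0.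
  by apply: le_trans h2 _; rewrite oppr_le0 ltW//; case/andP: y01.
Qed.

Lemma pochS z n : pochhammer z n.+1 = pochhammer z n * (z + n%:R).
Proof. by rewrite /pochhammer big_ord_recr. Qed.

Lemma poch0 z : pochhammer z 0 = 1. Proof. by rewrite /pochhammer big_ord0. Qed.

Lemma pochSl z n : pochhammer z n.+1 = z * pochhammer (z + 1) n.
Proof.
rewrite /pochhammer big_ord_recl /= addr0; congr (_ * _).
by apply: eq_bigr => i _; rewrite /bump /= add1n -addrA -natr1 [1 + _]addrC.
Qed.

Lemma pochD z m n : pochhammer z (m + n) = pochhammer z m * pochhammer (z + m%:R) n.
Proof.
elim: n => [|n ih]; first by rewrite addn0 poch0 mulr1.
by rewrite addnS !pochS ih natrD mulrA addrA.
Qed.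

Lemma poch1 n : pochhammer (1 : R[i]) n = n`!%:R.
Proof.
elim: n => [|n ih]; first by rewrite poch0.
by rewrite pochS ih factS mulnC natrM -natr1 [1 + _]addrC.
Qed.

Lemma nonpole_neq0 z n : ~ nonpos_integer z -> z + n%:R != 0.
Proof. by move=> h; apply/eqP => /eqP; rewrite addr_eq0 => /eqP zn; apply: h; exists n. Qed.

Lemma poch_neq0 z n : ~ nonpos_integer z -> pochhammer z n != 0.
Proof. by move=> h; rewrite /pochhammer prodf_seq_neq0; apply/allP => i _; exact: nonpole_neq0. Qed.

Lemma nonpoleS z n : ~ nonpos_integer z -> ~ nonpos_integer (z + n%:R).
Proof.
move=> h [m hm]; apply: h; exists (m + n)%N.
by rewrite natrD opprD -hm addrK.
Qed.

Lemma nonpole_pos z : 0 < Re z -> ~ nonpos_integer z.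
Proof. by move=> z0 [m hm]; move: z0; rewrite hm Re_opp Re_nat oppr_gt0 ltrn0. Qed.

Lemma beta_poch s a n : 0 < Re s -> 0 < Re a ->
  beta 1 s (a + n%:R) = pochhammer a n / pochhammer (s + a) n * beta 1 s a.
Proof.
move=> s0 a0; elim: n => [|n ih]; first by rewrite addr0 !poch0 divr1 mul1r.
have an0 : 0 < Re (a + n%:R) by rewrite Re_add Re_nat (lt_le_trans a0)// lerDl.
have np : ~ nonpos_integer (s + a) by apply: nonpole_pos; rewrite Re_add addr_gt0.
have := betaS ltr01 s0 an0; rewrite ih mul1r addrA => h.
apply: (mulfI (nonpole_neq0 n np)).
rewrite -natr1 addrA h !pochS; field.
by rewrite poch_neq0// nonpole_neq0.
Qed.

(** Gauss's product [m ^ z m! / (z (z + 1) ... (z + m))] with [m = n + 1]. *)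
Definition gprod z n : R[i] := cpow n.+1%:R z * n.+1`!%:R / pochhammer z n.+2.

(** The case [a = 1] of [cvg_beta_Gamma], where the beta integral is a quotient
    of a factorial and a Pochhammer symbol. *)
Lemma cvg_gprod_Gamma_integral s : 0 < Re s -> gprod s n @[n --> \oo] --> Gamma_integral s.
Proof.
move=> s0; have np := nonpole_pos s0.
have := @cvg_beta_Gamma s 1 s0 (lexx _).
rewrite (_ : (fun n => _) = gprod s)//.
apply/funext => n; rewrite beta_poch// beta1// poch1 /gprod (pochSl s).
rewrite invfM; move: (_`!%:R) (cpow _ s) => A B; field.
have sn : s != 0 by have := nonpole_neq0 0 np; rewrite addr0.
by rewrite sn poch_neq0//; exact: (@nonpoleS _ 1).
Qed.

(** The integrand is positive, and at least [exp (- 2)] on [[1, 2]]. *)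
Lemma Gamma_integral_real_neq0 (a : R) : 1 <= a -> Gamma_integral a%:C != 0.
Proof.
move=> a1; apply/eqP => G0; have {}G0 : Re (Gamma_integral a%:C) = 0 by rewrite G0.
have a0 : 0 < Re a%:C by rewrite (lt_le_trans ltr01).
have [ir _] := cintegrable_gamma a0.
have fE (t : R) : 0 < t ->
    Re (cpow t (a%:C - 1) * (expR (- t))%:C) = expR ((a - 1) * ln t) * expR (- t).
  by move=> t0; rewrite cpowE Re_mul /= subr0 mul0r cos0 mulr1 mulr0 subr0.
suff : 0 < \int[mu]_(t in `]0, +oo[) Re (cpow t (a%:C - 1) * (expR (- t))%:C).
  by rewrite -[X in 0 < X]/(Re (Gamma_integral a%:C)) G0 ltxx.
have D12 : `[1, 2]%classic `<=` (`]0, +oo[%classic : set R).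
  by move=> t; rewrite /= !in_itv /= andbT => /andP[h _]; exact: lt_le_trans h.
have m12 : measurable (`[1, 2]%classic : set R) by exact: measurable_itv.
have mD : measurable (`]0, +oo[%classic : set R) by exact: measurable_itv.
have i12 := @integrableS _ _ _ mu _ _ _ mD m12 D12 ir.
apply: (@lt_le_trans _ _ (\int[mu]_(t in `[1, 2]) (expR (- 2) : R))).
  rewrite Rintegral_cst// /= lebesgue_measure_itv /= lte_fin ltr1n.
  by rewrite mulr_gt0 ?expR_gt0//= subr_gt0 ltr1n.
apply: (@le_trans _ _ (\int[mu]_(t in `[1, 2]) Re (cpow t (a%:C - 1) * (expR (- t))%:C))).
  apply: le_Rintegral => //.
    apply: (@continuous_compact_integrable R (fun=> expR (- 2))).
      exact: segment_compact.
    by apply: continuous_in_subspaceT => t _; exact: cvg_cst.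
  move=> t Dt; cbv beta.
  have [t1 t2] : 1 <= t /\ t <= 2 by move: Dt; rewrite /= in_itv /= => /andP[].
  rewrite fE ?(lt_le_trans ltr01)// -[leLHS]mul1r ler_pM ?expR_ge0//.
    by rewrite -[leLHS]expR0 ler_expR mulr_ge0 ?subr_ge0 ?ln_ge0.
  by rewrite ler_expR lerN2.
rewrite /Rintegral fine_le ?integrable_fin_num//.
apply: ge0_subset_integral => //.
  by have /integrableP[] := ir.
move=> t Dt; have t0 : 0 < t by move: Dt; rewrite /= in_itv /= andbT.
by rewrite lee_fin fE// mulr_ge0 ?expR_ge0.
Qed.

(** Off the real axis the factors of the Gauss product satisfy
    [|z + j| ^ 2 = (Re z + j) ^ 2 (1 + (Im z) ^ 2 / (Re z + j) ^ 2)], and the product of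
    the last factors stays below [1 / (1 - 2 (Im z) ^ 2 / Re z)]. *)
Lemma cabs_poch_le z n : 1 <= Re z -> 2 * Im z ^+ 2 <= Re z ->
  (1 - 2 * Im z ^+ 2 / Re z) * cabs (pochhammer z n) ^+ 2 <=
  (1 - 2 * Im z ^+ 2 / (Re z + n%:R)) * cabs (pochhammer (Re z)%:C n) ^+ 2.
Proof.
set b2 := Im z ^+ 2; have b20 : 0 <= b2 by exact: sqr_ge0.
move=> a1 ab; elim: n => [|n ih]; first by rewrite !poch0 addr0.
rewrite !pochS !cabsM !exprMn mulrA.
apply: le_trans (ler_wpM2r (sqr_ge0 _) ih) _.
set t := Re z + n%:R.
have t1 : 1 <= t by rewrite (le_trans a1)// lerDl.
have t0 : 0 < t by exact: lt_le_trans t1.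
rewrite [leLHS]mulrAC [leLHS]mulrC [leRHS]mulrCA ler_wpM2l ?sqr_ge0//.
have -> : cabs (z + n%:R) ^+ 2 = t ^+ 2 + b2.
  by rewrite sqr_cabs Re_add Im_add Re_nat Im_nat addr0.
have -> : cabs ((Re z)%:C + n%:R) ^+ 2 = t ^+ 2.
  by rewrite sqr_cabs Re_add Im_add Re_nat Im_nat /= addr0 expr0n addr0.
have -> : Re z + n.+1%:R = t + 1 by rewrite /t -natr1 addrA.
rewrite -subr_ge0.
have -> : (1 - 2 * b2 / (t + 1)) * t ^+ 2 - (1 - 2 * b2 / t) * (t ^+ 2 + b2) =
   b2 * (2 * b2 / t + (t - 1) / (t + 1)).
  by field; rewrite !gt_eqF// addr_gt0.
by apply: mulr_ge0 => //; apply: addr_ge0; apply: divr_ge0; lra.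
Qed.

Lemma cabs_gprod z n : cabs (gprod z n) =
  expR (Re z * ln n.+1%:R) * n.+1`!%:R / cabs (pochhammer z n.+2).
Proof. by rewrite /gprod cabsM cabsV cabsM cabs_cpow cabs_nat. Qed.

Lemma cabs_gprod_ge z n : 1 <= Re z -> 2 * Im z ^+ 2 <= Re z ->
  (1 - 2 * Im z ^+ 2 / Re z) * cabs (gprod (Re z)%:C n) ^+ 2 <= cabs (gprod z n) ^+ 2.
Proof.
move=> a1 ab; rewrite !cabs_gprod; set K := expR _ * _.
rewrite [X in X <= _]mulrC !exprMn -[leLHS]mulrA ler_wpM2l ?sqr_ge0//.
have a0 : 0 < Re z := lt_le_trans ltr01 a1.
have p1 : 0 < cabs (pochhammer z n.+2) ^+ 2.
  by rewrite exprn_gt0// cabs_gt0 poch_neq0//; exact: nonpole_pos.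
have p2 : 0 < cabs (pochhammer (Re z)%:C n.+2) ^+ 2.
  by rewrite exprn_gt0// cabs_gt0 poch_neq0//; exact: nonpole_pos.
rewrite !exprVn [leLHS]mulrC ler_pdivrMr// [leRHS]mulrC ler_pdivlMr//.
apply: le_trans (cabs_poch_le n.+2 a1 ab) _.
rewrite ler_piMl ?sqr_ge0// gerBl; apply: divr_ge0.
  by apply: mulr_ge0 => //; exact: sqr_ge0.
by apply: addr_ge0 => //; exact: ltW.
Qed.

(** The limit of [cabs_gprod_ge]: the modulus of Gamma at [z] is bounded below by
    a multiple of its value at [Re z]. *)
Lemma Gamma_integral_neq0_large z : 1 <= Re z -> 2 * Im z ^+ 2 < Re z ->
  Gamma_integral z != 0.
Proof.
move=> a1 ab; have a0 : 0 < Re z := lt_le_trans ltr01 a1.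
have c1 : cabs (gprod z n) @[n --> \oo] --> cabs (Gamma_integral z).
  by apply: cvg_cabs; exact: cvg_gprod_Gamma_integral.
have c2 : cabs (gprod (Re z)%:C n) @[n --> \oo] --> cabs (Gamma_integral (Re z)%:C).
  by apply: cvg_cabs; exact: cvg_gprod_Gamma_integral.
have h : (1 - 2 * Im z ^+ 2 / Re z) * (cabs (Gamma_integral (Re z)%:C) *
    cabs (Gamma_integral (Re z)%:C)) <= cabs (Gamma_integral z) * cabs (Gamma_integral z).
  apply: (@ler_cvg_to _ \oo _ R (fun n => (1 - 2 * Im z ^+ 2 / Re z) *
      (cabs (gprod (Re z)%:C n) * cabs (gprod (Re z)%:C n)))
      (fun n => cabs (gprod z n) * cabs (gprod z n))).
  - by apply: cvgM; [exact: cvg_cst|exact: (cvgM c2 c2)].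
  - exact: (cvgM c1 c1).
  - by apply: nearW => n; exact: (cabs_gprod_ge n a1 (ltW ab)).
rewrite -cabs_gt0 lt_def cabs_ge0 andbT.
apply: contraTneq h => ->; rewrite mul0r -ltNge !mulr_gt0 ?cabs_gt0 ?Gamma_integral_real_neq0//.
by rewrite subr_gt0 ltr_pdivrMr// mul1r.
Qed.

Lemma Gamma_integral_poch z n : 0 < Re z ->
  Gamma_integral (z + n%:R) = pochhammer z n * Gamma_integral z.
Proof.
move=> z0; elim: n => [|n ih]; first by rewrite addr0 poch0 mul1r.
rewrite -natr1 addrA Gamma_integralS; last by rewrite Re_add Re_nat (lt_le_trans z0)// lerDl.
by rewrite ih pochS; ring.
Qed.

(** The functional equation moves [z] into the region where the imaginary part
    is small in comparison with the real part. *)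
Lemma Gamma_integral_neq0 z : 0 < Re z -> Gamma_integral z != 0.
Proof.
move=> z0; pose N := Num.bound (1 + 2 * Im z ^+ 2).
have B0 : 0 <= 1 + 2 * Im z ^+ 2 by rewrite addr_ge0// mulr_ge0// sqr_ge0.
have hN : 1 + 2 * Im z ^+ 2 < N%:R := archi_boundP B0.
have : Gamma_integral (z + N%:R) != 0.
  apply: Gamma_integral_neq0_large; rewrite !Re_add ?Im_add Re_nat ?Im_nat.
  - have := sqr_ge0 (Im z); lra.
  - by rewrite addr0; lra.
by rewrite Gamma_integral_poch// mulf_eq0 negb_or => /andP[].
Qed.

Lemma norm_lt_bound (r : R) : `|r| < (Num.bound r)%:R.
Proof. by have := archi_boundP (normr_ge0 r); rewrite /Num.bound normr_id. Qed.

(** The shift chosen in the definition of [Gamma] is immaterial, by the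
    functional equation. *)
Lemma Gamma_shift z n : ~ nonpos_integer z -> 0 < Re z + n%:R ->
  Gamma z = Gamma_integral (z + n%:R) / pochhammer z n.
Proof.
move=> np zn; rewrite /Gamma; case: ifP => [z0|_].
  by rewrite Gamma_integral_poch// mulrC mulKf// poch_neq0.
set N := Num.bound _.
have zN : 0 < Re z + N%:R.
  have := norm_lt_bound (Re z).
  by rewrite ltr_norml => /andP[h _]; rewrite -ltrBlDr sub0r.
wlog nN : n N zn zN / (n <= N)%N.
  by move=> h; have [/h|/ltnW/h] := leqP n N; [exact|move=> ->].
have [k ->] : exists k, N = (n + k)%N by exists (N - n)%N; rewrite subnKC.
rewrite natrD addrA (@Gamma_integral_poch (z + n%:R) k) ?Re_add ?Re_nat//.
rewrite pochD; field; rewrite poch_neq0//=; apply: poch_neq0; exact: nonpoleS.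
Qed.

Lemma exists_shift (r : R) : exists n : nat, 0 < r + n%:R.
Proof.
exists (Num.bound r); have := norm_lt_bound r.
by rewrite ltr_norml => /andP[h _]; rewrite -ltrBlDr sub0r.
Qed.

Lemma Gamma_neq0 z : ~ nonpos_integer z -> Gamma z != 0.
Proof.
move=> np; have [n hn] := exists_shift (Re z).
rewrite (Gamma_shift np hn) mulf_neq0 ?invr_neq0 ?poch_neq0//.
by apply: Gamma_integral_neq0; rewrite Re_add Re_nat.
Qed.

Lemma Gamma_poch z n : ~ nonpos_integer z ->
  Gamma (z + n%:R) = pochhammer z n * Gamma z.
Proof.
move=> np; have [m hm] := exists_shift (Re z).
have hmn : 0 < Re z + (n + m)%:R by rewrite natrD addrCA ltr_wpDl.
have hnm : 0 < Re (z + n%:R) + m%:R by rewrite Re_add Re_nat -addrA -natrD.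
rewrite (Gamma_shift (nonpoleS np) hnm) (Gamma_shift np hmn) -addrA -natrD pochD.
by field; rewrite !poch_neq0//; exact: nonpoleS.
Qed.

Lemma Gamma_pos z : 0 < Re z -> Gamma z = Gamma_integral z.
Proof. by rewrite /Gamma => ->. Qed.

(** Gauss's product satisfies the functional equation of Gamma up to a factor
    tending to 1, which carries its limit to the left half-plane. *)
Lemma gprodS z n : ~ nonpos_integer z ->
  gprod z n = (1 + (z + 1) * (n.+1%:R^-1)%:C) / z * gprod (z + 1) n.
Proof.
move=> np; have z0 : z != 0 by have := nonpole_neq0 0 np; rewrite addr0.
rewrite /gprod cpowS ?ltr0n// realCV !natC pochSl [in RHS]pochS.
have h : z + 1 + n.+1%:R != 0 by rewrite -addrA nat1r nonpole_neq0.
have n0 : (n.+1%:R : R[i]) != 0 by rewrite pnatr_eq0.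
have p0 : pochhammer (z + 1) n.+1 != 0 by apply: poch_neq0; exact: (@nonpoleS _ 1).
move: h n0 p0; move: (n.+1%:R : R[i]) (n.+1`!%:R : R[i]) (pochhammer _ _) => N f p h n0 p0.
field.
by rewrite ?h ?z0 ?n0 ?p0.
Qed.

Lemma cvg_gprod z : ~ nonpos_integer z -> gprod z n @[n --> \oo] --> Gamma z.
Proof.
have [n] := exists_shift (Re z); elim: n z => [|n ih] z.
  by rewrite addr0 => z0 _; rewrite Gamma_pos//; exact: cvg_gprod_Gamma_integral.
move=> hz np; have z0 : z != 0 by have := nonpole_neq0 0 np; rewrite addr0.
have c := ih (z + 1) _ (@nonpoleS _ 1 np).
rewrite (_ : gprod z = (fun n => (1 + (z + 1) * (n.+1%:R^-1)%:C) / z * gprod (z + 1) n)).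
  have -> : Gamma z = (1 + (z + 1) * 0) / z * Gamma (z + 1).
    by rewrite (@Gamma_poch _ 1) // pochS poch0 mul1r !addr0 mulr0 addr0; field.
  apply: cvgM; last by apply: c; rewrite Re_add /= -addrA nat1r.
  apply: cvgM; last exact: cvg_cst.
  apply: cvgD; first exact: cvg_cst.
  apply: cvgM; first exact: cvg_cst.
  by apply/ccvgP; split; [exact: cvg_invS|exact: cvg_cst].
by apply/funext => k; exact: gprodS.
Qed.

(** [B (s, a + m)] is asymptotically [m ^ (- s) Gamma (s)], while the recurrence
    expresses [B (s, a + m) / B (s, a)] by Gauss's products at [a] and [s + a]. *)
Lemma betaE s a : 0 < Re s -> 0 < Re a ->
  beta 1 s a = Gamma s * Gamma a / Gamma (s + a).
Proof.
move=> s0 a0; have sa0 : 0 < Re (s + a) by rewrite Re_add addr_gt0.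
have npa := nonpole_pos a0; have npsa := nonpole_pos sa0.
have a10 : 1 <= Re (a + 1) by rewrite Re_add /= lerDr ltW.
have c1 := cvg_beta_Gamma s0 a10.
pose u n := gprod (s + a) n * (gprod a n)^-1 * beta 1 s a.
have c2 : u n @[n --> \oo] --> Gamma (s + a) * (Gamma a)^-1 * beta 1 s a.
  apply: cvgM; last exact: cvg_cst.
  apply: cvgM; first exact: cvg_gprod.
  by apply: cvgV; [exact: Gamma_neq0|exact: cvg_gprod].
have uE : (fun n => cpow n.+1%:R s * beta 1 s (a + 1 + n.+1%:R)) = u.
  apply/funext => n; rewrite -addrA nat1r beta_poch// /u /gprod cpowD.
  have q1 := poch_neq0 n.+2 npa; have q2 := poch_neq0 n.+2 npsa.
  have q3 : (n.+1`!%:R : R[i]) != 0 by rewrite pnatr_eq0 -lt0n fact_gt0.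
  move: q3; move: (_`!%:R : R[i]) => f q3.
  field.
  by rewrite q1 q2 q3 !cpow_neq0.
have e : Gamma_integral s = Gamma (s + a) * (Gamma a)^-1 * beta 1 s a.
  by rewrite uE in c1; exact: (ccvg_unique c1 c2).
rewrite (Gamma_pos s0) e; field.
by rewrite !Gamma_neq0.
Qed.

End gamma_function.

(** * Gauss's summation theorem *)

Section gauss_summation.
Variable R : realType.
Implicit Types (a b c z : R[i]) (v : nat -> R) (C y : R).

Lemma cvg_series_mull (k : R) v : cvgn (series v) ->
  series (fun n => k * v n) @ \oo --> k * limn (series v).
Proof.
move=> cv; rewrite (_ : series _ = (fun n => k * series v n)).
  by apply: cvgM; [exact: cvg_cst|exact: cv].
by apply/funext => n; rewrite /series /= mulr_sumr.
Qed.

Lemma is_cvg_series_mull (k : R) v : cvgn (series v) ->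
  cvgn (series (fun n => k * v n)).
Proof. by move=> cv; apply/cvg_ex; eexists; exact: cvg_series_mull. Qed.

(** Kummer's test with the weights [j]: the right-hand sides telescope, which
    bounds the sum; the decreasing sequence [j v_j] tends to 0, as otherwise [v]
    would dominate a multiple of the harmonic series. *)
Lemma kummer_test v (d : R) (J : nat) : 0 < d -> (forall j, 0 <= v j) ->
  (forall j, (J <= j)%N -> d * v j <= j%:R * v j - j.+1%:R * v j.+1) ->
  cvgn (series v) /\ j%:R * v j @[j --> \oo] --> 0.
Proof.
move=> d0 v0 h; pose w j := j%:R * v j.
have w0 j : 0 <= w j by rewrite mulr_ge0.
have hw j : (J <= j)%N -> d * v j <= w j - w j.+1 by exact: h.
have sJ n : d * \sum_(J <= j < J + n) v j <= w J - w (J + n)%N.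
  elim: n => [|n ih]; first by rewrite addn0 big_geq// mulr0 subrr.
  rewrite addnS big_nat_recr ?leq_addr//= mulrDr.
  have := hw (J + n)%N (leq_addr _ _); lra.
have cv : cvgn (series v).
  apply: nondecreasing_is_cvgn; first by apply: nondecreasing_series => n _ _; exact: v0.
  exists (series v J + w J / d) => _ [n _ <-].
  have [nJ|/ltnW Jn] := leqP n J.
    apply: (@le_trans _ _ (series v J)); last by rewrite lerDl divr_ge0// ltW.
    by apply: nondecreasing_series => // k _ _; exact: v0.
  rewrite -[X in X <= _](subrK (series v J)) addrC lerD2l sub_series_geq//.
  rewrite ler_pdivlMr// mulrC -(subnKC Jn); apply: le_trans (sJ _) _.
  by rewrite gerBl.
split => //.
have wd n : (J <= n)%N -> w n.+1 <= w n.
  by move=> /hw; have := mulr_ge0 (ltW d0) (v0 n); lra.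
have wc : cvgn (fun n => w (J + n)%N).
  apply: nonincreasing_is_cvgn.
    by apply/nonincreasing_seqP => n; rewrite addnS; apply: wd; rewrite leq_addr.
  by exists 0 => _ [n _ <-].
pose L := limn (fun n => w (J + n)%N).
have wL n : (J <= n)%N -> L <= w n.
  move=> Jn; rewrite -(subnKC Jn).
  apply: (nonincreasing_cvgn_ge _ wc).
  by apply/nonincreasing_seqP => k; rewrite addnS; apply: wd; rewrite leq_addr.
have L0 : 0 <= L by apply: limr_ge => //; apply: nearW => n.
have wcL : w n @[n --> \oo] --> L.
  by rewrite -(cvg_shiftn J); under eq_fun do rewrite addnC; exact: wc.
suff -> : 0 = L by [].
apply/eqP; rewrite eq_le L0 /= leNgt; apply/negP => Lp.
apply: (@dvg_harmonic R).
(* The geometric term takes care of the finitely many indices below [J]. *)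
have cv' : cvgn (series (fun n => L^-1 * v n + geometric (2 ^+ J) 2^-1 n)).
  apply: is_cvg_seriesD; first exact: is_cvg_series_mull.
  by apply: is_cvg_geometric_series; rewrite ger0_norm ?invr_ge0// invf_lt1 ?ltr1n.
have vL n : 0 <= L^-1 * v n by rewrite mulr_ge0// invr_ge0.
have g0 n : 0 <= geometric (2 ^+ J) 2^-1 n :> R.
  by rewrite /geometric /= mulr_ge0// exprn_ge0.
suff le_ n : harmonic n <= L^-1 * v n + geometric (2 ^+ J) 2^-1 n :> R.
  by apply: series_le_cvg cv' => // n; [exact: harmonic_ge0|exact: addr_ge0].
have [nJ|Jn] := leqP n J.
  apply: (@le_trans _ _ 1); first by rewrite /harmonic /= invf_le1// ler1n.
  rewrite (@le_trans _ _ (geometric (2 ^+ J) 2^-1 n))// ?lerDr// /geometric /=.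
  by rewrite exprVn ler_pdivlMr ?exprn_gt0// mul1r ler_weXn2l// ler1n.
apply: (@le_trans _ _ (L^-1 * v n)); last by rewrite lerDl.
have n0 : (0 : R) < n%:R by rewrite ltr0n (leq_ltn_trans _ Jn).
have h1 : L <= n%:R * v n by apply: wL; exact: ltnW.
rewrite ler_pdivlMl// mulrC /harmonic /=.
apply: (@le_trans _ _ (n%:R^-1 * L)).
  by rewrite ler_wpM2r// lef_pV2 ?posrE// ler_nat.
by rewrite ler_pdivrMl.
Qed.

Lemma cabs_add_nat_sqr a n :
  cabs (a + n%:R) ^+ 2 = n%:R ^+ 2 + 2 * Re a * n%:R + cabs a ^+ 2.
Proof. by rewrite !sqr_cabs Re_add Im_add Re_nat Im_nat; ring. Qed.

Lemma cabs_mul_add_nat a b n : cabs (a + n%:R) * cabs (b + n%:R) <=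
  n%:R ^+ 2 + (Re a + Re b) * n%:R + (cabs a ^+ 2 + cabs b ^+ 2) / 2.
Proof.
have := sqr_ge0 (cabs (a + n%:R) - cabs (b + n%:R)).
rewrite sqrrB !cabs_add_nat_sqr; lra.
Qed.

Lemma nat_above (r : R) : exists J : nat, forall j, (J <= j)%N -> r <= j%:R.
Proof.
exists (Num.bound r) => j Jj.
apply: le_trans (ler_norm r) _; apply: le_trans (ltW (norm_lt_bound r)) _.
by rewrite ler_nat.
Qed.

(** Condition under which the series [2F1 (a, b; c; 1)] with [Re c = C] converges
    absolutely: either it terminates or its terms decrease fast enough. *)
Definition gauss_cond a b C :=
  Re a + Re b < C \/ (nonpos_integer a \/ nonpos_integer b).

Lemma gauss_cond_le a b C C' : C <= C' -> gauss_cond a b C -> gauss_cond a b C'.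
Proof. by move=> CC [h|h]; [left; exact: lt_le_trans CC|right]. Qed.

(** The arithmetic-geometric inequality bounds [|a + j| |b + j|] by
    [j ^ 2 + (Re a + Re b) j + O(1)], so that Kummer's test applies. *)
Lemma hypergeometric_test a b C v : 0 < C -> gauss_cond a b C ->
  (forall j, 0 <= v j) ->
  (forall j, v j.+1 * (j.+1%:R * (C + j%:R)) <=
     cabs (a + j%:R) * cabs (b + j%:R) * v j) ->
  cvgn (series v) /\ j%:R * v j @[j --> \oo] --> 0.
Proof.
move=> C0 cond v0 h.
have Cj j : 0 < C + j%:R by rewrite (lt_le_trans C0)// lerDl.
case: cond => [lt|cond].
- pose d := (C - (Re a + Re b)) / 2; have d0 : 0 < d by rewrite divr_gt0// subr_gt0.
  pose K := (cabs a ^+ 2 + cabs b ^+ 2) / 2.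
  have [J hJ] := nat_above ((K + d * C) / d).
  apply: (@kummer_test v d J d0 v0) => j /hJ; rewrite ler_pdivrMr// => jK.
  have h1 := le_trans (h j) (ler_wpM2r (v0 j) (cabs_mul_add_nat a b j)).
  rewrite -/K in h1.
  rewrite lerBrDr -lerBrDl -mulrBl -(ler_pM2r (Cj j)).
  have -> : j.+1%:R * v j.+1 * (C + j%:R) = v j.+1 * (j.+1%:R * (C + j%:R)) by ring.
  apply: le_trans h1 _; rewrite mulrAC ler_wpM2r//.
  rewrite -subr_ge0.
  have -> : (j%:R - d) * (C + j%:R) - (j%:R ^+ 2 + (Re a + Re b) * j%:R + K) =
     j%:R * d - (K + d * C) by rewrite /d; field.
  by rewrite subr_ge0.
- have [m hm] : exists m, v m.+1 = 0.
    have z m : cabs (a + m%:R) * cabs (b + m%:R) = 0 -> v m.+1 = 0.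
      move=> e; apply/eqP; rewrite eq_le v0 andbT.
      have := h m; rewrite e mul0r pmulr_lle0// mulr_gt0//.
    by case: cond => -[m e]; exists m; apply: z; rewrite e addNr cabs0 ?mulr0 ?mul0r.
  have vz j : (m < j)%N -> v j = 0.
    elim: j => // j ih; rewrite ltnS leq_eqVlt => /predU1P[<-//|/ih e].
    apply/eqP; rewrite eq_le v0 andbT.
    by have := h j; rewrite e mulr0 pmulr_lle0// mulr_gt0.
  apply: (@kummer_test v 1 m.+1 ltr01 v0) => j mj.
  by rewrite !vz ?mulr0 ?subr0// ltnS ltnW.
Qed.

Definition hyp_coef a b c n : R[i] :=
  pochhammer a n * pochhammer b n / (pochhammer c n * n`!%:R).

Lemma hyp_coef0 a b c : hyp_coef a b c 0 = 1.
Proof. by rewrite /hyp_coef !poch0 fact0 !mulr1 divr1. Qed.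

Lemma cabs_hyp_coef a b c n : cabs (hyp_coef a b c n) =
  cabs (pochhammer a n) * cabs (pochhammer b n) / (cabs (pochhammer c n) * n`!%:R).
Proof. by rewrite /hyp_coef !cabsM cabsV cabsM cabs_nat. Qed.

Lemma hyp_coefS a b c n : ~ nonpos_integer c ->
  hyp_coef a b c n.+1 * (n.+1%:R * (c + n%:R)) =
  (a + n%:R) * (b + n%:R) * hyp_coef a b c n.
Proof.
move=> np; rewrite /hyp_coef !pochS factS natrM.
have h1 := nonpole_neq0 n np; have h2 := poch_neq0 n np.
have h3 : (n.+1%:R : R[i]) != 0 by rewrite pnatr_eq0.
have h4 : (n`!%:R : R[i]) != 0 by rewrite pnatr_eq0 -lt0n fact_gt0.
move: h3 h4; move: (n.+1%:R : R[i]) (n`!%:R : R[i]) => N f h3 h4.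
by field; rewrite h1 h2 h3 h4.
Qed.

Lemma cabs_add_nat_ge c n : 0 < Re c -> Re c + n%:R <= cabs (c + n%:R).
Proof. by move=> c0; have := Re_le_cabs (c + n%:R); rewrite Re_add Re_nat. Qed.

Lemma hyp_coef_ratio a b c n : 0 < Re c ->
  cabs (hyp_coef a b c n.+1) * (n.+1%:R * (Re c + n%:R)) <=
  cabs (a + n%:R) * cabs (b + n%:R) * cabs (hyp_coef a b c n).
Proof.
move=> c0; rewrite -!cabsM -hyp_coefS; last exact: nonpole_pos.
rewrite cabsM [X in _ <= _ * X]cabsM cabs_nat.
by rewrite ler_wpM2l ?cabs_ge0// ler_wpM2l// cabs_add_nat_ge.
Qed.

Lemma hyp_coef_summable a b c : 0 < Re c -> gauss_cond a b (Re c) ->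
  asummable (hyp_coef a b c) /\
  n%:R * cabs (hyp_coef a b c n) @[n --> \oo] --> 0.
Proof.
move=> c0 cond; apply: (hypergeometric_test c0 cond).
- by move=> j; exact: cabs_ge0.
- by move=> j; exact: hyp_coef_ratio.
Qed.

Lemma hyp_coef_power_summable a b c y : 0 < Re c -> 0 <= y < 1 ->
  asummable (fun n => hyp_coef a b c n * (y ^+ n)%:C).
Proof.
move=> c0 /andP[y0 y1]; pose v n := cabs (hyp_coef a b c n) * y ^+ n.
suff [h _] : cvgn (series v) /\ j%:R * v j @[j --> \oo] --> 0.
  apply: asummable_le h => n; rewrite cabsM cabs_real ger0_norm//.
  by rewrite exprn_ge0.
have v0 j : 0 <= v j by rewrite mulr_ge0 ?cabs_ge0// exprn_ge0.
pose S := Re a + Re b; pose K := (cabs a ^+ 2 + cabs b ^+ 2) / 2.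
have K0 : 0 <= K by rewrite divr_ge0// addr_ge0// sqr_ge0.
pose M := `|Re c - 1 - S * y| + Re c + K * y.
have [J hJ] := nat_above (M / (1 - y)).
have y10 : 0 < 1 - y by rewrite subr_gt0.
apply: (@kummer_test v 1 J.+1 ltr01 v0) => j Jj.
have j1 : (1 : R) <= j%:R by rewrite ler1n (leq_trans _ Jj).
have jM : M <= j%:R * (1 - y).
  by have := hJ j (ltnW Jj); rewrite ler_pdivrMr.
have Cj : 0 < Re c + j%:R by rewrite (lt_le_trans c0)// lerDl.
have h1 : v j.+1 * (j.+1%:R * (Re c + j%:R)) <= (j%:R ^+ 2 + S * j%:R + K) * y * v j.
  have := le_trans (@hyp_coef_ratio a b c j c0)
    (ler_wpM2r (cabs_ge0 _) (cabs_mul_add_nat a b j)).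
  move=> /(ler_wpM2r (exprn_ge0 j.+1 y0)).
  rewrite -/K -/S /v exprS; congr (_ <= _); ring.
rewrite lerBrDr -lerBrDl -mulrBl -(ler_pM2r Cj).
have -> : j.+1%:R * v j.+1 * (Re c + j%:R) = v j.+1 * (j.+1%:R * (Re c + j%:R)) by ring.
apply: le_trans h1 _; rewrite [leRHS]mulrAC ler_wpM2r// -subr_ge0.
have -> : (j%:R - 1) * (Re c + j%:R) - (j%:R ^+ 2 + S * j%:R + K) * y =
  j%:R * (j%:R * (1 - y)) + j%:R * (Re c - 1 - S * y) - (Re c + K * y) by ring.
have n1 : - `|Re c - 1 - S * y| <= Re c - 1 - S * y by rewrite lerNl -normrN ler_norm.
have h2 : j%:R * - `|Re c - 1 - S * y| <= j%:R * (Re c - 1 - S * y) by rewrite ler_wpM2l.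
have h3 : j%:R * M <= j%:R * (j%:R * (1 - y)) by rewrite ler_wpM2l.
have h4 : 1 * (Re c + K * y) <= j%:R * (Re c + K * y).
  by rewrite ler_wpM2r// addr_ge0 ?(ltW c0)// mulr_ge0.
have h5 : j%:R * M = j%:R * `|Re c - 1 - S * y| + j%:R * (Re c + K * y).
  by rewrite /M; ring.
move: h2 h3 h4; rewrite h5 mulrN mul1r; lra.
Qed.

(** The value at 1 of Gauss's series. *)
Definition hyp1 a b c := csum (hyp_coef a b c).

(** The contiguity relation comes from a telescoping sum:
    [(c - a) (c - b) u'_n - c (c - a - b) u_n = c ((n + 1) u_{n+1} - n u_n)]
    for the terms [u_n], [u'_n] of the series at [c] and at [c + 1]. *)
Lemma hyp1_contiguous a b c : 0 < Re c -> gauss_cond a b (Re c) ->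
  (c - a) * (c - b) * hyp1 a b (c + 1) = c * (c - a - b) * hyp1 a b c.
Proof.
move=> c0 cond; have c10 : 0 < Re (c + 1) by rewrite Re_add addr_gt0.
have cond1 : gauss_cond a b (Re (c + 1)).
  by apply: gauss_cond_le cond; rewrite Re_add lerDl.
have [s0 t0] := hyp_coef_summable c0 cond; have [s1 _] := hyp_coef_summable c10 cond1.
have np := nonpole_pos c0.
have cn0 : c != 0 by have := nonpole_neq0 0 np; rewrite addr0.
have key (n S1 S0 u1 u0 u2 : R[i]) :
    (c - a) * (c - b) * S1 - c * (c - a - b) * S0 = c * (n * u0) ->
    (c + n) * u1 = c * u0 -> u2 * ((n + 1) * (c + n)) = (a + n) * (b + n) * u0 ->
    c + n != 0 ->
    (c - a) * (c - b) * (S1 + u1) - c * (c - a - b) * (S0 + u0) = c * ((n + 1) * u2).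
  move=> ih e1 e2 cn; apply: (mulfI cn).
  have -> : (c + n) * (c * ((n + 1) * u2)) = c * (u2 * ((n + 1) * (c + n))) by ring.
  rewrite e2.
  transitivity ((c + n) * ((c - a) * (c - b) * S1 - c * (c - a - b) * S0) +
    (c - a) * (c - b) * ((c + n) * u1) - (c + n) * (c * (c - a - b) * u0)); first by ring.
  by rewrite ih e1; ring.
have tel N : (c - a) * (c - b) * series (hyp_coef a b (c + 1)) N -
    c * (c - a - b) * series (hyp_coef a b c) N = c * (N%:R * hyp_coef a b c N).
  elim: N => [|N ih]; first by rewrite /series /= !big_geq// !mulr0 subr0 mul0r mulr0.
  rewrite !seriesSr.
  have e1 : (c + N%:R) * hyp_coef a b (c + 1) N = c * hyp_coef a b c N.
    have h1 := poch_neq0 N np; have h2 := poch_neq0 N (@nonpoleS _ _ 1 np).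
    have h4 : (N`!%:R : R[i]) != 0 by rewrite pnatr_eq0 -lt0n fact_gt0.
    have e : c * pochhammer (c + 1) N = pochhammer c N * (c + N%:R).
      by rewrite -pochSl pochS.
    apply: (mulfI (mulf_neq0 h1 h2)).
    rewrite /hyp_coef !invfM.
    transitivity (pochhammer a N * pochhammer b N / N`!%:R * (pochhammer c N * (c + N%:R))).
      by field; rewrite h2 h4.
    by rewrite -e; field; rewrite h1 h4.
  have e2 := hyp_coefS a b N np.
  rewrite -natr1 in e2 *.
  exact: key ih e1 e2 (nonpole_neq0 N np).
have l1 : (c - a) * (c - b) * series (hyp_coef a b (c + 1)) N -
    c * (c - a - b) * series (hyp_coef a b c) N @[N --> \oo] -->
    (c - a) * (c - b) * hyp1 a b (c + 1) - c * (c - a - b) * hyp1 a b c.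
  by apply: cvgB; apply: cvgM; [exact: cvg_cst|exact: asummable_cvg|
    exact: cvg_cst|exact: asummable_cvg].
have l2 : c * (N%:R * hyp_coef a b c N) @[N --> \oo] --> c * 0.
  apply: cvgM; first exact: cvg_cst.
  by apply: ccvg_norm0; under eq_fun do rewrite cabsM cabs_nat.
have telE : (fun N => (c - a) * (c - b) * series (hyp_coef a b (c + 1)) N -
    c * (c - a - b) * series (hyp_coef a b c) N) = (fun N => c * (N%:R * hyp_coef a b c N)).
  by apply/funext => N; exact: tel.
rewrite telE in l1.
apply/eqP; rewrite -subr_eq0 -(mulr0 c); apply/eqP.
exact: (ccvg_unique l1 l2).
Qed.

Lemma hyp1_iterate a b c n : 0 < Re c -> gauss_cond a b (Re c) ->
  pochhammer (c - a) n * pochhammer (c - b) n * hyp1 a b (c + n%:R) =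
  pochhammer c n * pochhammer (c - a - b) n * hyp1 a b c.
Proof.
move=> c0 cond; elim: n => [|n ih]; first by rewrite !poch0 addr0.
have cn0 : 0 < Re (c + n%:R) by rewrite Re_add Re_nat (lt_le_trans c0)// lerDl.
have condn : gauss_cond a b (Re (c + n%:R)).
  by apply: gauss_cond_le cond; rewrite Re_add Re_nat lerDl.
have := hyp1_contiguous cn0 condn; rewrite -[c + n%:R + 1]addrA natr1 => h.
rewrite !pochS.
transitivity (pochhammer (c - a) n * pochhammer (c - b) n *
  ((c + n%:R - a) * (c + n%:R - b) * hyp1 a b (c + n.+1%:R))); first by ring.
rewrite h.
transitivity ((c + n%:R) * (c - a - b + n%:R) *
  (pochhammer (c - a) n * pochhammer (c - b) n * hyp1 a b (c + n%:R))); first by ring.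
by rewrite ih; ring.
Qed.

Lemma poch_real_gt0 C n : 0 < C -> 0 < cabs (pochhammer C%:C n).
Proof. by move=> C0; rewrite cabs_gt0 poch_neq0//; exact: nonpole_pos. Qed.

Lemma cabs_real_nat C n : 0 < C -> cabs (C%:C + n%:R) = C + n%:R.
Proof.
move=> C0; rewrite -natC -rmorphD cabs_real ger0_norm//.
by rewrite addr_ge0// ltW.
Qed.

(** Already the first factor gains [(Re c + n) / Re c], and the other ones can
    only increase. *)
Lemma cabs_poch_shift c n j : 0 < Re c ->
  (Re c + n%:R) * cabs (pochhammer (Re c)%:C j.+1) <=
  Re c * cabs (pochhammer (c + n%:R) j.+1).
Proof.
move=> c0; elim: j => [|j ih].
  rewrite !pochS !poch0 !mul1r !addr0 cabs_real ger0_norm ?(ltW c0)//.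
  by rewrite mulrC ler_wpM2l ?(ltW c0)// cabs_add_nat_ge.
rewrite pochS [in leRHS]pochS !cabsM !mulrA.
apply: ler_pM => //.
- by rewrite mulr_ge0 ?cabs_ge0// addr_ge0 ?(ltW c0).
- exact: cabs_ge0.
- rewrite cabs_real_nat//.
  have cn0 : 0 < Re (c + n%:R) by rewrite Re_add Re_nat (lt_le_trans c0)// lerDl.
  apply: le_trans (cabs_add_nat_ge j.+1 cn0).
  by rewrite Re_add Re_nat lerD2r lerDl.
Qed.

(** By [cabs_poch_shift], all terms but the first are at most
    [Re c / (Re c + n)] times those of a fixed convergent series. *)
Lemma cvg_hyp1_shift a b c : 0 < Re c -> gauss_cond a b (Re c) ->
  hyp1 a b (c + n%:R) @[n --> \oo] --> (1 : R[i]).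
Proof.
move=> c0 cond; pose C := Re c.
pose w := fun n => cabs (hyp_coef a b C%:C n).
have C0 : 0 < Re C%:C by [].
have [sw _] := @hyp_coef_summable a b C%:C C0 cond.
pose e (j : nat) : R[i] := (j == 0%N)%:R.
have bnd n j : cabs (hyp_coef a b (c + n%:R) j - e j) <= C / (C + n%:R) * w j.
  have Cn : 0 < C + n%:R by rewrite (lt_le_trans c0)// lerDl.
  case: j => [|j].
    by rewrite hyp_coef0 /e subrr cabs0 mulr_ge0 ?cabs_ge0// divr_ge0 ?ltW.
  rewrite /e subr0 /w !cabs_hyp_coef.
  have h := @cabs_poch_shift c n j c0; rewrite -/C in h *.
  have p1 := poch_real_gt0 j.+1 c0.
  have p2 : 0 < cabs (pochhammer (c + n%:R) j.+1).
    by rewrite cabs_gt0 poch_neq0//; apply: nonpoleS; exact: nonpole_pos.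
  have f0 : (0 : R) < j.+1`!%:R by rewrite ltr0n fact_gt0.
  have A0 := mulr_ge0 (cabs_ge0 (pochhammer a j.+1)) (cabs_ge0 (pochhammer b j.+1)).
  move: h p1 p2 f0 A0 Cn; rewrite -/C.
  move: (cabs _ * cabs _) (cabs _) (cabs _) (_`!%:R : R) (C + n%:R) => A P' P f D h p1 p2 f0 A0 Cn.
  have -> : C / D * (A / (P * f)) = A / (P' * f) * ((C * P') / (D * P)).
    by field; rewrite !gt_eqF.
  rewrite ler_peMr//; first by rewrite divr_ge0// mulr_ge0// ltW.
  by rewrite ler_pdivlMr ?mulr_gt0// mul1r.
have es : asummable e.
  apply: (@asummable_le _ _ w) => // j; rewrite /e.
  have [->|_] := eqVneq j 0%N; first by rewrite /w hyp_coef0.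
  by rewrite cabs0; exact: cabs_ge0.
have e1 : csum e = 1.
  apply: csum_cvg; apply: cvg_near_cst; exists 1%N => // n /= n1.
  rewrite /series /= big_ltn//= big_nat_cond big1 ?addr0// => i /andP[/andP[i1 _] _].
  by rewrite /e gtn_eqF.
have ds n : asummable (fun j => hyp_coef a b (c + n%:R) j - e j).
  apply: (@asummable_le _ _ (fun j => C / (C + n%:R) * w j)) => //.
  exact: is_cvg_series_mull.
have hE n : hyp1 a b (c + n%:R) - 1 = csum (fun j => hyp_coef a b (c + n%:R) j - e j).
  have cn0 : 0 < Re (c + n%:R) by rewrite Re_add Re_nat (lt_le_trans c0)// lerDl.
  have condn : gauss_cond a b (Re (c + n%:R)).
    by apply: gauss_cond_le cond; rewrite Re_add Re_nat lerDl.
  have [sn _] := hyp_coef_summable cn0 condn.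
  have l : series (hyp_coef a b (c + n%:R)) N - series e N @[N --> \oo] -->
      csum (hyp_coef a b (c + n%:R)) - csum e.
    by apply: cvgB; exact: asummable_cvg.
  rewrite e1 in l; apply/esym/csum_cvg.
  have sE : series (fun j => hyp_coef a b (c + n%:R) j - e j) =
      (fun N => series (hyp_coef a b (c + n%:R)) N - series e N).
    by apply/funext => N; rewrite /series /= sumrB.
  by rewrite sE; exact: l.
pose W := limn (series w).
apply/ccvg_cabsP.
apply: (@squeeze_cvgr _ _ _ _ (fun=> 0) (fun n => C * W * (C + n%:R)^-1)).
- apply: nearW => n; rewrite cabs_ge0 andTb hE.
  apply: le_trans (cabs_csum (ds n)) _.
  have -> : C * W * (C + n%:R)^-1 = C / (C + n%:R) * W by ring.
  rewrite -(cvg_lim _ (@cvg_series_mull (C / (C + n%:R)) w sw))//.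
  apply: lim_series_le; [exact: (ds n)|exact: is_cvg_series_mull|exact: (bnd n)].
- exact: cvg_cst.
- rewrite -(mulr0 (C * W)); apply: cvgM; first exact: cvg_cst.
  apply/cvgrPdist_lt => d d0.
  have [J hJ] := nat_above (d^-1 + 1); exists J => // n /= /hJ hn.
  have Cn : 0 < C + n%:R by rewrite (lt_le_trans c0)// lerDl.
  rewrite sub0r normrN gtr0_norm ?invr_gt0// -[ltRHS]invrK ltf_pV2 ?posrE ?invr_gt0//.
  by rewrite (@lt_le_trans _ _ (d^-1 + 1)) ?ltrDl// (le_trans hn)// lerDr ltW.
Qed.

(** Gauss's theorem: iterating the contiguity relation expresses the sum at [c] by
    the sum at [c + n], which tends to 1, and Pochhammer symbols, whose quotient is
    one of Gauss's products: the powers of [n] cancel. *)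
Lemma hyp1E a b c : 0 < Re c -> gauss_cond a b (Re c) ->
  ~ nonpos_integer (c - a) -> ~ nonpos_integer (c - b) ->
  ~ nonpos_integer (c - a - b) ->
  hyp1 a b c = Gamma c * Gamma (c - a - b) / (Gamma (c - a) * Gamma (c - b)).
Proof.
move=> c0 cond na nb nab; have nc := nonpole_pos c0.
pose u n := gprod c n * gprod (c - a - b) n / (gprod (c - a) n * gprod (c - b) n).
have lu : u n @[n --> \oo] --> Gamma c * Gamma (c - a - b) / (Gamma (c - a) * Gamma (c - b)).
  apply: cvgM; first by apply: cvgM; exact: cvg_gprod.
  apply: cvgV; first by rewrite mulf_neq0 ?Gamma_neq0.
  by apply: cvgM; exact: cvg_gprod.
have l2 : hyp1 a b (c + n.+2%:R) @[n --> \oo] --> (1 : R[i]).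
  pose g (n : nat) := hyp1 a b (c + n%:R).
  have gl : g n @[n --> \oo] --> (1 : R[i]) by exact: cvg_hyp1_shift.
  have <- : (fun n => g (n + 2)%N) = (fun n => hyp1 a b (c + n.+2%:R)).
    by apply/funext => n; rewrite /g addn2.
  by rewrite (cvg_shiftn 2 g).
have lv : u n * hyp1 a b (c + n.+2%:R) @[n --> \oo] -->
    Gamma c * Gamma (c - a - b) / (Gamma (c - a) * Gamma (c - b)) * 1.
  exact: (cvgM lu l2).
have uE n : u n * hyp1 a b (c + n.+2%:R) = hyp1 a b c.
  have h := hyp1_iterate n.+2 c0 cond.
  have p1 := poch_neq0 n.+2 nc; have p2 := poch_neq0 n.+2 nab.
  have p3 := poch_neq0 n.+2 na; have p4 := poch_neq0 n.+2 nb.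
  have f0 : (n.+1`!%:R : R[i]) != 0 by rewrite pnatr_eq0 -lt0n fact_gt0.
  have -> : u n = pochhammer (c - a) n.+2 * pochhammer (c - b) n.+2 /
      (pochhammer c n.+2 * pochhammer (c - a - b) n.+2).
    rewrite /u /gprod !cpowB.
    have q := cpow_neq0 (n.+1%:R : R).
    move: f0 (q c) (q a) (q b); move: (_`!%:R : R[i]) (cpow _ c) (cpow _ a) (cpow _ b).
    move=> f A B D f0 A0 B0 D0.
    by field; rewrite p1 p2 p3 p4 f0 A0 B0 D0.
  rewrite mulrAC h; move: p1 p2.
  by move: (pochhammer _ _) (pochhammer _ _) => x y x0 y0; field; rewrite x0 y0.
rewrite -[RHS]mulr1; apply/esym/(ccvg_unique lv).
rewrite (_ : (fun n => _) = (fun=> hyp1 a b c)); first exact: cvg_cst.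
by apply/funext => n; exact: uE.
Qed.

End gauss_summation.

(** * Saigo's integral of a power *)

Section saigo_kernel.
Variable R : realType.
Local Notation mu := (@lebesgue_measure R).
Implicit Types (a b alpha s z : R[i]) (x y t : R).

Lemma hypergeometric21E a b c y :
  hypergeometric [:: a; b] [:: c] y%:C = csum (fun n => hyp_coef a b c n * (y ^+ n)%:C).
Proof.
rewrite /hypergeometric; congr csum; apply/funext => n.
rewrite !big_cons !big_nil !mulr1 /hyp_coef rmorphXn invfM /=.
ring.
Qed.

Lemma measurable_oo x y : measurable (`]x, y[%classic : set R).
Proof. exact: measurable_itv. Qed.

Lemma cpow_real t y : cpow t y%:C = (expR (y * ln t))%:C.
Proof. by rewrite cpowE /= mul0r cos0 sin0 mulr1 mulr0. Qed.

Lemma Re_realM y z : Re (y%:C * z) = y * Re z.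
Proof. by rewrite Re_mul /= mul0r subr0. Qed.

(** The integrand of Saigo's operator applied to [t ^ (s - 1)]. *)
Definition kernel a b alpha x s t : R[i] :=
  cpow t (s - 1) * (cpow (x - t) (alpha - 1) *
    hypergeometric [:: a; b] [:: alpha] (1 - t / x)%:C).

Lemma kernelD a b alpha x s z t :
  kernel a b alpha x (s + z) t = cpow t z * kernel a b alpha x s t.
Proof.
have e : s + z - 1 = z + (s - 1) by ring.
by rewrite /kernel e cpowD -[LHS]mulrA.
Qed.

Lemma kernel_series a b alpha x s t : 0 < t < x -> 0 < Re alpha ->
  let u n := hyp_coef a b alpha n * cpow x (- n%:R) *
     (cpow t (s - 1) * cpow (x - t) (alpha + n%:R - 1)) in
  asummable u /\ kernel a b alpha x s t = csum u.
Proof.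
move=> /andP[t0 tx] al0 u.
have x0 := lt_trans t0 tx; have xt : 0 < x - t by rewrite subr_gt0.
pose y := 1 - t / x.
have y01 : 0 <= y < 1.
  rewrite subr_ge0 ler_pdivrMr// mul1r (ltW tx) /=.
  by rewrite ltrBlDr ltrDl divr_gt0.
have y0 : 0 < y by rewrite subr_gt0 ltr_pdivrMr// mul1r.
have su := @hyp_coef_power_summable R a b alpha y al0 y01.
have uE : u = (fun n => cpow t (s - 1) * cpow (x - t) (alpha - 1) *
    (hyp_coef a b alpha n * (y ^+ n)%:C)).
  apply/funext => n; rewrite /u.
  have -> : (y ^+ n)%:C = cpow x (- n%:R) * cpow (x - t) n%:R.
    have -> : x - t = y * x by rewrite /y; field; rewrite gt_eqF.
    by rewrite cpowMl// cpowN -cpow_nat// mulrC mulfK// cpow_neq0.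
  have -> : alpha + n%:R - 1 = (alpha - 1) + n%:R by ring.
  by rewrite (cpowD (x - t) (alpha - 1)); ring.
split.
- rewrite uE; apply: (@asummable_le _ _ (fun n => cabs (cpow t (s - 1) * cpow (x - t) (alpha - 1)) *
    cabs (hyp_coef a b alpha n * (y ^+ n)%:C))).
    by move=> n; rewrite cabsM.
  exact: is_cvg_series_mull.
- by rewrite uE csumZ// /kernel mulrA hypergeometric21E.
Qed.

(** Termwise integration of the hypergeometric series against the beta
    integrand; the integrals of the norms are summable by Kummer's test. *)
Lemma kernel_integral a b alpha x s : 0 < x -> 0 < Re alpha -> 0 < Re s ->
  gauss_cond a b (Re (s + alpha)) ->
  cintegrable `]0, x[ (kernel a b alpha x s) /\
  cint `]0, x[ (kernel a b alpha x s) =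
    cpow x (s + alpha - 1) * beta 1 s alpha * hyp1 a b (s + alpha).
Proof.
move=> x0 al0 s0 cond.
have mD := measurable_oo 0 x.
have sa0 : 0 < Re (s + alpha) by rewrite Re_add addr_gt0.
pose f n t : R[i] := cpow t (s - 1) * cpow (x - t) (alpha + n%:R - 1).
pose h n := hyp_coef a b alpha n * cpow x (- n%:R).
pose S := (Re s)%:C : R[i]; pose A := (Re alpha)%:C : R[i].
have aln n : 0 < Re (alpha + n%:R) by rewrite Re_add Re_nat (lt_le_trans al0)// lerDl.
have An n : 0 < Re (A + n%:R) by rewrite Re_add Re_nat (lt_le_trans al0)// lerDl.
have fi n : cintegrable `]0, x[ (f n) by exact: cintegrable_beta.
have hfi n : cintegrable `]0, x[ (fun t => h n * f n t) by exact: cintegrableZ.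
pose B n := Re (beta x S (A + n%:R)).
have BE n : B n = \int[mu]_(t in `]0, x[) cabs (f n t).
  rewrite /B /beta.
  transitivity (\int[mu]_(t in `]0, x[) Re (cpow t (S - 1) * cpow (x - t) (A + n%:R - 1))).
    by [].
  apply: eq_Rintegral => t _; rewrite /f cabsM 2!cabs_cpow.
  have -> : S - 1 = (Re s - 1)%:C by rewrite /S rmorphB.
  have -> : A + n%:R - 1 = (Re alpha + n%:R - 1)%:C by rewrite /A -natC rmorphB rmorphD.
  rewrite (cpow_real t (Re s - 1)) (cpow_real (x - t) (Re alpha + n%:R - 1)) Re_realM.
  by rewrite Re_add Re_opp 2!Re_add Re_nat Re_opp.
have B0 n : 0 <= B n.
  by rewrite BE; apply: Rintegral_ge0 => t _; exact: cabs_ge0.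
have Bs n : (Re (s + alpha) + n%:R) * B n.+1 = x * (Re alpha + n%:R) * B n.
  have := betaS x0 (s0 : 0 < Re S) (An n).
  have -> : S + (A + n%:R) = (Re (s + alpha) + n%:R)%:C.
    by rewrite Re_add /S /A -natC !rmorphD addrA.
  have -> : x%:C * (A + n%:R) = (x * (Re alpha + n%:R))%:C.
    by rewrite /A -natC realCM rmorphD.
  rewrite -addrA natr1 => /(congr1 (@complex.Re R)).
  by rewrite !Re_realM.
pose v n := cabs (h n) * B n.
have vE n : \int[mu]_(t in `]0, x[) cabs (h n * f n t) = v n.
  rewrite /v BE -RintegralZl//; first by apply: eq_Rintegral => t _; rewrite cabsM.
  exact: integrable_cabs.
have v0 n : 0 <= v n by rewrite mulr_ge0 ?cabs_ge0.
have [cv _] : cvgn (series v) /\ j%:R * v j @[j --> \oo] --> 0.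
  apply: (hypergeometric_test sa0 cond v0) => n.
  have e1 := Bs n; have e2 := @hyp_coef_ratio R a b alpha n al0.
  have hE m : cabs (h m) = cabs (hyp_coef a b alpha m) * x ^- m.
    by rewrite /h cabsM cpowN cabsV cpow_nat// cabs_real ger0_norm// exprn_ge0 ?ltW.
  have xn : 0 < x ^- n by rewrite invr_gt0 exprn_gt0.
  rewrite /v !hE exprS invfM.
  have -> : cabs (hyp_coef a b alpha n.+1) * (x^-1 * x ^- n) * B n.+1 *
      (n.+1%:R * (Re (s + alpha) + n%:R)) =
     cabs (hyp_coef a b alpha n.+1) * n.+1%:R * x^-1 * x ^- n *
      ((Re (s + alpha) + n%:R) * B n.+1) by ring.
  rewrite e1.
  have -> : cabs (hyp_coef a b alpha n.+1) * n.+1%:R * x^-1 * x ^- n *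
      (x * (Re alpha + n%:R) * B n) = (x^-1 * x) *
      (cabs (hyp_coef a b alpha n.+1) * (n.+1%:R * (Re alpha + n%:R))) * (x ^- n * B n) by ring.
  rewrite mulVf ?gt_eqF// mul1r.
  have := ler_wpM2r (mulr_ge0 (ltW xn) (B0 n)) e2.
  by congr (_ <= _); ring.
have ks t : `]0, x[%classic t -> asummable (fun n => h n * f n t) /\
    kernel a b alpha x s t = csum (fun n => h n * f n t).
  by rewrite /= in_itv /= => tx; exact: kernel_series.
have cI : cvgn (series (fun n => \int[mu]_(t in `]0, x[) cabs (h n * f n t))).
  by under eq_fun do rewrite vE.
have [ig cs] := cint_series mD hfi (fun t Dt => (ks t Dt).1) cI.
have ke t : `]0, x[%classic t -> csum (fun n => h n * f n t) = kernel a b alpha x s t.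
  by move=> Dt; rewrite (ks t Dt).2.
split; first exact: (eq_cintegrable mD ke ig).
rewrite -(eq_cint ke).
have [sH _] := hyp_coef_summable sa0 cond.
have npa := nonpole_pos al0; have npsa := nonpole_pos sa0.
have term n : cint `]0, x[ (fun t => h n * f n t) =
    cpow x (s + alpha - 1) * beta 1 s alpha * hyp_coef a b (s + alpha) n.
  rewrite cintZ// -/(beta x s (alpha + n%:R)) beta_scale// beta_poch//.
  have -> : s + (alpha + n%:R) - 1 = (s + alpha - 1) + n%:R by ring.
  rewrite /h cpowN cpowD /hyp_coef.
  have h1 := poch_neq0 n npa; have h2 := poch_neq0 n npsa.
  have h3 : (n`!%:R : R[i]) != 0 by rewrite pnatr_eq0 -lt0n fact_gt0.
  have h4 := cpow_neq0 x (n%:R : R[i]).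
  move: h1 h2 h3 h4.
  move: (pochhammer alpha n) (pochhammer (s + alpha) n) (n`!%:R : R[i]) (cpow x n%:R).
  by move=> P P' F' X h1 h2 h3 h4; field; rewrite h1 h2 h3 h4.
have sE : (fun n => cint `]0, x[ (fun t => h n * f n t)) =
    (fun n => cpow x (s + alpha - 1) * beta 1 s alpha * hyp_coef a b (s + alpha) n).
  by apply/funext => n; exact: term.
rewrite sE in cs; rewrite -(csum_cvg cs) csumZ//.
Qed.

End saigo_kernel.

Section saigo_power.
Variable R : realType.
Local Notation mu := (@lebesgue_measure R).
Implicit Types (a b alpha s z : R[i]) (x t e : R).

Lemma beta_Sl s a : 0 < Re s -> 0 < Re a ->
  (s + a) * beta 1 (s + 1) a = s * beta 1 s a.
Proof.
move=> s0 a0; have sa0 : 0 < Re (s + a) by rewrite Re_add addr_gt0.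
have s10 : 0 < Re (s + 1) by rewrite Re_add addr_gt0.
rewrite (betaE s0 a0) (betaE s10 a0).
have -> : s + 1 + a = s + a + 1 by ring.
have nps := nonpole_pos s0; have npsa := nonpole_pos sa0.
rewrite (@Gamma_poch _ s 1 nps) (@Gamma_poch _ (s + a) 1 npsa) !pochS !poch0 !mul1r !addr0.
have g1 := Gamma_neq0 npsa; have g2 : s + a != 0 by have := nonpole_neq0 0 npsa; rewrite addr0.
move: g1 g2; move: (Gamma (s + a)) (s + a) => G w g1 g2.
by field; rewrite g1 g2.
Qed.

(** The contiguity relation of Gauss's series, read on the integrals. *)
Lemma kernel_integral_contiguous a b alpha x s : 0 < x -> 0 < Re alpha -> 0 < Re s ->
  gauss_cond a b (Re (s + alpha)) ->
  (s + alpha - a) * (s + alpha - b) * cint `]0, x[ (kernel a b alpha x (s + 1)) =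
  x%:C * s * (s + alpha - a - b) * cint `]0, x[ (kernel a b alpha x s).
Proof.
move=> x0 al0 s0 cond.
have s10 : 0 < Re (s + 1) by rewrite Re_add addr_gt0.
have sa0 : 0 < Re (s + alpha) by rewrite Re_add addr_gt0.
have cond1 : gauss_cond a b (Re (s + 1 + alpha)).
  by apply: gauss_cond_le cond; rewrite !Re_add addrAC lerDl.
rewrite (kernel_integral x0 al0 s0 cond).2 (kernel_integral x0 al0 s10 cond1).2.
have -> : s + 1 + alpha - 1 = s + alpha - 1 + 1 by ring.
have -> : s + 1 + alpha = s + alpha + 1 by ring.
rewrite cpowS//.
have h1 := hyp1_contiguous sa0 cond; have h2 := beta_Sl s0 al0.
have c0 : s + alpha != 0 by have := nonpole_neq0 0 (nonpole_pos sa0); rewrite addr0.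
apply: (mulfI c0); move: h1 h2.
move: (hyp1 a b (s + alpha + 1)) (hyp1 a b (s + alpha)) (beta 1 (s + 1) alpha)
  (beta 1 s alpha) (cpow x (s + alpha - 1)) => H1 H0 B1 B0 X h1 h2.
transitivity (x%:C * X * ((s + alpha) * B1) *
  ((s + alpha - a) * (s + alpha - b) * H1)); first by ring.
by rewrite h1 h2; ring.
Qed.

Lemma expR_ln_le_bound e (E x t : R) : 0 < t < x -> 0 <= e <= E ->
  expR (e * ln t) <= 1 + expR (E * ln x).
Proof.
move=> /andP[t0 tx] /andP[e0 eE]; have x0 := lt_trans t0 tx.
have [l0|l0] := leP (ln t) 0.
  apply: (@le_trans _ _ 1); last by rewrite lerDl expR_ge0.
  by rewrite -expR0 ler_expR mulr_ge0_le0.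
apply: (@le_trans _ _ (expR (E * ln x))); last by rewrite lerDr.
rewrite ler_expR ler_pM//; first exact: ltW.
by rewrite ler_ln// ltW.
Qed.

Lemma cpow_oo_meas s x : cmeas `]0, x[ (fun t => cpow t s).
Proof.
apply: open_continuous_cmeas; first exact: interval_open.
by move=> t; rewrite /= in_itv /= => /andP[t0 _]; exact: continuous_cpow.
Qed.

(** If the integral converges at [s0] then it is bounded for [s = theta + e],
    [e -> 0], where [theta = a + b - alpha]. When Gauss's series does not
    converge at [s0 + alpha], the contiguity relation
    [(s + alpha - a) (s + alpha - b) M (s + 1) = x s e M (s)]
    forces [M (theta + 1) = 0], against Gauss's evaluation. *)
Lemma kernel_integrable_cond a b alpha x s0 : 0 < x -> 0 < Re alpha -> 0 < Re s0 ->
  cintegrable `]0, x[ (kernel a b alpha x s0) ->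
  gauss_cond a b (Re (s0 + alpha)).
Proof.
move=> x0 al0 s00 i0.
have mD := measurable_oo 0 x.
have [lt|le] := ltP (Re a + Re b) (Re (s0 + alpha)); first by left.
right; apply: contrapT => /not_orP[npa npb].
pose th := a + b - alpha.
have Reth : Re th = Re a + Re b - Re alpha by rewrite /th !Re_add Re_opp.
have th0 : Re s0 <= Re th by move: le; rewrite Reth Re_add lerBrDr.
have thp : 0 < Re th := lt_le_trans s00 th0.
have [e eE] : exists e : nat -> R, e = (fun n => n.+1%:R^-1) by eexists.
have e0 n : 0 < e n by rewrite eE invr_gt0.
have e1 n : e n <= 1 by rewrite eE invf_le1// ler1n.
have ec : e n @[n --> \oo] --> 0 by rewrite eE; exact: cvg_invS.
pose M s := cint `]0, x[ (kernel a b alpha x s).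
have ab0 : a * b != 0.
  apply: mulf_neq0.
  - by have := nonpole_neq0 0 npa; rewrite addr0.
  - by have := nonpole_neq0 0 npb; rewrite addr0.
have ReS n : Re (th + (e n)%:C) = Re th + e n by rewrite Re_add.
have sp n : 0 < Re (th + (e n)%:C) by rewrite ReS addr_gt0.
have sc n : gauss_cond a b (Re (th + (e n)%:C + alpha)).
  left; rewrite !Re_add /= Re_opp.
  have -> : Re a + Re b - Re alpha + e n + Re alpha = Re a + Re b + e n by ring.
  by rewrite ltrDl.
have th1p : 0 < Re (th + 1) by rewrite Re_add addr_gt0.
have cond1 : gauss_cond a b (Re (th + 1 + alpha)).
  left; rewrite !Re_add /= Re_opp.
  have -> : Re a + Re b - Re alpha + 1 + Re alpha = Re a + Re b + 1 by ring.
  by rewrite ltrDl.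
have [i1 M1] := kernel_integral x0 al0 th1p cond1.
have cont n : (b + (e n)%:C) * (a + (e n)%:C) * M (th + (e n)%:C + 1) =
    x%:C * (th + (e n)%:C) * (e n)%:C * M (th + (e n)%:C).
  have := kernel_integral_contiguous x0 al0 (sp n) (sc n).
  have -> : th + (e n)%:C + alpha - a = b + (e n)%:C by rewrite /th; ring.
  have -> : th + (e n)%:C + alpha - b = a + (e n)%:C by rewrite /th; ring.
  have -> : b + (e n)%:C - b = (e n)%:C by ring.
  exact.
(* The kernels at theta + e n are dominated by a multiple of the kernel at s0. *)
pose E := Re th - Re s0 + 1; pose K := 1 + expR (E * ln x).
pose B := 2 * \int[mu]_(t in `]0, x[) (K * cabs (kernel a b alpha x s0 t)).
have ica := integrable_cabs mD i0.
have iK : mu.-integrable `]0, x[ (EFin \o (fun t => K * cabs (kernel a b alpha x s0 t))).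
  exact: (@integrableZl _ _ _ mu _ mD K _ ica).
have MB n : cabs (M (th + (e n)%:C)) <= B.
  have [ii _] := kernel_integral x0 al0 (sp n) (sc n).
  apply: le_trans (cabs_cint mD ii) _; rewrite ler_wpM2l//.
  apply: le_Rintegral => //; first exact: integrable_cabs.
  move=> t Dt; have tx : 0 < t < x by move: Dt; rewrite /= in_itv.
  have -> : th + (e n)%:C = s0 + (th + (e n)%:C - s0) by ring.
  rewrite kernelD cabsM ler_wpM2r ?cabs_ge0// cabs_cpow.
  apply: expR_ln_le_bound => //; rewrite Re_add ReS Re_opp /E.
  by have := e0 n; have := e1 n => h1 h2; apply/andP; split; lra.
(* The kernel at theta + 1 is integrable, so M is continuous from the right there. *)
have Mc : M (th + (e n)%:C + 1) @[n --> \oo] --> M (th + 1).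
  have ica1 := integrable_cabs mD i1.
  have iK1 := @integrableZl _ _ _ mu _ mD (1 + expR (1 * ln x)) _ ica1.
  pose f n t := cpow t (e n)%:C * kernel a b alpha x (th + 1) t.
  have [] := @dominated_cint R _ f (kernel a b alpha x (th + 1))
    (fun t => (1 + expR (1 * ln x)) * cabs (kernel a b alpha x (th + 1) t)) mD.
  - move=> n; apply: cmeasM; first exact: cpow_oo_meas.
    exact: cintegrable_cmeas.
  - move=> t; rewrite /= in_itv /= => /andP[t0 tx].
    have l : cpow t (e n)%:C * kernel a b alpha x (th + 1) t @[n --> \oo] -->
        cpow t 0 * kernel a b alpha x (th + 1) t.
      apply: cvgM; last exact: cvg_cst.
      rewrite /cpow; apply: cvg_cexp; apply: cvgM; last exact: cvg_cst.
      by apply/ccvgP; split; [exact: ec|exact: cvg_cst].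
    by rewrite cpow0 mul1r in l; exact: l.
  - exact: iK1.
  - move=> n t Dt; have tx : 0 < t < x by move: Dt; rewrite /= in_itv.
    rewrite /f cabsM ler_wpM2r ?cabs_ge0// cabs_cpow.
    by apply: expR_ln_le_bound => //; rewrite /= (ltW (e0 n)) e1.
  move=> _ l; have fE : (fun n => M (th + (e n)%:C + 1)) = (fun n => cint `]0, x[ (f n)).
    apply/funext => n; rewrite /M; apply: eq_cint => t _.
    by rewrite /f -kernelD addrAC.
  by rewrite fE; exact: l.
have ecC : (e n)%:C @[n --> \oo] --> (0 : R[i]).
  by apply/ccvgP; split; [exact: ec|exact: cvg_cst].
have Ladd z : z + (e n)%:C @[n --> \oo] --> z + 0.
  by apply: cvgD; [exact: cvg_cst|exact: ecC].
have L1 : (b + (e n)%:C) * (a + (e n)%:C) * M (th + (e n)%:C + 1) @[n --> \oo] -->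
    (b + 0) * (a + 0) * M (th + 1).
  apply: cvgM; last exact: Mc.
  by apply: cvgM; exact: Ladd.
have L2 : x%:C * (th + (e n)%:C) * (e n)%:C * M (th + (e n)%:C) @[n --> \oo] --> (0 : R[i]).
  apply: ccvg_norm0.
  pose u n := cabs (x%:C * (th + (e n)%:C) * (e n)%:C) * B.
  apply: (@squeeze_cvgr _ _ _ _ (fun=> 0) u).
  - apply: nearW => n; rewrite cabs_ge0 andTb cabsM /u.
    by rewrite ler_wpM2l ?cabs_ge0.
  - exact: cvg_cst.
  - have l3 : x%:C * (th + (e n)%:C) * (e n)%:C @[n --> \oo] --> x%:C * (th + 0) * 0.
      by apply: cvgM; [apply: cvgM; [exact: cvg_cst|exact: Ladd]|exact: ecC].
    rewrite mulr0 in l3.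
    have l4 := cvg_cabs l3; rewrite cabs0 in l4.
    have l5 : u n @[n --> \oo] --> 0 * B by apply: cvgM; [exact: l4|exact: cvg_cst].
    by rewrite mul0r in l5.
have eqL : (fun n => (b + (e n)%:C) * (a + (e n)%:C) * M (th + (e n)%:C + 1)) =
    (fun n => x%:C * (th + (e n)%:C) * (e n)%:C * M (th + (e n)%:C)).
  by apply/funext => n; exact: cont.
rewrite eqL in L1.
have M0 : M (th + 1) = 0.
  apply/eqP; apply: contraTT isT => Mn0.
  have : b * a * M (th + 1) != 0 by rewrite mulf_neq0// mulrC.
  rewrite -[b]addr0 -[X in _ * X * _]addr0.
  by rewrite (ccvg_unique L1 L2) eqxx.
(* At c = a + b + 1 Gauss's evaluation has only values of Gamma at regular points. *)
have cE : th + 1 + alpha = a + b + 1 by rewrite /th; ring.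
have c0 : 0 < Re (th + 1 + alpha) by rewrite Re_add addr_gt0.
have g1 : hyp1 a b (th + 1 + alpha) != 0.
  have n1 := @nonpoleS _ b 1 npb; have n2 := @nonpoleS _ a 1 npa.
  have n3 : ~ nonpos_integer (1 : R[i]) by exact: nonpole_pos.
  have ea : th + 1 + alpha - a = b + 1 by rewrite /th; ring.
  have eb : th + 1 + alpha - b = a + 1 by rewrite /th; ring.
  have ec1 : th + 1 + alpha - a - b = 1 by rewrite /th; ring.
  have h := hyp1E c0 cond1; rewrite ec1 ea eb in h; rewrite (h n1 n2 n3).
  apply: mulf_neq0.
    by apply: mulf_neq0; apply: Gamma_neq0; [exact: nonpole_pos|exact: n3].
  by rewrite invr_eq0; apply: mulf_neq0; exact: Gamma_neq0.
have b1 : beta 1 (th + 1) alpha != 0.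
  rewrite betaE//; apply: mulf_neq0.
    by apply: mulf_neq0; apply: Gamma_neq0; exact: nonpole_pos.
  by rewrite invr_eq0; apply: Gamma_neq0; exact: nonpole_pos.
move: M0; rewrite /M M1; apply/eqP; apply: mulf_neq0; last exact: g1.
by apply: mulf_neq0; [exact: cpow_neq0|exact: b1].
Qed.

Lemma kernel_integralE (alpha beta eta s : R[i]) x :
  0 < x -> 0 < Re alpha -> 0 < Re s ->
  gauss_cond (alpha + beta) (- eta) (Re (s + alpha)) ->
  ~ nonpos_integer (s - beta) -> ~ nonpos_integer (s + alpha + eta) ->
  ~ nonpos_integer (s + eta - beta) ->
  cint `]0, x[ (kernel (alpha + beta) (- eta) alpha x s) =
  cpow x (s + alpha - 1) * (Gamma alpha * Gamma s * Gamma (s + eta - beta) /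
    (Gamma (s - beta) * Gamma (s + alpha + eta))).
Proof.
move=> x0 al0 s0 cond n1 n2 n3.
have sa0 : 0 < Re (s + alpha) by rewrite Re_add addr_gt0.
rewrite (kernel_integral x0 al0 s0 cond).2 (betaE s0 al0).
have e1 : s + alpha - (alpha + beta) = s - beta by ring.
have e2 : s + alpha - - eta = s + alpha + eta by ring.
have e3 : s + alpha - (alpha + beta) - - eta = s + eta - beta by ring.
have h := hyp1E sa0 cond; rewrite e3 e1 e2 in h; rewrite (h n1 n2 n3).
have g0 := Gamma_neq0 (nonpole_pos sa0); have g1 := Gamma_neq0 n1; have g2 := Gamma_neq0 n2.
move: g0 g1 g2; move: (Gamma (s + alpha)) (Gamma (s - beta)) (Gamma (s + alpha + eta)).
by move=> A B D g0 g1 g2; field; rewrite g0 g1 g2.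
Qed.

End saigo_power.

(** * The k-Gamma and k-Bessel functions *)

Section bessel.
Variable R : realType.
Local Notation mu := (@lebesgue_measure R).
Implicit Types (a b alpha s z v : R[i]) (x t k c : R).

Lemma cpow_expR t k s : cpow (expR (k * ln t)) s = cpow t (k%:C * s).
Proof. by rewrite /cpow expRK realCM; congr cexp; ring. Qed.

Lemma exhausts_pos_pow k : 0 < k ->
  exhausts `]0, +oo[ ((fun t => expR (k * ln t) / k) \o (fun n => n.+2%:R^-1))
    ((fun t => expR (k * ln t) / k) \o (fun n => n.+2%:R)).
Proof.
move=> k0; have := exhausts_pos R => -[oD ab sub h].
have l : expR (k * ln (n.+2%:R^-1)) @[n --> \oo] --> (0 : R).
  by apply: expR_ln_cvg0 => //; exact: cvg_invS2.
have near_le (y : R) : 0 < y -> \forall n \near \oo, expR (k * ln (n.+2%:R^-1)) <= y.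
  move=> y0; move/cvgrPdist_lt : l => /(_ _ y0); apply: filterS => n.
  by rewrite sub0r normrN gtr0_norm ?expR_gt0// => /ltW.
split => //.
- move=> n /=; rewrite ltr_pM2r ?invr_gt0// ltr_expR ltr_pM2l// ltr_ln ?posrE//.
- move=> n t /= /andP[t1 _]; rewrite in_itv /= andbT (lt_le_trans _ t1)//.
  by rewrite divr_gt0// expR_gt0.
- move=> t; rewrite /= in_itv /= andbT => t0.
  have kt0 : 0 < k * t by rewrite mulr_gt0.
  have kti : 0 < (k * t)^-1 by rewrite invr_gt0.
  apply: filterS2 (near_le _ kt0) (near_le _ kti) => n h1 h2.
  apply/andP; split; first by rewrite ler_pdivrMr// [t * k]mulrC.
  rewrite ler_pdivlMr// [t * k]mulrC; move: h2; rewrite lnV ?posrE// mulrN expRN.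
  by rewrite lef_pV2 ?posrE ?expR_gt0.
Qed.

(** Substitution of [u = t ^ k / k] in Euler's integral. *)
Lemma GammakE k z : 0 < k ->
  Gammak k z = cpow k (z / k%:C - 1) * Gamma (z / k%:C).
Proof.
move=> k0; rewrite /Gammak; case: ifP => // z0.
have kC : (k%:C : R[i]) != 0 by rewrite -cabs_eq0 cabs_real normr_eq0 gt_eqF.
pose w := z / k%:C.
have w0 : 0 < Re w by rewrite /w -realCV mulrC Re_realM mulr_gt0// invr_gt0.
have zE : z = k%:C * w by rewrite /w mulrC divfK.
pose phi t := expR (k * ln t) / k.
pose phi' t := k / t * expR (k * ln t) / k.
pose g t := cpow t (w - 1) * (expR (- t))%:C : R[i].
have mD : measurable (`]0, +oo[%classic : set R) by exact: measurable_itv.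
have e t : `]0, +oo[%classic t -> (phi' t)%:C * g (phi t) =
    cpow k (1 - w) * (cpow t (z - 1) * (expR (- (t `^ k / k)))%:C).
  rewrite /= in_itv /= andbT => t0.
  have kn : k != 0 by rewrite gt_eqF.
  have tn : t != 0 by rewrite gt_eqF.
  have ep : phi' t = expR (k * ln t) / t by rewrite /phi'; field; rewrite kn tn.
  rewrite /g ep powR_expR// -/(phi t) mulrA [RHS]mulrA; congr (_ * _).
  rewrite /phi cpowMl ?expR_gt0 ?invr_gt0// cpow_expR cpowVl//.
  have -> : (expR (k * ln t) / t)%:C = cpow t (k%:C - 1).
    by rewrite cpowB cpow1// realCM realCV cpow_real.
  have -> : 1 - w = - (w - 1) by ring.
  rewrite cpowN mulrA -cpowD mulrC; congr (_ * cpow _ _).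
  by rewrite zE; ring.
have ik := cintegrable_gammak k0 z0.
have subst : cint `]0, +oo[ g = cint `]0, +oo[ (fun t => (phi' t)%:C * g (phi t)).
  apply: (@cint_substitution R `]0, +oo[ `]0, +oo[ _ _ phi phi' g (exhausts_pos R)
    (exhausts_pos_pow k0)).
  - by move=> t _; rewrite /= in_itv /= andbT divr_gt0// expR_gt0.
  - move=> u t; rewrite /= !in_itv /= !andbT => u0 t0 ut.
    by rewrite ltr_pM2r ?invr_gt0// ltr_expR ltr_pM2l// ltr_ln ?posrE.
  - move=> t; rewrite /= in_itv /= andbT => t0.
    have := is_deriveM (is_derive_expR_ln k t0) (is_derive_cst k^-1 t 1).
    by move=> /is_derive_eq; apply; rewrite /GRing.scale /phi' /=; ring.
  - move=> t; rewrite /= in_itv /= andbT => t0.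
    apply: cvgM; last exact: cvg_cst.
    apply: cvgM; last exact: is_derive_continuous (is_derive_expR_ln k t0).
    by apply: cvgM; [exact: cvg_cst|apply: cvgV => //; rewrite gt_eqF].
  - move=> t; rewrite /= in_itv /= andbT => t0.
    apply: ccontinuousM; first exact: continuous_cpow.
    apply: continuous_real_complex.
    by apply: (@continuous_comp _ _ _ (fun t => - t) (@expR R));
      [exact: opp_continuous|exact: continuous_expR].
  - exact: cintegrable_gamma.
  - apply: (@eq_cintegrable _ _ (fun t => cpow k (1 - w) *
      (cpow t (z - 1) * (expR (- (t `^ k / k)))%:C))) => //.
      by move=> t Dt; rewrite e.
    exact: cintegrableZ.
have -> : Gamma w = cint `]0, +oo[ g by rewrite (Gamma_pos w0).
rewrite subst (eq_cint e) cintZ//.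
have -> : 1 - w = - (w - 1) by ring.
by rewrite cpowN mulrA divff ?cpow_neq0// mul1r.
Qed.

(** The coefficients of [W_{v,c}^k (t)], up to the factor [t ^ (v / k)] and a
    constant; [p] stands for [v / k + 1]. *)
Definition bessel_coef k c (p : R[i]) n : R[i] :=
  ((- c / (4 * k)) ^+ n)%:C / (pochhammer p n * n`!%:R).

Lemma bessel_coef0 k c p : bessel_coef k c p 0 = 1.
Proof. by rewrite /bessel_coef expr0 poch0 fact0 mulr1 divr1. Qed.

Lemma cabs_bessel_coef k c p n : cabs (bessel_coef k c p n) =
  `|c / (4 * k)| ^+ n / (cabs (pochhammer p n) * n`!%:R).
Proof.
by rewrite /bessel_coef cabsM cabsV cabsM cabs_real cabs_nat normrX mulNr normrN.
Qed.

Lemma bessel_coef_summable k c p r : ~ nonpos_integer p -> 0 <= r ->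
  cvgn (series (fun n => cabs (bessel_coef k c p n) * r ^+ n)).
Proof.
move=> np r0; pose v n := cabs (bessel_coef k c p n) * r ^+ n.
pose q := `|c / (4 * k)| * r; have q0 : 0 <= q by rewrite mulr_ge0.
have v0 n : 0 <= v n by rewrite mulr_ge0 ?cabs_ge0// exprn_ge0.
have vS n : v n.+1 * (n.+1%:R * cabs (p + n%:R)) = q * v n.
  rewrite /v !cabs_bessel_coef !exprS pochS cabsM factS natrM.
  have h1 : 0 < cabs (p + n%:R) by rewrite cabs_gt0 nonpole_neq0.
  have h2 : 0 < cabs (pochhammer p n) by rewrite cabs_gt0 poch_neq0.
  have h3 : (0 : R) < n`!%:R by rewrite ltr0n fact_gt0.
  have h4 : (0 : R) < n.+1%:R by rewrite ltr0n.
  rewrite /q; move: h1 h2 h3 h4; move: (`|_|) (`|_| ^+ n) (r ^+ n) => D Dn rn.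
  move: (cabs (p + n%:R)) (cabs (pochhammer p n)) (n`!%:R : R) (n.+1%:R : R).
  move=> A B F N h1 h2 h3 h4; field.
  by rewrite !gt_eqF.
have [J hJ] := nat_above (q + `|Re p| + 2).
suff [] : cvgn (series v) /\ j%:R * v j @[j --> \oo] --> 0 by [].
apply: (@kummer_test R v 1 J ltr01 v0) => n /hJ hn.
have pn : q <= cabs (p + n%:R).
  apply: le_trans (Re_le_cabs _); rewrite Re_add Re_nat.
  have : - `|Re p| <= Re p by rewrite lerNl -normrN ler_norm.
  lra.
have n2 : (2 : R) <= n%:R.
  by apply: le_trans hn; rewrite lerDr addr_ge0.
have pp : 0 < cabs (p + n%:R) by rewrite cabs_gt0 nonpole_neq0.
have h : n.+1%:R * v n.+1 <= v n.
  rewrite -(ler_pM2r pp).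
  have -> : n.+1%:R * v n.+1 * cabs (p + n%:R) = v n.+1 * (n.+1%:R * cabs (p + n%:R)) by ring.
  by rewrite vS [leRHS]mulrC ler_wpM2r.
have h2 : 2 * v n <= n%:R * v n by rewrite ler_wpM2r.
rewrite mul1r; move: h h2; lra.
Qed.

Lemma asummable_bessel k c p t : ~ nonpos_integer p ->
  asummable (fun n => bessel_coef k c p n * (t ^+ n.*2)%:C).
Proof.
move=> np.
apply: (@asummable_le R _ (fun n => cabs (bessel_coef k c p n) * (t ^+ 2) ^+ n));
  last by apply: bessel_coef_summable => //; exact: sqr_ge0.
move=> n; by rewrite cabsM cabs_real -mul2n exprM ger0_norm// exprn_ge0// sqr_ge0.
Qed.

(** By [GammakE] the powers of [k] and of 2 combine into [(2 k) ^ (v / k)] and the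
    argument [- c / (4 k)]. *)
Lemma besselkE k c v t : 0 < k -> 0 < t -> ~ nonpos_integer (v / k%:C + 1) ->
  besselk k c v t = (cpow (2 * k) (v / k%:C) * Gamma (v / k%:C + 1))^-1 *
    cpow t (v / k%:C) *
    csum (fun n => bessel_coef k c (v / k%:C + 1) n * (t ^+ n.*2)%:C).
Proof.
move=> k0 t0 np; rewrite /besselk -csumZ; last exact: asummable_bessel.
congr csum; apply/funext => n.
have kC : (k%:C : R[i]) != 0 by rewrite -cabs_eq0 cabs_real normr_eq0 gt_eqF.
rewrite GammakE//.
have -> : ((n%:R * k)%:C + v + k%:C) / k%:C = v / k%:C + 1 + n%:R.
  by rewrite realCM natC; field.
rewrite (Gamma_poch n np).
have -> : v / k%:C + 1 + n%:R - 1 = v / k%:C + n%:R by ring.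
have t2 : 0 < t / 2 by rewrite divr_gt0.
have p2 : (0 : R) < 2 by []. have i2 : (0 : R) < 2^-1 by rewrite invr_gt0.
rewrite (cpowD k) (cpowD (t / 2)) (cpow_nat n k0) (cpow_nat n.*2 t2).
rewrite (cpowMl (v / k%:C) p2 k0) (cpowMl (v / k%:C) t0 i2) (cpowVl (v / k%:C) p2).
rewrite /bessel_coef.
have h1 := Gamma_neq0 np; have h2 := poch_neq0 n np.
have h3 : (n`!%:R : R[i]) != 0 by rewrite pnatr_eq0 -lt0n fact_gt0.
have h4 := cpow_neq0 k (v / k%:C); have h5 := cpow_neq0 2 (v / k%:C).
have h6 : ((k ^+ n)%:C : R[i]) != 0.
  by rewrite -cabs_eq0 cabs_real normr_eq0 expf_neq0// gt_eqF.
have eC : ((- c) ^+ n)%:C / (k ^+ n)%:C * ((t / 2) ^+ n.*2)%:C =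
    ((- c / (4 * k)) ^+ n)%:C * (t ^+ n.*2)%:C :> R[i].
  rewrite -realCV -!realCM -mul2n !exprM -exprVn -!exprMn; congr ((_ ^+ _)%:C).
  by field; rewrite gt_eqF.
move: h1 h2 h3 h4 h5 h6 eC.
move: (Gamma (v / k%:C + 1)) (pochhammer (v / k%:C + 1) n) (n`!%:R : R[i])
  (cpow k (v / k%:C)) (cpow 2 (v / k%:C)) (cpow t (v / k%:C)) ((k ^+ n)%:C : R[i])
  (((- c) ^+ n)%:C : R[i]) (((t / 2) ^+ n.*2)%:C : R[i])
  (((- c / (4 * k)) ^+ n)%:C : R[i]) ((t ^+ n.*2)%:C : R[i]).
move=> G P f X Y Z K A T B U h1 h2 h3 h4 h5 h6 eC.
transitivity ((A / K * T) * (Z / (X * Y * P * G * f))).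
  by field; rewrite h1 h2 h3 h4 h5 h6.
by rewrite eC; field; rewrite h1 h2 h3 h4 h5.
Qed.

End bessel.

(** * Saigo's integral of the k-Bessel function *)

Section saigo_bessel.
Variable R : realType.
Local Notation mu := (@lebesgue_measure R).
Implicit Types (a b alpha s z v p w : R[i]) (x t k c : R).

Lemma poch_double w n : pochhammer w n.*2 =
  4 ^+ n * pochhammer (w / 2) n * pochhammer (w / 2 + 1 / 2) n.
Proof.
elim: n => [|n ih]; first by rewrite !poch0 expr0 !mulr1.
rewrite doubleS !pochS ih exprS -[n.*2.+1%:R]natr1 -mul2n natrM.
by move: (n%:R : R[i]) => N; field.
Qed.

(** The four lower parameters other than [v / k + 1] come in such pairs, so that
    [Gamma (s - beta)] and [Gamma (s + alpha + eta)] are regular values. *)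
Lemma nonpole_half w : ~ nonpos_integer (w / 2) -> ~ nonpos_integer (w / 2 + 1 / 2) ->
  ~ nonpos_integer w.
Proof.
move=> h1 h2 [m mE]; have := odd_double_half m; case: (odd m); move: (m./2) => j /= mm.
- apply: h2; exists j; rewrite mE -mm natrD -mul2n natrM.
  by move: (j%:R : R[i]) => N; field.
- apply: h1; exists j; rewrite mE -mm add0n -mul2n natrM.
  by move: (j%:R : R[i]) => N; field.
Qed.

Lemma exprn_mono t x n : 0 <= t -> t <= x -> t ^+ n <= x ^+ n.
Proof.
move=> t0 tx; elim: n => [|n ih]; first by rewrite !expr0.
by rewrite !exprS ler_pM// exprn_ge0.
Qed.

Lemma in_oo x t : `]0, x[%classic t -> 0 < t < x.
Proof. by rewrite /= in_itv. Qed.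

Definition bessel_series k c p t : R[i] :=
  csum (fun n => bessel_coef k c p n * (t ^+ n.*2)%:C).

Lemma kernel_double a b alpha x s n t : 0 < t ->
  kernel a b alpha x (s + n.*2%:R) t = (t ^+ n.*2)%:C * kernel a b alpha x s t.
Proof. by move=> t0; rewrite kernelD cpow_nat. Qed.

(** On [(0, x)] the kernel at [s + 2 n] is at most [x ^ (2 n)] times the kernel at
    [s], and the coefficients decrease factorially. *)
Lemma kernel_bessel_integral a b alpha x s k c p : 0 < x -> ~ nonpos_integer p ->
  cintegrable `]0, x[ (kernel a b alpha x s) ->
  cintegrable `]0, x[ (fun t => bessel_series k c p t * kernel a b alpha x s t) /\
  series (fun n => bessel_coef k c p n * cint `]0, x[ (kernel a b alpha x (s + n.*2%:R)))
    @ \oo --> cint `]0, x[ (fun t => bessel_series k c p t * kernel a b alpha x s t).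
Proof.
move=> x0 np i0; have mD := measurable_oo 0 x.
pose K := kernel a b alpha x s; pose I := \int[mu]_(t in `]0, x[) cabs (K t).
have iK : mu.-integrable `]0, x[ (EFin \o (fun t => cabs (K t))) by exact: integrable_cabs.
have I0 : 0 <= I by apply: Rintegral_ge0 => t _; exact: cabs_ge0.
pose f n t := bessel_coef k c p n * kernel a b alpha x (s + n.*2%:R) t.
have fE n t : `]0, x[%classic t ->
    f n t = bessel_coef k c p n * (t ^+ n.*2)%:C * K t.
  by move=> /in_oo/andP[t0 _]; rewrite /f kernel_double// mulrA.
have tx2 n t : `]0, x[%classic t -> cabs ((t ^+ n.*2)%:C : R[i]) <= (x ^+ 2) ^+ n.
  move=> /in_oo/andP[t0 tx]; rewrite cabs_real ger0_norm ?exprn_ge0 ?(ltW t0)//.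
  by rewrite -exprM mul2n exprn_mono// ltW.
have kI n : cintegrable `]0, x[ (kernel a b alpha x (s + n.*2%:R)).
  apply: (@eq_cintegrable _ _ (fun t => (t ^+ n.*2)%:C * K t)) => //.
    by move=> t /in_oo/andP[t0 _]; rewrite kernel_double.
  apply: (@cintegrableM _ _ _ _ ((x ^+ 2) ^+ n)) => //; last exact: tx2.
  split; last exact: measurable_cst.
  exact: measurable_funX.
have fI n : cintegrable `]0, x[ (f n) by exact: cintegrableZ.
have fS t : `]0, x[%classic t -> asummable (f ^~ t).
  move=> Dt; apply: (@asummable_le _ _ (fun n => cabs (K t) *
      cabs (bessel_coef k c p n * (t ^+ n.*2)%:C))).
    by move=> n; rewrite fE// cabsM mulrC.
  by apply: is_cvg_series_mull; exact: asummable_bessel.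
have cI : cvgn (series (fun n => \int[mu]_(t in `]0, x[) cabs (f n t))).
  apply: (@series_le_cvg _ _ (fun n => I * (cabs (bessel_coef k c p n) * (x ^+ 2) ^+ n))).
  - by move=> n; apply: Rintegral_ge0 => t _; exact: cabs_ge0.
  - by move=> n; rewrite !mulr_ge0 ?cabs_ge0// exprn_ge0// sqr_ge0.
  - move=> n; rewrite mulrC -RintegralZl//.
    apply: le_Rintegral => //; first exact: integrable_cabs.
      exact: (@integrableZl _ _ _ mu _ mD _ _ iK).
    move=> t Dt; rewrite fE// cabsM cabsM ler_wpM2r ?cabs_ge0//.
    by rewrite ler_wpM2l ?cabs_ge0// tx2.
  - by apply: is_cvg_series_mull; apply: bessel_coef_summable => //; exact: sqr_ge0.
have [ig cs] := cint_series mD fI fS cI.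
have e t : `]0, x[%classic t -> csum (f ^~ t) = bessel_series k c p t * K t.
  move=> Dt; rewrite mulrC /bessel_series -csumZ; last exact: asummable_bessel.
  by congr csum; apply/funext => n; rewrite fE// mulrC.
split; first exact: (eq_cintegrable mD e ig).
rewrite -(eq_cint e).
have -> : (fun n => bessel_coef k c p n * cint `]0, x[ (kernel a b alpha x (s + n.*2%:R)))
    = (fun n => cint `]0, x[ (f n)).
  by apply/funext => n; rewrite cintZ.
exact: cs.
Qed.

(** The constant term is 1, and for [t <= x] the other terms are at most [t / x]
    times their values at [x]. *)
Lemma bessel_series_near0 k c p x : 0 < x -> ~ nonpos_integer p ->
  exists2 d, 0 < d & forall t, 0 < t < d -> 1 / 2 <= cabs (bessel_series k c p t).
Proof.
move=> x0 np.
have sx := @bessel_coef_summable R k c p _ np (sqr_ge0 x).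
pose w n := cabs (bessel_coef k c p n) * (x ^+ 2) ^+ n.
pose W := limn (series w).
have w0 n : 0 <= w n by rewrite mulr_ge0 ?cabs_ge0// exprn_ge0// sqr_ge0.
have W0 : 0 <= W by apply: limr_ge => //; apply: nearW => n; apply: sumr_ge0.
have W1 : 0 < 2 * (W + 1) by rewrite mulr_gt0// ltr_wpDl.
exists (x / (2 * (W + 1))); first by rewrite divr_gt0.
move=> t /andP[t0 td].
have tW : t / x * W <= 1 / 2.
  have h : t / x <= (2 * (W + 1))^-1.
    by rewrite ler_pdivrMr// mulrC ltW.
  apply: le_trans (ler_wpM2r W0 h) _.
  by rewrite mulrC ler_pdivrMr// mulrA mulfVK ?pnatr_eq0// mul1r lerDl.
have tx : t <= x.
  apply: le_trans (ltW td) _; rewrite ler_pdivrMr// ler_peMr// ?(ltW x0)//.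
  by move: W0; lra.
have tx1 : t / x <= 1 by rewrite ler_pdivrMr// mul1r.
have tx0 : 0 <= t / x by rewrite divr_ge0// ltW.
pose u n := bessel_coef k c p n * (t ^+ n.*2)%:C.
pose e (n : nat) : R[i] := (n == 0%N)%:R.
have bnd n : cabs (u n - e n) <= t / x * w n.
  rewrite /u /e; have [->|n0] := eqVneq n 0%N.
    by rewrite bessel_coef0 expr0 mulr1 subrr cabs0 mulr_ge0.
  rewrite subr0 cabsM cabs_real ger0_norm ?exprn_ge0 ?(ltW t0)// /w mulrCA.
  rewrite ler_wpM2l ?cabs_ge0// -mul2n exprM.
  have -> : t ^+ 2 = (t / x) ^+ 2 * x ^+ 2 by rewrite expr_div_n divfK// expf_neq0// gt_eqF.
  rewrite [in leLHS]exprMn_comm; last by rewrite /GRing.comm mulrC.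
  apply: ler_wpM2r; first by apply: exprn_ge0; exact: sqr_ge0.
  rewrite -exprM.
  rewrite -[leRHS]expr1 ler_wiXn2l//.
  by rewrite muln_gt0 andTb lt0n.
have su : asummable u by exact: asummable_bessel.
have sd : asummable (fun n => u n - e n).
  by apply: (asummable_le bnd); exact: is_cvg_series_mull.
have es : asummable e.
  apply: (@asummable_le _ _ w) => // n; rewrite /e.
  have [->|_] := eqVneq n 0%N; last by rewrite cabs0.
  by rewrite /w bessel_coef0 expr0 mulr1.
have ce : csum e = 1.
  apply: csum_cvg; apply: cvg_near_cst; exists 1%N => // n /= n1.
  rewrite /series /= big_ltn//= big_nat_cond big1 ?addr0// => i /andP[/andP[i1 _] _].
  by rewrite /e gtn_eqF.
have dE : csum (fun n => u n - e n) = bessel_series k c p t - 1.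
  have l : series u N - series e N @[N --> \oo] --> csum u - csum e.
    by apply: cvgB; exact: asummable_cvg.
  rewrite ce in l; apply: csum_cvg.
  have sE : series (fun n => u n - e n) = (fun N => series u N - series e N).
    by apply/funext => N; rewrite /series /= sumrB.
  by rewrite sE; exact: l.
have h : cabs (bessel_series k c p t - 1) <= 1 / 2.
  rewrite -dE; apply: le_trans (cabs_csum sd) _; apply: le_trans tW.
  rewrite -(cvg_lim _ (@cvg_series_mull R (t / x) w sx))//.
  by apply: lim_series_le; [exact: sd|exact: is_cvg_series_mull|exact: bnd].
have := cabsB 1 (1 - bessel_series k c p t).
by rewrite subKr cabs1 -cabsN opprB => h2; move: h h2; lra.
Qed.

(** Near 0 the entire series is bounded away from 0, and away from 0 the kernel
    is dominated by the kernel of a large exponent. *)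
Lemma kernel_integrable_of_bessel a b alpha x s k c p :
  0 < x -> 0 < Re alpha -> 0 < Re s -> ~ nonpos_integer p ->
  cintegrable `]0, x[ (fun t => bessel_series k c p t * kernel a b alpha x s t) ->
  cintegrable `]0, x[ (kernel a b alpha x s).
Proof.
move=> x0 al0 s0 np iH; have mD := measurable_oo 0 x.
have [d d0 hd] := bessel_series_near0 k c x0 np.
have [N hN] := nat_above (Re a + Re b + 1).
have sN0 : 0 < Re (s + N%:R) by rewrite Re_add Re_nat (lt_le_trans s0)// lerDl.
have cond : gauss_cond a b (Re (s + N%:R + alpha)).
  left; rewrite !Re_add Re_nat.
  have := hN N (leqnn N); move: s0 al0; lra.
have [iN _] := kernel_integral x0 al0 sN0 cond.
have iH' := integrable_cabs mD iH; have iN' := integrable_cabs mD iN.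
have i1 := @integrableZl _ _ _ mu _ mD 2 _ iH'.
have i2 := @integrableZl _ _ _ mu _ mD (d ^- N) _ iN'.
have i3 := @integrableD _ _ _ mu _ mD _ _ i1 i2.
have kmeas : cmeas `]0, x[ (kernel a b alpha x s).
  apply: (@eq_cmeas _ _ (fun t => cpow t (- N%:R) * kernel a b alpha x (s + N%:R) t)).
    by move=> t _; rewrite -kernelD addrK.
  by apply: cmeasM; [exact: cpow_oo_meas|exact: cintegrable_cmeas].
apply: (@cintegrable_le _ _ _ (fun t =>
  2 * cabs (bessel_series k c p t * kernel a b alpha x s t) +
  d ^- N * cabs (kernel a b alpha x (s + N%:R) t)) mD kmeas); last exact: i3.
move=> t Dt; have [t0 tx] : 0 < t /\ t < x by move: Dt; rewrite /= in_itv /= => /andP[].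
have dN : 0 <= d ^- N by rewrite invr_ge0 exprn_ge0// ltW.
have [td|dt] := ltP t d.
- apply: le_trans (_ : 2 * cabs (bessel_series k c p t * kernel a b alpha x s t) <= _);
    last by rewrite lerDl mulr_ge0 ?cabs_ge0.
  have hb : 1 / 2 <= cabs (bessel_series k c p t) by apply: hd; rewrite t0 td.
  rewrite cabsM mulrA -[leLHS]mul1r ler_wpM2r ?cabs_ge0//; move: hb; lra.
- apply: le_trans (_ : d ^- N * cabs (kernel a b alpha x (s + N%:R) t) <= _);
    last by rewrite lerDr mulr_ge0 ?cabs_ge0.
  rewrite kernelD cabsM cpow_nat// cabs_real ger0_norm ?exprn_ge0 ?(ltW t0)//.
  rewrite mulrA -[leLHS]mul1r ler_wpM2r ?cabs_ge0// mulrC ler_pdivlMr ?exprn_gt0//.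
  by rewrite mul1r exprn_mono// ltW.
Qed.

End saigo_bessel.

(* For k > 1 the hypothesis on Re (lambda + v) does not by itself force the
   integral on the left to converge (take k = 4, c = 0, v = 0, lambda = 1,
   alpha = 1, beta = 1/8, eta = -3/8), so convergence is made explicit: the
   integral converges when lambda/k + v/k satisfies the bound, which for k <= 1
   follows from the hypotheses, and the formula holds whenever it converges. *)
Theorem theorem3p1 (R : realType) (k c x : R) (alpha beta eta lambda v : R[i])
  (hk : 0 < k) (hx : 0 < x)
  (hv : -1 < complex.Re v) (halpha : 0 < complex.Re alpha)
  (hlambda : Num.max 0 (complex.Re (beta - eta)) < complex.Re (lambda + v))
  (hG1 : ~ nonpos_integer (lambda / k%:C + v / k%:C))
  (hG2 : ~ nonpos_integer (lambda / k%:C + v / k%:C + eta - beta))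
  (hb1 : ~ nonpos_integer (v / k%:C + 1))
  (hb2 : ~ nonpos_integer
     (lambda / (2 * k%:C) + v / (2 * k%:C) - beta / 2))
  (hb3 : ~ nonpos_integer
     (lambda / (2 * k%:C) + v / (2 * k%:C) - (beta - 1) / 2))
  (hb4 : ~ nonpos_integer
     (lambda / (2 * k%:C) + v / (2 * k%:C) + (alpha + eta) / 2))
  (hb5 : ~ nonpos_integer
     (lambda / (2 * k%:C) + v / (2 * k%:C) + (alpha + eta + 1) / 2)) :
  let f := fun t : R => cpow t (lambda / k%:C - 1) * besselk k c v t in
  (Num.max 0 (complex.Re (beta - eta)) < complex.Re (lambda / k%:C + v / k%:C) ->
     saigo_defined alpha beta eta f x) /\
  (saigo_defined alpha beta eta f x ->
   saigo alpha beta eta f x =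
     cpow x (lambda / k%:C + v / k%:C - beta - 1) / cpow (2 * k) (v / k%:C)
     * (Gamma (lambda / k%:C + v / k%:C)
        * Gamma (lambda / k%:C + v / k%:C + eta - beta)
        / (Gamma (lambda / k%:C + v / k%:C - beta)
           * Gamma (lambda / k%:C + v / k%:C + alpha + eta)
           * Gamma (v / k%:C + 1)))
     * hypergeometric
         [:: lambda / (2 * k%:C) + v / (2 * k%:C);
             lambda / (2 * k%:C) + v / (2 * k%:C) + 1 / 2;
             lambda / (2 * k%:C) + v / (2 * k%:C) + (eta - beta) / 2;
             lambda / (2 * k%:C) + v / (2 * k%:C) + (eta - beta + 1) / 2]
         [:: v / k%:C + 1;
             lambda / (2 * k%:C) + v / (2 * k%:C) - beta / 2;
             lambda / (2 * k%:C) + v / (2 * k%:C) - (beta - 1) / 2;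
             lambda / (2 * k%:C) + v / (2 * k%:C) + (alpha + eta) / 2;
             lambda / (2 * k%:C) + v / (2 * k%:C) + (alpha + eta + 1) / 2]
         (- (c * x ^+ 2 / (4 * k)))%:C).
Proof.
have kC : (k%:C : R[i]) != 0 by rewrite -cabs_eq0 cabs_real normr_eq0 gt_eqF.
set s := lambda / k%:C + v / k%:C in hG1 hG2 *.
have s2E : lambda / (2 * k%:C) + v / (2 * k%:C) = s / 2 by rewrite /s; field.
rewrite s2E in hb2 hb3 hb4 hb5 *.
set p := v / k%:C + 1 in hb1 *.
move=> f; have mD := measurable_oo 0 x.
have s0 : 0 < Re s.
  have -> : s = (k^-1)%:C * (lambda + v) by rewrite /s realCV; field.
  rewrite Re_realM mulr_gt0 ?invr_gt0// (le_lt_trans _ hlambda)//.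
  by rewrite le_max lexx.
pose a := alpha + beta; pose b := - eta.
pose ka := (cpow (2 * k) (v / k%:C) * Gamma p)^-1.
have ka0 : ka != 0 by rewrite invr_neq0// mulf_neq0 ?cpow_neq0// Gamma_neq0.
have intE t : `]0, x[%classic t -> saigo_integrand alpha beta eta f x t =
    ka * (bessel_series k c p t * kernel a b alpha x s t).
  move=> /in_oo/andP[t0 tx].
  rewrite /saigo_integrand /f /kernel besselkE// -/p -/ka -/(bessel_series k c p t).
  have -> : s - 1 = lambda / k%:C - 1 + v / k%:C by rewrite /s; ring.
  by rewrite (cpowD t (lambda / k%:C - 1)); ring.
have ReC : Re (beta - eta) < Re s -> Re a + Re b < Re (s + alpha).
  rewrite /a /b !Re_add !Re_opp; lra.
split.
  move=> hs; have cond : gauss_cond a b (Re (s + alpha)).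
    by left; apply: ReC; apply: le_lt_trans hs; rewrite le_max lexx orbT.
  have [iK _] := kernel_integral hx halpha s0 cond.
  have [iH _] := @kernel_bessel_integral R a b alpha x s k c p hx hb1 iK.
  apply: (@eq_cintegrable _ _ (fun t => ka * (bessel_series k c p t * kernel a b alpha x s t))) => //.
    by move=> t Dt; rewrite intE.
  exact: cintegrableZ.
move=> iS.
have iH : cintegrable `]0, x[ (fun t => bessel_series k c p t * kernel a b alpha x s t).
  apply: (@eq_cintegrable _ _ (fun t => ka^-1 * saigo_integrand alpha beta eta f x t)) => //.
    by move=> t Dt; rewrite intE// mulKf.
  exact: cintegrableZ.
have iK := kernel_integrable_of_bessel hx halpha s0 hb1 iH.
have cond := kernel_integrable_cond hx halpha s0 iK.
have [_ lim] := @kernel_bessel_integral R a b alpha x s k c p hx hb1 iK.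
have nsb : ~ nonpos_integer (s - beta).
  apply: nonpole_half.
  - by have -> : (s - beta) / 2 = s / 2 - beta / 2 by field.
  - by have -> : (s - beta) / 2 + 1 / 2 = s / 2 - (beta - 1) / 2 by field.
have nsae : ~ nonpos_integer (s + alpha + eta).
  apply: nonpole_half.
  - by have -> : (s + alpha + eta) / 2 = s / 2 + (alpha + eta) / 2 by field.
  - by have -> : (s + alpha + eta) / 2 + 1 / 2 = s / 2 + (alpha + eta + 1) / 2 by field.
have MnE n : cint `]0, x[ (kernel a b alpha x (s + n.*2%:R)) =
    cpow x (s + alpha - 1) * (x ^+ n.*2)%:C * (Gamma alpha *
      (pochhammer s n.*2 * Gamma s) * (pochhammer (s + eta - beta) n.*2 * Gamma (s + eta - beta)) /
    ((pochhammer (s - beta) n.*2 * Gamma (s - beta)) *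
     (pochhammer (s + alpha + eta) n.*2 * Gamma (s + alpha + eta)))).
  have e1 : s + n.*2%:R - beta = s - beta + n.*2%:R by ring.
  have e2 : s + n.*2%:R + alpha + eta = s + alpha + eta + n.*2%:R by ring.
  have e3 : s + n.*2%:R + eta - beta = s + eta - beta + n.*2%:R by ring.
  have e4 : s + n.*2%:R + alpha - 1 = s + alpha - 1 + n.*2%:R by ring.
  have sn0 : 0 < Re (s + n.*2%:R) by rewrite Re_add Re_nat (lt_le_trans s0)// lerDl.
  have condn : gauss_cond a b (Re (s + n.*2%:R + alpha)).
    by apply: gauss_cond_le cond; rewrite !Re_add Re_nat lerD2r lerDl.
  have n1 := @nonpoleS _ _ n.*2 nsb; rewrite -e1 in n1.
  have n2 := @nonpoleS _ _ n.*2 nsae; rewrite -e2 in n2.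
  have n3 := @nonpoleS _ _ n.*2 hG2; rewrite -e3 in n3.
  rewrite (kernel_integralE hx halpha sn0 condn n1 n2 n3) e1 e2 e3 e4.
  rewrite (cpowD x) (cpow_nat _ hx) (Gamma_poch _ hG1) (Gamma_poch _ hG2).
  by rewrite (Gamma_poch _ nsb) (Gamma_poch _ nsae).
set A := [:: _; _; _; _]; set B := [:: _; _; _; _; _]; set y := - (c * x ^+ 2 / (4 * k)).
(* The part of the n-th integral that does not depend on n. *)
pose C0 := cpow x (s + alpha - 1) * (Gamma alpha * Gamma s * Gamma (s + eta - beta) /
  (Gamma (s - beta) * Gamma (s + alpha + eta))).
have g1 := Gamma_neq0 (nonpole_pos halpha). have g2 := Gamma_neq0 hG1.
have g3 := Gamma_neq0 hG2. have g4 := Gamma_neq0 nsb. have g5 := Gamma_neq0 nsae.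
have C00 : C0 != 0.
  rewrite /C0; apply: mulf_neq0; first exact: cpow_neq0.
  apply: mulf_neq0; first exact: mulf_neq0 (mulf_neq0 g1 g2) g3.
  by rewrite invr_eq0; exact: mulf_neq0 g4 g5.
have termE n : bessel_coef k c p n * cint `]0, x[ (kernel a b alpha x (s + n.*2%:R)) =
   C0 * ((\prod_(z <- A) pochhammer z n) / (\prod_(z <- B) pochhammer z n) *
     (y%:C ^+ n / n`!%:R)).
  rewrite MnE /A /B !big_cons !big_nil.
  have -> : s / 2 + (eta - beta) / 2 = (s + eta - beta) / 2 by field.
  have -> : s / 2 + (eta - beta + 1) / 2 = (s + eta - beta) / 2 + 1 / 2 by field.
  have -> : s / 2 - beta / 2 = (s - beta) / 2 by field.
  have -> : s / 2 - (beta - 1) / 2 = (s - beta) / 2 + 1 / 2 by field.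
  have -> : s / 2 + (alpha + eta) / 2 = (s + alpha + eta) / 2 by field.
  have -> : s / 2 + (alpha + eta + 1) / 2 = (s + alpha + eta) / 2 + 1 / 2 by field.
  have q1 := poch_neq0 n.*2 nsb; have q2 := poch_neq0 n.*2 nsae.
  have q3 := poch_neq0 n hb1.
  have q4 : (n`!%:R : R[i]) != 0 by rewrite pnatr_eq0 -lt0n fact_gt0.
  have q5 : (4 ^+ n : R[i]) != 0 by rewrite expf_neq0// pnatr_eq0.
  have yE : ((- c / (4 * k)) ^+ n)%:C * (x ^+ n.*2)%:C = y%:C ^+ n :> R[i].
    rewrite -rmorphXn -realCM -mul2n exprM -exprMn; congr ((_ ^+ _)%:C).
    by rewrite /y; field; rewrite gt_eqF.
  rewrite -yE /bessel_coef /C0.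
  rewrite (poch_double s) (poch_double (s + eta - beta)).
  move: q1 q2; rewrite (poch_double (s - beta)) (poch_double (s + alpha + eta)).
  move: q3 q4 q5 g4 g5.
  move: (pochhammer (s / 2) n) (pochhammer (s / 2 + 1 / 2) n)
    (pochhammer ((s + eta - beta) / 2) n) (pochhammer ((s + eta - beta) / 2 + 1 / 2) n)
    (pochhammer ((s - beta) / 2) n) (pochhammer ((s - beta) / 2 + 1 / 2) n)
    (pochhammer ((s + alpha + eta) / 2) n) (pochhammer ((s + alpha + eta) / 2 + 1 / 2) n)
    (pochhammer p n) (n`!%:R : R[i]) (4 ^+ n : R[i]).
  move: (Gamma alpha) (Gamma s) (Gamma (s + eta - beta)) (Gamma (s - beta))
    (Gamma (s + alpha + eta)) (cpow x (s + alpha - 1)).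
  move: (((- c / (4 * k)) ^+ n)%:C : R[i]) ((x ^+ n.*2)%:C : R[i]).
  move=> Cn Xn Ga Gs Ge Gd Gf X S1 S2 E1 E2 D1 D2 F1 F2 P f4 N4 q3 q4 q5 g4 g5.
  rewrite !mulf_eq0 !negb_or => /andP[/andP[_ q6] q7] /andP[/andP[_ q8] q9].
  by field; rewrite q3 q4 q5 q6 q7 q8 q9 g4 g5.
pose T n := (\prod_(z <- A) pochhammer z n) / (\prod_(z <- B) pochhammer z n) *
     (y%:C ^+ n / n`!%:R).
set L := cint _ _ in lim.
have TL : series T @ \oo --> C0^-1 * L.
  have -> : series T = (fun N => C0^-1 * series (fun n => bessel_coef k c p n *
      cint `]0, x[ (kernel a b alpha x (s + n.*2%:R))) N).
    apply/funext => N; rewrite /series /= mulr_sumr; apply: eq_bigr => n _.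
    by rewrite termE mulKf.
  by apply: cvgM; [exact: cvg_cst|exact: lim].
have hyp : hypergeometric A B y%:C = C0^-1 * L by exact: csum_cvg TL.
have LE : L = C0 * hypergeometric A B y%:C by rewrite hyp mulVKf.
rewrite /saigo (eq_cint intE) cintZ// -/L LE.
have -> : s - beta - 1 = - alpha - beta + (s + alpha - 1) by ring.
rewrite (cpowD x (- alpha - beta)) /C0 /ka.
have g6 := Gamma_neq0 hb1. have g7 := cpow_neq0 (2 * k) (v / k%:C).
move: g1 g4 g5 g6 g7.
move: (Gamma alpha) (Gamma s) (Gamma (s + eta - beta)) (Gamma (s - beta))
  (Gamma (s + alpha + eta)) (Gamma p) (cpow x (s + alpha - 1)) (cpow x (- alpha - beta))
  (cpow (2 * k) (v / k%:C)) (hypergeometric A B y%:C).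
move=> Ga Gs Ge Gd Gf Gp X Y Z H g1 g4 g5 g6 g7.
by field; rewrite g1 g4 g5 g6 g7.
Qed.
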